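(* Let $k$ be a field, let $p$ be a prime number, and let $T$ be a torus over $k$ with character lattice $\hat T$. The following are equivalent: (1) $T$ is $p$-retract rational; (2) the flasque class $[\hat T]^{\mathrm{fl}}$ is $p$-invertible; (3) there exists a commutative diagram of $\mathrm{Gal}(k)$-lattices, consisting of a short exact sequence $0\to \hat T\xrightarrow{j} M\to Q\to 0$, homomorphisms $a:\hat T\to P$ and $b:P\to M$, and an integer $d$ not divisible by $p$, with $P$ and $Q$ permutation lattices, such that $b\circ a=j\circ \varphi_{\hat T,d}$, where $\varphi_{\hat T,d}:\hat T\to\hat T$ is multiplication by $d$.
   Context: For a profinite group $G$, a $G$-lattice is a finitely generated free abelian group with a continuous $G$-action (so the action factors through a finite quotient); homomorphisms of $G$-lattices are $G$-equivariant. A permutation $G$-lattice is a $G$-lattice having a $\mathbb{Z}$-basis permuted by $G$. $\mathrm{Gal}(k)$ is the absolute Galois group of $k$. A $G$-lattice $M$ is $p$-invertible if there is a permutation $G$-lattice $P$ such that $M\otimes_{\mathbb Z}\mathbb{Z}_{(p)}$ is a direct summand of $P\otimes_{\mathbb Z}\mathbb{Z}_{(p)}$ (as $\mathbb{Z}_{(p)}[G]$-modules); equivalently, for some integer $d$ not divisible by $p$, multiplication by $d$ on $M$ factors as $M\to P\to M$ through a permutation $G$-lattice $P$. For $G$ finite, a $G$-lattice $F$ is flasque if $\hat H^{-1}(G',F)=0$ (Tate cohomology) for all subgroups $G'\subseteq G$. Two $G$-lattices $M,N$ are stably equivalent if $M\oplus P\cong N\oplus Q$ for some permutation $G$-lattices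 $P,Q$. Every $G$-lattice $M$ has a flasque resolution, i.e. an exact sequence of $G$-lattices $0\to M\to P\to F\to 0$ with $P$ permutation and $F$ flasque, and the stable equivalence class of $F$ depends only on $M$; it is the flasque class $[M]^{\mathrm{fl}}$. If one lattice in $[M]^{\mathrm{fl}}$ is $p$-invertible, then all are, and one then says that $[M]^{\mathrm{fl}}$ is $p$-invertible. For a $k$-torus $T$, $\hat T$ is regarded as a $\mathrm{Gal}(L/k)$-lattice for a finite Galois extension $L/k$ splitting $T$ when forming $[\hat T]^{\mathrm{fl}}$. A $k$-variety $X$ (integral) is $p$-retract rational if there exist an integer $n$, a $k$-variety $X'$, a finite dominant morphism $f:X'\to X$ of degree not divisible by $p$, a morphism $s:X'\to\mathbb{A}^n_k$ and a rational map $\pi:\mathbb{A}^n_k\dashrightarrow X$ such that $\pi\circ s$ is defined (the image of $s$ meets the domain of definition of $\pi$) and equals $f$ as a rational map. *)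

(* Defs.v *)
From HB Require Import structures.
From mathcomp Require Import all_boot all_order all_fingroup all_algebra all_field.
From mathcomp Require Import boolp.
From mathcomp.multinomials Require Import mpoly.

Set Implicit Arguments.
Unset Strict Implicit.
Unset Printing Implicit Defensive.

Import GRing.Theory.
Local Open Scope ring_scope.

(* The structure map is explicit (no comAlgType), so that restriction of
   scalars is just a composition of ring morphisms. *)
Record kalg (k : fieldType) := KAlg {
  kring :> comPzRingType;
  kstr : {rmorphism k -> kring} }.

Record khom (k : fieldType) (A B : kalg k) := KHom {
  kfun :> {rmorphism A -> B};
  khomP : forall c, kfun (kstr A c) = kstr B c }.

Lemma khom_eq (k : fieldType) (A B : kalg k) (f g : khom A B) :
  f =1 g -> f = g.
Proof.
case: f g => [[f [[[f0 fD]] [[f1 fM]]]] fP] [[g [[[g0 gD]] [[g1 gM]]]] gP] /= fg.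
have E : f = g by apply: funext.
subst g.
have ? := Prop_irrelevance f0 g0; subst g0.
have ? := Prop_irrelevance fD gD; subst gD.
have ? := Prop_irrelevance f1 g1; subst g1.
have ? := Prop_irrelevance fM gM; subst gM.
by have ? := Prop_irrelevance fP gP; subst gP.
Qed.

Fact kid_subproof (k : fieldType) (A : kalg k) (c : k) :
  (idfun : {rmorphism A -> A}) (kstr A c) = kstr A c.
Proof. by []. Qed.

Definition kid (k : fieldType) (A : kalg k) : khom A A :=
  KHom (@kid_subproof k A).

Fact kcomp_subproof (k : fieldType) (A B C : kalg k) (g : khom B C)
    (f : khom A B) (c : k) :
  (kfun g \o kfun f : {rmorphism A -> C}) (kstr A c) = kstr C c.
Proof. by rewrite /= !khomP. Qed.

Definition kcomp (k : fieldType) (A B C : kalg k) (g : khom B C)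
  (f : khom A B) : khom A C := KHom (kcomp_subproof g f).

Section Restriction.
Variables (k K : fieldType) (i : {rmorphism k -> K}).

Definition kres (R : kalg K) : kalg k :=
  @KAlg k R (kstr R \o i : {rmorphism k -> R}).

Fact kres_hom_subproof (R S : kalg K) (h : khom R S) (c : k) :
  (kfun h : {rmorphism kres R -> kres S}) (kstr (kres R) c) = kstr (kres S) c.
Proof. exact: (khomP h). Qed.

Definition kres_hom (R S : kalg K) (h : khom R S) : khom (kres R) (kres S) :=
  KHom (kres_hom_subproof h).

End Restriction.

Definition mpoly_alg (k : fieldType) (n : nat) : kalg k :=
  @KAlg k {mpoly k[n]} (@mpolyC n k : {rmorphism k -> {mpoly k[n]}}).

(* An integral affine k-variety, given by its coordinate ring, an integral
   k-algebra of finite type.  A morphism X -> Y is a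
   khom (coord_alg Y) (coord_alg X). *)
Record affvar (k : fieldType) := AffVar {
  coord : idomainType;
  coord_str : {rmorphism k -> coord};
  affvar_ft : exists (n : nat) (f : khom (mpoly_alg k n) (KAlg coord_str)),
    forall a : coord, exists u, f u = a }.

Definition coord_alg (k : fieldType) (X : affvar k) : kalg k :=
  KAlg (coord_str X).

Fact affspace_subproof (k : fieldType) (n : nat) :
  exists (m : nat) (f : khom (mpoly_alg k m)
     (KAlg (@mpolyC n k : {rmorphism k -> {mpoly k[n]}}))),
    forall a : {mpoly k[n]}, exists u, f u = a.
Proof. by exists n, (kid (mpoly_alg k n)) => a; exists a. Qed.

Definition affspace (k : fieldType) (n : nat) : affvar k :=
  @AffVar k {mpoly k[n]} _ (affspace_subproof k n).

Definition funfield (k : fieldType) (X : affvar k) : kalg k :=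
  @KAlg k {fraction coord X}
    (@tofrac (coord X) \o coord_str X : {rmorphism k -> {fraction coord X}}).

Section Morphisms.
Variables (k : fieldType) (X' X : affvar k).
Variable f : khom (coord_alg X) (coord_alg X').

Definition finite_morphism : Prop :=
  exists (m : nat) (e : 'I_m -> coord X'), forall b : coord X',
  exists c : 'I_m -> coord X, b = \sum_(l < m) f (c l) * e l.

(* The affine schemes being integral, f is dominant iff the map on coordinate
   rings is injective. *)
Definition dominant : Prop := injective f.

Definition in_base_funfield (z : {fraction coord X'}) : Prop :=
  exists a b : coord X, b != 0 /\ z = tofrac (f a) / tofrac (f b).

(* [k(X') : k(X)] = d, by a basis of k(X') over the image of k(X). *)
Definition morphism_degree (d : nat) : Prop :=
  exists e : 'I_d -> {fraction coord X'}, forall z,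
  exists! c : {ffun 'I_d -> {fraction coord X'}},
    (forall l, in_base_funfield (c l)) /\ z = \sum_(l < d) c l * e l.

End Morphisms.

(* A rational map from the integral variety Y to the affine variety X is the
   same as a k-algebra map k[X] -> k(Y), because k[X] is finitely generated. *)
Definition ratmap (k : fieldType) (Y X : affvar k) : Type :=
  khom (coord_alg X) (funfield Y).

(* Points of an affine variety are the prime ideals of its coordinate ring. *)
Definition regular_at (k : fieldType) (Y : affvar k) (y : {pred coord Y})
    (z : {fraction coord Y}) : Prop :=
  exists u v : coord Y, v \notin y /\ z = tofrac u / tofrac v.

Definition ratmap_dom (k : fieldType) (Y X : affvar k) (pi : ratmap Y X)
    (y : {pred coord Y}) : Prop :=
  forall a : coord X, regular_at y (pi a).

Definition comp_defined (k : fieldType) (Z Y X : affvar k) (pi : ratmap Y X)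
    (s : khom (coord_alg Y) (coord_alg Z)) : Prop :=
  exists z : prime_idealr (coord Z),
    ratmap_dom pi [pred v : coord Y | s v \in (z : {pred coord Z})].

(* pi o s = f as rational maps, i.e. pi^* a = u / v with s^* v <> 0 implies
   f^* a = s^* u / s^* v in k(Z). *)
Definition comp_eq (k : fieldType) (Z Y X : affvar k) (pi : ratmap Y X)
    (s : khom (coord_alg Y) (coord_alg Z))
    (f : khom (coord_alg X) (coord_alg Z)) : Prop :=
  forall (a : coord X) (u v : coord Y),
    s v != 0 -> pi a = tofrac u / tofrac v ->
    tofrac (f a) = tofrac (s u) / tofrac (s v) :> {fraction coord Z}.

(* A scheme finite over an affine scheme is affine, so restricting X' to
   affine varieties loses nothing. *)
Definition p_retract_rational (k : fieldType) (p : nat) (X : affvar k) : Prop :=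
  exists (n : nat) (X' : affvar k) (f : khom (coord_alg X) (coord_alg X')),
    [/\ finite_morphism f, dominant f,
        exists d : nat, morphism_degree f d /\ ~~ (p %| d)%N
      & exists (s : khom (coord_alg (affspace k n)) (coord_alg X'))
               (pi : ratmap (affspace k n) X),
          comp_defined pi s /\ comp_eq pi s f].

Definition points (k : fieldType) (X : affvar k) (R : kalg k) : Type :=
  khom (coord_alg X) R.

(* A group variety as a group structure on its functor of points. *)
Record groupvar (k : fieldType) := GroupVar {
  gvar :> affvar k;
  gmul : forall R : kalg k, points gvar R -> points gvar R -> points gvar R;
  gone : forall R : kalg k, points gvar R;
  ginv : forall R : kalg k, points gvar R -> points gvar R;
  gmul_nat : forall (R S : kalg k) (h : khom R S) (x y : points gvar R),
    kcomp h (gmul x y) = gmul (kcomp h x) (kcomp h y);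
  gmulA : forall (R : kalg k), associative (@gmul R);
  gmul1 : forall (R : kalg k), left_id (gone R) (@gmul R);
  gmulV : forall (R : kalg k), left_inverse (gone R) (@ginv R) (@gmul R) }.

Section Characters.
Variables (k K : fieldType) (T : groupvar k) (i : {rmorphism k -> K}).

(* Characters of T_K, i.e. homomorphisms T_K -> G_m of group functors on
   K-algebras; note that T_K(R) = T(R) for a K-algebra R. *)
Record character := Character {
  chi :> forall R : kalg K, points T (kres i R) -> R;
  chi_unit : forall (R : kalg K) (x : points T (kres i R)),
    exists v : R, chi x * v = 1;
  chiM : forall (R : kalg K) (x y : points T (kres i R)),
    chi (gmul x y) = chi x * chi y;
  chi_nat : forall (R S : kalg K) (h : khom R S) (x : points T (kres i R)),
    h (chi x) = chi (kcomp (kres_hom i h) x) }.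

(* T_K is isomorphic to a power of G_m: some tuple of characters is a bijection
   T_K(R) -> (R^* )^n for all K-algebras R. *)
Definition split_over : Prop :=
  exists (n : nat) (c : 'I_n -> character),
  forall (R : kalg K) (u : 'I_n -> R),
    (forall l, exists v : R, u l * v = 1) ->
    exists! x : points T (kres i R), forall l, c l R x = u l.

End Characters.

Definition is_sep_closure (k Om : fieldType) (i : {rmorphism k -> Om}) : Prop :=
  (forall x : Om, exists q : {poly k},
      separable_poly q /\ root (map_poly i q) x) /\
  (forall q : {poly Om}, separable_poly q -> (1 < size q)%N ->
      exists x, root q x).

Definition is_torus (k ks : fieldType) (i : {rmorphism k -> ks})
  (T : groupvar k) : Prop := split_over T i.

Record kaut (k K : fieldType) (i : {rmorphism k -> K}) := KAut {
  kautf :> {rmorphism K -> K};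
  kautV : {rmorphism K -> K};
  kautK : cancel kautf kautV;
  kautVK : cancel kautV kautf;
  kautP : forall c, kautf (i c) = i c }.

Section KAut.
Variables (k K : fieldType) (i : {rmorphism k -> K}).

Lemma rmorph_eq (f g : {rmorphism K -> K}) : f =1 g -> f = g.
Proof.
case: f g => [f [[[f0 fD]] [[f1 fM]]]] [g [[[g0 gD]] [[g1 gM]]]] /= fg.
have E : f = g by apply: funext.
subst g.
have ? := Prop_irrelevance f0 g0; subst g0.
have ? := Prop_irrelevance fD gD; subst gD.
have ? := Prop_irrelevance f1 g1; subst g1.
by have ? := Prop_irrelevance fM gM; subst gM.
Qed.

Lemma kaut_eq (s t : kaut i) : s =1 t -> s = t.
Proof.
case: s t => [f f' fK f'K fP] [g g' gK g'K gP] /= fg.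
have E : f = g by apply: rmorph_eq.
subst g.
have E : f' = g' by apply: rmorph_eq => x; rewrite -{1}(g'K x) fK.
subst g'.
have ? := Prop_irrelevance fK gK; subst gK.
have ? := Prop_irrelevance f'K g'K; subst g'K.
by have ? := Prop_irrelevance fP gP; subst gP.
Qed.

HB.instance Definition _ := gen_eqMixin (kaut i).
HB.instance Definition _ := gen_choiceMixin (kaut i).

Definition kaut1 : kaut i :=
  @KAut k K i idfun idfun (fun=> erefl) (fun=> erefl) (fun=> erefl).

Fact kautVP (s : kaut i) c : kautV s (i c) = i c.
Proof. by rewrite -{1}(kautP s c) kautK. Qed.

Definition kaut_inv (s : kaut i) : kaut i :=
  KAut (kautVK s) (kautK s) (kautVP s).

(* As for gal_of in galois.v, (s * t) x = t (s x). *)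
Fact kaut_mulP (s t : kaut i) c : (kautf t \o kautf s) (i c) = i c.
Proof. by rewrite /= !kautP. Qed.

Definition kaut_mul (s t : kaut i) : kaut i :=
  @KAut k K i (kautf t \o kautf s) (kautV s \o kautV t)
    (can_comp (kautK t) (kautK s)) (can_comp (kautVK s) (kautVK t))
    (kaut_mulP s t).

Fact kaut_mulA : associative kaut_mul.
Proof. by move=> s t u; apply: kaut_eq. Qed.
Fact kaut_mul1g : left_id kaut1 kaut_mul.
Proof. by move=> s; apply: kaut_eq. Qed.
Fact kaut_mulg1 : right_id kaut1 kaut_mul.
Proof. by move=> s; apply: kaut_eq. Qed.
Fact kaut_mulVg : left_inverse kaut1 kaut_inv kaut_mul.
Proof. by move=> s; apply: kaut_eq => x /=; rewrite kautVK. Qed.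
Fact kaut_mulgV : right_inverse kaut1 kaut_inv kaut_mul.
Proof. by move=> s; apply: kaut_eq => x /=; rewrite kautK. Qed.

HB.instance Definition _ :=
  isGroup.Build (kaut i) kaut_mulA kaut_mul1g kaut_mulg1 kaut_mulVg kaut_mulgV.

End KAut.

(* A lattice of rank n is Z^n with G acting through matrices on row vectors,
   v |-> v *m act g.  This is a right action for the product of G; since the
   products of gal_of and kaut are opposite to composition, it is a left action
   of the Galois group in the usual sense.  A homomorphism M -> N is an
   equivariant matrix f acting by v |-> v *m f. *)
Record lattice (G : groupType) (n : nat) := Lattice {
  act :> G -> 'M[int]_n;
  act1 : act 1%g = 1%:M;
  actM : forall g h : G, act (g * h)%g = act g *m act h }.

Section Lattices.
Variable G : groupType.

Definition equivariant (m n : nat) (M : lattice G m) (N : lattice G n)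
    (f : 'M[int]_(m, n)) : Prop :=
  forall g, act M g *m f = f *m act N g.

Definition permutation_lattice (n : nat) (P : lattice G n) : Prop :=
  exists2 B : 'M[int]_n, B \in unitmx &
    forall (g : G) (r : 'I_n), exists r' : 'I_n,
      row r B *m act P g = row r' B.

Definition lattice_iso (m n : nat) (M : lattice G m) (N : lattice G n) : Prop :=
  exists (f : 'M[int]_(m, n)) (h : 'M[int]_(n, m)),
    [/\ equivariant M N f, equivariant N M h, f *m h = 1%:M & h *m f = 1%:M].

Section Sum.
Variables (m n : nat) (M : lattice G m) (N : lattice G n).

Definition dsum_act (g : G) : 'M[int]_(m + n) :=
  block_mx (act M g) 0 0 (act N g).

Fact dsum_act1 : dsum_act 1%g = 1%:M.
Proof. by rewrite /dsum_act !act1 scalar_mx_block. Qed.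

Fact dsum_actM g h : dsum_act (g * h)%g = dsum_act g *m dsum_act h.
Proof.
by rewrite /dsum_act !actM mulmx_block !mul0mx !mulmx0 !addr0 !add0r.
Qed.

Definition dsum : lattice G (m + n) := Lattice dsum_act1 dsum_actM.

End Sum.

Definition stably_equivalent (m n : nat) (M : lattice G m) (N : lattice G n) :
    Prop :=
  exists (r s : nat) (P : lattice G r) (Q : lattice G s),
    [/\ permutation_lattice P, permutation_lattice Q
      & lattice_iso (dsum M P) (dsum N Q)].

Definition short_exact (l m n : nat) (L : lattice G l) (M : lattice G m)
    (N : lattice G n) (j : 'M[int]_(l, m)) (q : 'M[int]_(m, n)) : Prop :=
  [/\ equivariant L M j /\ equivariant M N q,
      forall v : 'rV_l, v *m j = 0 -> v = 0,
      forall w : 'rV_m, w *m q = 0 <-> exists v : 'rV_l, w = v *m j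
    & forall u : 'rV_n, exists w : 'rV_m, u = w *m q].

(* Matrices over Z_(p), viewed inside the matrices over Q. *)
Definition Zp_mx (p m n : nat) (A : 'M[rat]_(m, n)) : Prop :=
  forall r s, ~~ (p %| `|denq (A r s)|)%N.

(* Homomorphisms of Z_(p)[G]-modules from M (x) Z_(p) to N (x) Z_(p). *)
Definition Zp_hom (p m n : nat) (M : lattice G m) (N : lattice G n)
    (f : 'M[rat]_(m, n)) : Prop :=
  Zp_mx p f /\
  forall g, map_mx intr (act M g) *m f = f *m map_mx intr (act N g).

Definition p_invertible (p n : nat) (M : lattice G n) : Prop :=
  exists (r : nat) (P : lattice G r) (f : 'M[rat]_(n, r)) (h : 'M[rat]_(r, n)),
    [/\ permutation_lattice P, Zp_hom p M P f, Zp_hom p P M h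
      & f *m h = 1%:M].

End Lattices.

Section Flasque.
Variable gT : finGroupType.

(* \hat H^{-1}(H, F) is the kernel of the norm modulo the subgroup generated by
   the v.h - v. *)
Definition flasque (n : nat) (F : lattice gT n) : Prop :=
  forall (H : {group gT}) (v : 'rV[int]_n),
    v *m (\sum_(h in H) act F h) = 0 ->
    exists w : gT -> 'rV[int]_n, v = \sum_(h in H) (w h *m act F h - w h).

Definition in_flasque_class (m n : nat) (M : lattice gT m) (N : lattice gT n) :
    Prop :=
  exists (r s : nat) (P : lattice gT r) (F : lattice gT s)
         (j : 'M[int]_(m, r)) (q : 'M[int]_(r, s)),
    [/\ permutation_lattice P, flasque F, short_exact M P F j q
      & stably_equivalent F N].

Definition flasque_class_p_invertible (p m : nat) (M : lattice gT m) : Prop :=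
  exists (n : nat) (N : lattice gT n), in_flasque_class M N /\ p_invertible p N.

End Flasque.

Section GaloisLattices.
Variables (k ks : fieldType) (i : {rmorphism k -> ks}).

(* Continuity for the Krull topology: stabilizers of vectors are open. *)
Record gal_lattice (n : nat) := GalLattice {
  gal_lat :> lattice (kaut i) n;
  gal_cont : forall v : 'rV[int]_n, exists S : seq ks,
    forall s : kaut i, {in S, forall x, s x = x} -> v *m act gal_lat s = v }.

Variable T : groupvar k.

Fact twist_subproof (s : kaut i) (R : kalg ks) (x : points T (kres i R)) c :
  (kfun x : {rmorphism coord_alg T -> kres i (kres s R)})
    (kstr (coord_alg T) c) = kstr (kres i (kres s R)) c.
Proof. by rewrite khomP /= kautP. Qed.

(* If R is a ks-algebra with structure map e, then kres s R is R with structure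
   map e \o s; both are the same k-algebra, whence T(R) = T(kres s R). *)
Definition twist (s : kaut i) (R : kalg ks) (x : points T (kres i R)) :
  points T (kres i (kres s R)) := KHom (twist_subproof s x).

(* M is the character lattice of T, through an isomorphism ev.  The conjugate
   of a character c by s is x |-> c (twist s x): if c is given by
   \sum_l a_l (x) b_l in ks (x) k[T], it is given by \sum_l s(a_l) (x) b_l. *)
Definition is_character_lattice (n : nat) (M : gal_lattice n) : Prop :=
  exists ev : 'rV[int]_n -> character T i,
    [/\ forall c : character T i, exists! v : 'rV[int]_n,
          forall (R : kalg ks) (x : points T (kres i R)), ev v R x = c R x,
        forall v w (R : kalg ks) (x : points T (kres i R)),
          ev (v + w) R x = ev v R x * ev w R x
      & forall (s : kaut i) v (R : kalg ks) (x : points T (kres i R)),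
          ev (v *m act M s) R x = ev v (kres s R) (twist s x)].

(* N is M regarded as a Gal(L/k)-lattice, for an embedding e of L into ks. *)
Definition deflation (L : splittingFieldType k) (e : {rmorphism L -> ks})
    (n : nat) (M : gal_lattice n) (N : lattice (gal_of {:L}%AS) n) : Prop :=
  forall (s : kaut i) (g : gal_of {:L}%AS),
    (forall x : L, s (e x) = e (g x)) -> act M s = act N g.

Definition torus_flasque_class_p_invertible (p n : nat) (That : gal_lattice n) :
    Prop :=
  exists (L : splittingFieldType k) (e : {rmorphism L -> ks})
         (N : lattice (gal_of {:L}%AS) n),
    [/\ galois 1%AS {:L}%AS /\ (forall c : k, e (c%:A) = i c),
        split_over T (in_alg L),
        deflation e That N
      & flasque_class_p_invertible p N].

Definition p_factorization (p n : nat) (That : gal_lattice n) : Prop :=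
  exists (m r t : nat) (M : gal_lattice m) (P : gal_lattice r)
         (Q : gal_lattice t) (j : 'M[int]_(n, m)) (q : 'M[int]_(m, t))
         (a : 'M[int]_(n, r)) (b : 'M[int]_(r, m)) (d : int),
    [/\ permutation_lattice P /\ permutation_lattice Q,
        short_exact That M Q j q,
        equivariant That P a /\ equivariant P M b,
        ~~ (p %| d)%Z
      & a *m b = d%:M *m j].

End GaloisLattices.

(* Main.v *)
(* Over a finite Galois extension L/k with group G splitting T, k[T] is the ring of
   G-invariants of the Laurent ring L[T^], and (3) may be checked over G.

   (2) <=> (3) is lattice theory: Ext^1(F, P) = 0 for F flasque and P permutation
   turns a diagram as in (3) into a factorization of d on a flasque class through
   a permutation lattice, and conversely the pull-back of a flasque resolution
   0 -> T^ -> R -> F -> 0 along a map Q -> F, which exists by the p-invertibility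
   of F, provides the sequence 0 -> T^ -> M -> Q -> 0.

   (3) => (1): take X' = T and f = multiplication by d, which has degree |d|^n.
   By Hilbert 90 the permutation lattice Q is lifted to rational functions on T, so
   that multiplication by d on T factors rationally through the quasi-trivial torus
   with character lattice P, which is open in an affine space.

   (1) => (3): the rational map pi pulls the characters of T back to rational
   functions on an affine space, hence to monomials in prime polynomials over L
   permuted by G; these span P.  Sending a prime to the norm, from k(X') to k(T), of
   its restriction along s yields the d-th power of the given character.  M is the
   lattice spanned, modulo L^*, by the characters and by the primes of L[T^] which
   occur in these norms. *)
From HB Require Import structures.
From mathcomp Require Import all_boot all_order all_fingroup all_algebra all_field.
From mathcomp Require Import boolp.
From mathcomp Require classical_sets.
From mathcomp Require Import ring zify.
From mathcomp.multinomials Require Import mpoly.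
Require Import Defs.

Set Implicit Arguments.
Unset Strict Implicit.
Unset Printing Implicit Defensive.

Import GRing.Theory Num.Theory.
Local Open Scope ring_scope.

(** * Lattices *)

(** [T] is known only through its functor of points and its characters over [ks]. A Yoneda argument
    recovers k[T]: a universal point with values in ks[T^] gives a map k[T] -> ks[T^], injective
    because k[T] embeds in its base change, and the finitely many coefficients involved lie in a
    finite Galois extension L. The lattices of a diagram as in (3) come from Gal(L/k) only if L is
    large, so L cannot be fixed before the diagram is given. From (1) to (3), the obstacle is that L
    (x) k(X') need not be a field, so that no field norm is available over L(T). Norms are
    determinants of multiplication matrices over k(T), extended to polynomials over L. They do not
    vanish on the relevant primes, which divide conjugates of polynomials with invertible matrices.
    The lattices in L(T)^* / L^* are free because the Laurent ring is factorial, with units c x^v.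
    From (3) to (1), Hilbert 90 gives rational functions on T only, whereas [s] must be a morphism;
    one more affine coordinate carries their common denominator, so T need not be shrunk. *)

Lemma mulmxnr (R : pzRingType) m n r (A : 'M[R]_(m, n)) (B : 'M_(n, r)) k :
  A *m (B *+ k) = (A *m B) *+ k.
Proof. exact: raddfMn. Qed.

Lemma colMx (R : pzRingType) m n r (A : 'M[R]_(m, n)) (B : 'M_(n, r)) k :
  col k (A *m B) = A *m col k B.
Proof. by apply/colP=> i; rewrite !mxE; apply: eq_bigr => j _; rewrite mxE. Qed.

(** * Integral kernels as direct summands *)

Section IntegerKernels.

(** With C = A D R in Smith normal form, v is in the kernel exactly when v A is supported on the
    zero rows of D. The corresponding rows of A^-1 form a basis [K], and the corresponding columns
    of A give the coordinates [K']: the kernel is a direct summand. *)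
Lemma int_kernel_basis m n (C : 'M[int]_(m, n)) :
  exists (s : nat) (K : 'M[int]_(s, m)) (K' : 'M[int]_(m, s)),
  [/\ K *m K' = 1%:M, K *m C = 0
    & forall v : 'rV_m, v *m C = 0 -> v *m K' *m K = v].
Proof.
have [A uA [R uR [d _ ->]]] := int_Smith_normal_form C.
set D := \matrix_(i, j) _.
pose Z := [pred i : 'I_m | [forall j, D i j == 0]].
exists #|Z|, (rowsub (@enum_val _ Z) (invmx A)), (colsub (@enum_val _ Z) A).
split.
- apply/matrixP=> i j; rewrite mul_rowsub_mx mulmx_colsub !mxE.
  have /matrixP/(_ (enum_val i) (enum_val j)) := mulVmx uA.
  by rewrite !mxE (inj_eq enum_val_inj).
- rewrite mulmxA mulmxA mul_rowsub_mx mulVmx // mul_rowsub_mx mul1mx.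
  rewrite (_ : rowsub _ _ = 0) ?mul0mx //.
  apply/matrixP=> i j; rewrite [LHS]mxE [RHS]mxE.
  by have /forallP/(_ j)/eqP := enum_valP i.
move=> v; rewrite mulmxA => /(congr1 (mulmxr (invmx R))) /=.
rewrite mulmxK // mul0mx mulmxA => vD0.
rewrite mulmx_colsub -[RHS](mulmxK uA).
set u := v *m A in vD0 *.
have u0 i : i \notin Z -> u 0 i = 0.
  move=> /forallPn[j]; rewrite mxE; have [ij|_] := eqVneq (i : nat) j; last by rewrite mulr0n eqxx.
  rewrite mulr1n => di0; have /matrixP/(_ 0 j) := vD0.
  rewrite !mxE (bigD1 i) //= big1 ?addr0 => [|l ne_li].
    rewrite !mxE ij eqxx mulr1n => /eqP; rewrite mulf_eq0 -ij (negPf di0) orbF.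
    by move/eqP.
  rewrite !mxE; case: eqP => [lj | _]; last by rewrite /= mulr0n mulr0.
  by case/eqP: ne_li; apply: val_inj; rewrite /= lj.
apply/rowP=> l; rewrite !mxE [RHS](bigID Z) /= [X in _ + X]big1 ?addr0; last first.
  by move=> i /u0->; rewrite mul0r.
rewrite [RHS]big_enum_val /=; apply: eq_bigr => i _.
by rewrite !mxE.
Qed.

(** The matrices [C i] are placed side by side in a single one, each row being flattened by
    [mxvec]. *)
Lemma int_common_kernel_basis (I : finType) m n (C : I -> 'M[int]_(m, n)) :
  exists (s : nat) (K : 'M[int]_(s, m)) (K' : 'M[int]_(m, s)),
  [/\ K *m K' = 1%:M, forall i, K *m C i = 0
    & forall v : 'rV_m, (forall i, v *m C i = 0) -> v *m K' *m K = v].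
Proof.
pose C' := \matrix_(l < m)
  mxvec (\matrix_(i < #|I|, j < n) C (enum_val i) l j).
have C'E (v : 'rV_m) : v *m C' = mxvec (\matrix_(i, j) (v *m C (enum_val i)) 0 j).
  apply/rowP=> z; case/mxvec_indexP: z => i j; rewrite mxvecE !mxE.
  by apply: eq_bigr => l _; rewrite !mxE mxvecE mxE.
have [s [K [K' [KK' KC' ker]]]] := int_kernel_basis C'.
exists s, K, K'; split=> // [i | v vC].
  apply/row_matrixP=> l; rewrite row_mul row0.
  have := congr1 (row l) KC'; rewrite row_mul row0 C'E => /(congr1 vec_mx).
  rewrite mxvecK linear0 => /matrixP eqC; apply/rowP=> j.
  by have := eqC (enum_rank i) j; rewrite !mxE enum_rankK.
apply: ker; rewrite C'E; apply: (canLR vec_mxK); rewrite linear0.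
by apply/matrixP=> i j; rewrite mxE vC !mxE.
Qed.

End IntegerKernels.

Section Splitting.
Variables (G : groupType) (l m n : nat).
Variables (L : lattice G l) (M : lattice G m) (N : lattice G n).

(** The quotient is free, so the sequence splits over the integers, though not equivariantly.
    Extensions are computed throughout in the coordinates given by the section [sg] and the
    retraction [rho]. *)
Lemma short_exact_split (j : 'M[int]_(l, m)) (q : 'M[int]_(m, n)) :
  short_exact L M N j q ->
  exists (sg : 'M[int]_(n, m)) (rho : 'M[int]_(m, l)),
  [/\ sg *m q = 1%:M, j *m rho = 1%:M, rho *m j + q *m sg = 1%:M, j *m q = 0
    & sg *m rho = 0].
Proof.
case=> _ j_inj kerq surj.
have jq0 : j *m q = 0.
  apply/row_matrixP=> i; rewrite row_mul row0; apply/kerq.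
  by exists (delta_mx 0 i); rewrite rowE.
have mx_inj k (A : 'M[int]_(k, l)) : A *m j = 0 -> A = 0.
  move=> Aj; apply/row_matrixP=> i; rewrite row0; apply: j_inj.
  by rewrite -row_mul Aj row0.
have [sg sgE] := choice (fun i : 'I_n => surj (delta_mx 0 i)).
pose S := \matrix_i sg i.
have Sq : S *m q = 1%:M.
  by apply/row_matrixP=> i; rewrite row_mul rowK -sgE row1.
have kerE (i : 'I_m) : exists v : 'rV_l, row i (1%:M - q *m S) = v *m j.
  apply/kerq; rewrite -row_mul mulmxBl mul1mx -mulmxA Sq mulmx1 subrr.
  by rewrite row0.
have [rho rhoE] := choice kerE.
pose Rh := \matrix_i rho i.
have Rhj : Rh *m j = 1%:M - q *m S.
  by apply/row_matrixP=> i; rewrite row_mul rowK -rhoE.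
exists S, Rh; split=> //.
- apply/eqP; rewrite -subr_eq0; apply/eqP/mx_inj.
  by rewrite mulmxBl -mulmxA Rhj mulmxBr mulmx1 mulmxA jq0 mul0mx subr0 mul1mx subrr.
- by rewrite Rhj subrK.
apply: mx_inj; rewrite -mulmxA Rhj mulmxBr mulmx1 mulmxA Sq mul1mx.
exact: subrr.
Qed.

End Splitting.

Section PermutationLattices.
Variable G : groupType.

(** The definition provides some image index for each g and each row. The rows of an invertible
    matrix being distinct, this index is unique and the choices form an action. *)
Lemma perm_latticeP r (P : lattice G r) : permutation_lattice P ->
  exists (B B' : 'M[int]_r) (s : G -> 'I_r -> 'I_r),
  [/\ B *m B' = 1%:M, B' *m B = 1%:M,
      forall g i, row i B *m P g = row (s g i) B,
      forall i, s 1%g i = i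
    & forall g h i, s (g * h)%g i = s h (s g i)].
Proof.
case=> B uB PB; pose s g := projT1 (choice (PB g)).
have sE g i : row i B *m P g = row (s g i) B := projT2 (choice (PB g)) i.
clearbody s.
have rowB_inj : injective (fun i => row i B).
  move=> i i' /(congr1 (mulmxr (invmx B))) /=.
  rewrite -!row_mul mulmxV // !row1 => /matrixP/(_ 0 i).
  by rewrite !mxE !eqxx eq_sym; case: eqP => // ->.
exists B, (invmx B), s; split=> //; rewrite ?mulmxV ?mulVmx //.
  by move=> i; apply: rowB_inj; rewrite /= -sE act1 mulmx1.
by move=> g h i; apply: rowB_inj; rewrite -!sE actM mulmxA.
Qed.

Lemma perm_lattice_of_action r (P : lattice G r) (s : G -> 'I_r -> 'I_r) :
  (forall g i, row i (P g) = delta_mx 0 (s g i)) -> permutation_lattice P.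
Proof.
move=> Ps; exists 1%:M; first exact: unitmx1.
by move=> g i; exists (s g i); rewrite -row_mul mul1mx Ps row1.
Qed.

Lemma perm_lattice_dsum m n (P : lattice G m) (Q : lattice G n) :
  permutation_lattice P -> permutation_lattice Q ->
  permutation_lattice (dsum P Q).
Proof.
move=> [B uB PB] [C uC QC]; exists (block_mx B 0 0 C).
  by rewrite unitmxE det_ublock unitrM -!unitmxE uB.
move=> g i; rewrite /= /dsum_act -row_mul mulmx_block !(mulmx0, mul0mx, addr0, add0r).
case: (split_ordP i) => k ->.
  have [k' Ek] := PB g k; exists (lshift _ k').
  by rewrite !rowKu !row_row_mx !row0 row_mul Ek.
have [k' Ek] := QC g k; exists (rshift _ k').
by rewrite !rowKd !row_row_mx !row0 row_mul Ek.
Qed.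

Definition lattice0 : lattice G 0 :=
  @Lattice G 0 (fun=> 1%:M) erefl (fun _ _ => esym (mulmx1 _)).

Lemma perm_lattice0 : permutation_lattice lattice0.
Proof. by exists 1%:M => [|g []]; rewrite ?unitmx1. Qed.

Lemma equivariant_comp m n r (M : lattice G m) (N : lattice G n)
    (R : lattice G r) f h :
  equivariant M N f -> equivariant N R h -> equivariant M R (f *m h).
Proof. by move=> eqf eqh g; rewrite mulmxA eqf -!mulmxA eqh. Qed.

Lemma lattice_iso_refl n (M : lattice G n) : lattice_iso M M.
Proof. by exists 1%:M, 1%:M; split=> [g|g||]; rewrite ?mul1mx ?mulmx1. Qed.

Lemma stably_equivalent_refl n (M : lattice G n) : stably_equivalent M M.
Proof.
exists 0, 0, lattice0, lattice0; split; try exact: perm_lattice0.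
exact: lattice_iso_refl.
Qed.

End PermutationLattices.

(** * Flasque lattices and the vanishing of Ext^1(F, P) *)

Section FiniteGroup.
Variable gT : finGroupType.
Implicit Types (H : {group gT}).

Definition norm_mx n (F : lattice gT n) H : 'M[int]_n := \sum_(h in H) F h.

Lemma act_norm_mx n (F : lattice gT n) H h :
  h \in H -> F h *m norm_mx F H = norm_mx F H.
Proof.
move=> Hh; rewrite /norm_mx [RHS](reindex_inj (mulgI h)) /= mulmx_sumr.
by apply: eq_big => g; rewrite ?groupMl // => _; rewrite actM.
Qed.

Lemma norm_mx_act n (F : lattice gT n) H h :
  h \in H -> norm_mx F H *m F h = norm_mx F H.
Proof.
move=> Hh; rewrite /norm_mx [RHS](reindex_inj (mulIg h)) /= mulmx_suml.
by apply: eq_big => g; rewrite ?groupMr // => _; rewrite actM.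
Qed.

Lemma equivariant_norm m n (M : lattice gT m) (N : lattice gT n) f H :
  equivariant M N f -> norm_mx M H *m f = f *m norm_mx N H.
Proof. by move=> eqf; rewrite mulmx_suml mulmx_sumr; apply: eq_bigr. Qed.

(** [rho] picks one representative in each H-orbit, and [h_ i] carries the representative of the
    orbit of i to i. *)
Lemma orbit_transversal H (T : finType) (s : gT -> T -> T) :
  (forall i, s 1%g i = i) -> (forall g h i, s (g * h)%g i = s h (s g i)) ->
  exists (rho : T -> T) (h_ : T -> gT),
    (forall i, h_ i \in H /\ s (h_ i) (rho i) = i)
    /\ (forall i h, h \in H -> rho (s h i) = rho i).
Proof.
move=> s1 sM; pose orb i := [set s h i | h in H].
(* The choice depends only on the set [orb i], hence [rho] is constant on orbits; the default i is
   never reached, since i lies in [orb i]. *)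
pose rho (i : T) : T := odflt i [pick j in orb i].
have orbE i j : j \in orb i -> orb j = orb i.
  case/imsetP=> h Hh ->; apply/setP=> l; apply/imsetP/imsetP=> [] [g Hg ->].
    by exists (h * g)%g; rewrite ?groupM // sM.
  by exists (h^-1 * g)%g; rewrite ?groupM ?groupV // -sM mulgA mulgV mul1g.
have orb_id i : i \in orb i by apply/imsetP; exists 1%g; rewrite ?group1 ?s1.
have rho_orb i : rho i \in orb i.
  by rewrite /rho; case: pickP => //= /(_ i); rewrite orb_id.
have orb_sym i j : j \in orb i -> i \in orb j by move/orbE->.
have exh i : exists h, h \in H /\ s h (rho i) = i.
  by have /orb_sym/imsetP[h Hh Eh] := rho_orb i; exists h; rewrite -Eh.
have [h_ hP] := choice exh; exists rho, h_; split=> // i h Hh.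
have /orbE eq_orb : s h i \in orb i by apply/imsetP; exists h.
by rewrite /rho eq_orb; case: pickP => //= /(_ i); rewrite orb_id.
Qed.

(** A vector of norm zero has coefficient sum zero on each H-orbit. It is then the sum of the u_i
    (e_i - e_rho(i)), and e_i is the image of e_rho(i) under [h_ i]. *)
Lemma flasque_perm r (P : lattice gT r) : permutation_lattice P -> flasque P.
Proof.
move=> /perm_latticeP[B [B' [s [BB' B'B PB s1 sM]]]] H v.
rewrite -/(norm_mx P H) => vN.
have [rho [h_ [hP rhoE]]] := orbit_transversal H s1 sM.
pose u := v *m B'.
have vE : v = \sum_i u 0 i *: row i B by rewrite -mulmx_sum_row -mulmxA B'B mulmx1.
have sumB (c : 'I_r -> int) : \sum_i c i *: row i B = 0 -> forall i, c i = 0.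
  move=> c0 i; have : (\row_l c l) *m B = 0.
    by rewrite mulmx_sum_row -[RHS]c0; apply: eq_bigr => l _; rewrite mxE.
  move/(congr1 (mulmxr B')) => /=; rewrite -mulmxA BB' mulmx1 mul0mx.
  by move/rowP/(_ i); rewrite !mxE.
have rho_idem i : rho (rho i) = rho i.
  by have [Hh Eh] := hP i; rewrite -[in RHS]Eh rhoE.
have normB i : row i B *m norm_mx P H = row (rho i) B *m norm_mx P H.
  have [Hh Eh] := hP i; rewrite -[in LHS](act_norm_mx P (groupVr Hh)) mulmxA PB.
  by rewrite -{2}Eh -sM mulgV s1.
have orbsum t : \sum_(i | rho i == t) u 0 i = 0.
  have [rt | ne_rt] := eqVneq (rho t) t; last first.
    apply: big_pred0 => i; apply: contraNF ne_rt => /eqP <-.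
    by rewrite rho_idem.
  pose k i := \sum_(h in H) (s h (rho i) == t)%:R : int.
  (* At a representative t, the coefficient of the norm of v is the orbit sum times the number of h
     in H fixing t, which is positive because of h = 1. *)
  have /sumB/(_ t): \sum_j (\sum_i u 0 i * \sum_(h in H) (s h (rho i) == j)%:R)
      *: row j B = 0.
    rewrite -[RHS]vN [in RHS]vE mulmx_suml.
    under eq_bigr do rewrite scaler_suml.
    rewrite exchange_big /=; apply: eq_bigr => i _.
    rewrite -scalemxAl normB /norm_mx mulmx_sumr.
    under eq_bigr do rewrite -scalerA.
    rewrite -scaler_sumr; congr (_ *: _).
    under eq_bigr do rewrite scaler_suml.
    rewrite exchange_big /=; apply: eq_bigr => h _; rewrite PB.
    rewrite (bigD1 (s h (rho i))) //= eqxx scale1r big1 ?addr0 // => j.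
    by rewrite eq_sym => /negPf->; rewrite scale0r.
  rewrite (bigID (fun i => rho i == t)) /= [X in _ + X]big1 ?addr0; last first.
    move=> i ne_it; rewrite big1 ?mulr0 // => h Hh; case: eqP => // Et.
    by rewrite -rt -Et rhoE // rho_idem eqxx in ne_it.
  under eq_bigr => i /eqP-> do rewrite mulrC.
  rewrite -mulr_sumr => /eqP; rewrite mulf_eq0 => /orP[] /eqP //.
  rewrite -natr_sum => /eqP; rewrite pnatr_eq0 (bigD1 1%g) //= s1 eqxx.
  by rewrite addSn.
exists (fun h => \sum_(i | h_ i == h) u 0 i *: row (rho i) B).
rewrite {1}vE.
have -> : \sum_i u 0 i *: row i B =
    \sum_i (u 0 i *: row (rho i) B *m P (h_ i) - u 0 i *: row (rho i) B).
  rewrite sumrB [X in _ - X](_ : _ = 0) ?subr0.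
    apply: eq_bigr => i _; have [_ Eh] := hP i.
    by rewrite -scalemxAl PB Eh.
  rewrite (partition_big rho predT) //= big1 // => t _.
  transitivity ((\sum_(i | rho i == t) u 0 i) *: row t B).
    by rewrite scaler_suml; apply: eq_bigr => i /eqP->.
  by rewrite orbsum scale0r.
rewrite (partition_big h_ (mem H)) /= => [|i _]; last by case: (hP i).
apply: eq_bigr => h _; rewrite sumrB mulmx_suml; congr (_ - _).
by apply: eq_bigr => i /eqP->.
Qed.

(* A functional invariant under H extends because the obstruction is a
   1-cocycle of H in the dual of F, and H^1(H, F^* ) is dual to
   \hat H^{-1}(H, F). *)
Lemma flasque_extend_invariant l m n (L : lattice gT l) (M : lattice gT m)
    (F : lattice gT n) j q (H : {group gT}) (phi : 'cV[int]_l) :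
  short_exact L M F j q -> flasque F ->
  (forall h, h \in H -> L h *m phi = phi) ->
  exists psi : 'cV[int]_m,
    j *m psi = phi /\ forall h, h \in H -> M h *m psi = psi.
Proof.
move=> ex flF phiH; have [[eqj eqq] _ _ _] := ex.
have [sg [rho [sgq jrho sumE jq0 _]]] := short_exact_split ex.
(* [psi0] extends [phi] without regard to the action. Its defect [c] takes values in the dual of
   F. *)
pose psi0 := rho *m phi; pose c h := sg *m (M h *m psi0 - psi0).
have cE h : h \in H -> M h *m psi0 = psi0 + q *m c h.
  move=> Hh; apply/eqP; rewrite -subr_eq0 opprD addrA subr_eq0; apply/eqP.
  rewrite -[LHS]mul1mx -sumE mulmxDl -(mulmxA rho) mulmxBr mulmxA -eqj.
  rewrite -(mulmxA (L h)) /psi0 !(mulmxA j) jrho mul1mx phiH // subrr mulmx0.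
  by rewrite add0r -mulmxA.
pose f := \sum_(h in H) c h; pose m0 := #|H|.
have qinj (x y : 'cV_n) : q *m x = q *m y -> x = y.
  by move/(congr1 (mulmx sg)); rewrite !mulmxA sgq !mul1mx.
have normE : norm_mx M H *m psi0 = psi0 *+ m0 + q *m f.
  rewrite mulmx_suml -sumr_const mulmx_sumr -big_split /=.
  by apply: eq_bigr => h /cE.
(* Summation over H makes |H| c the coboundary of [f]. It remains to divide [f] by |H| after adding
   an invariant. *)
have cf h : h \in H -> c h *+ m0 = f - F h *m f.
  move=> Hh; have : M h *m (psi0 *+ m0 + q *m f) = psi0 *+ m0 + q *m f.
    by rewrite -normE mulmxA act_norm_mx.
  rewrite mulmxDr mulmxnr cE // mulrnDl mulmxA eqq -mulmxA => E; apply: qinj.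
  apply: (addrI (psi0 *+ m0)); rewrite mulmxBr addrA -E addrK.
  by rewrite mulmxnr.
(* In coordinates that diagonalize the norm, the rows of A^-1 with D_ii = 0 are killed by the norm,
   and the columns of A with D_kk != 0 are H-invariant functionals. *)
have [A uA [R uR [d _ ND]]] := int_Smith_normal_form (norm_mx F H).
set D := \matrix_(i, j) _ in ND.
have kerA i : D i i = 0 -> row i (invmx A) *m norm_mx F H = 0.
  move=> Di0; rewrite ND -row_mul !mulmxA mulVmx // mul1mx row_mul.
  rewrite (_ : row i D = 0) ?mul0mx //; apply/rowP=> k; rewrite !mxE.
  have [ik|_] := eqVneq (i : nat) k; last by rewrite mulr0n.
  by move: Di0; rewrite mxE eqxx.
have Afix h k : h \in H -> D k k != 0 -> F h *m col k A = col k A.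
  move=> Hh Dk0; have := act_norm_mx F Hh; rewrite ND => /(congr1 (mulmxr (invmx R))).
  rewrite /= !mulmxA !mulmxK // => /(congr1 (col k)).
  rewrite -(mulmxA (F h)) !colMx.
  have -> : col k D = D k k *: delta_mx k 0.
    apply/colP=> i; rewrite !mxE eqxx andbT.
    have [->|ne] := eqVneq i k; first by rewrite eqxx mulr1.
    by rewrite (negPf (_ : (i : nat) != k)) ?mulr0n ?mulr0.
  rewrite -!scalemxAr -!colE => E; apply/colP=> i; apply: (mulfI Dk0).
  by move/colP/(_ i): E; rewrite !mxE.
have wit i : exists w : gT -> 'rV[int]_n, D i i = 0 ->
    row i (invmx A) = \sum_(h in H) (w h *m F h - w h).
  have [/kerA/flF[w ->]|/eqP] := eqVneq (D i i) 0; first by exists w.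
  by exists (fun=> 0).
have [w wE] := choice wit.
(* Where D_ii = 0, flasqueness writes row i of A^-1 as the sum of the w(h) F(h) - w(h), so that
   (A^-1 f)_i = - |H| \sum_h w(h) c(h) is divisible by |H|. The other coordinates only contribute
   the invariant A y, so 0 will do there. *)
pose u' := \col_i (if D i i == 0 then - (\sum_(h in H) w i h *m c h) 0 0 else 0).
pose y := u' *+ m0 - invmx A *m f.
have y0 i : D i i = 0 -> y i 0 = 0.
  move=> Di0; rewrite mxE mulmxnE [u' i 0]mxE Di0 eqxx [fun_of_matrix (- _) i 0]mxE.
  rewrite (_ : (invmx A *m f) i 0 = (row i (invmx A) *m f) 0 0); last first.
    by rewrite -row_mul [RHS]mxE.
  rewrite wE // mulmx_suml; apply/eqP; rewrite subr_eq0; apply/eqP.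
  rewrite mulNrn summxE -sumrMnl summxE -sumrN; apply: eq_bigr => h Hh.
  rewrite mulmxBl -mulmxA -opprB -mulmxBr -cf // mulmxnr.
  by rewrite [RHS]mxE mulmxnE.
pose u := A *m u'.
have uE : u *+ m0 = f + A *m y.
  by rewrite mulmxBr mulmxA mulmxV // mul1mx addrC subrK mulmxnr.
have Ay h : h \in H -> F h *m (A *m y) = A *m y.
  move=> Hh; rewrite mulmxA; apply/colP=> i; rewrite !mxE.
  apply: eq_bigr => k _; have [/y0->|Dk] := eqVneq (D k k) 0.
    by rewrite !mulr0.
  have /colP/(_ i) := Afix h k Hh Dk; rewrite !mxE => <-; congr (_ * _).
  by apply: eq_bigr => l' _; rewrite mxE.
have m0_gt0 : (m0%:R : int) != 0 by rewrite pnatr_eq0 -lt0n cardG_gt0.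
have cu h : h \in H -> c h = u - F h *m u.
  move=> Hh; apply/colP=> i; apply: (mulfI m0_gt0); rewrite !mulr_natl.
  transitivity ((c h *+ m0) i 0); first by rewrite mulmxnE.
  transitivity (((u - F h *m u) *+ m0) i 0); last by rewrite mulmxnE.
  congr (fun_of_matrix _ i 0); rewrite cf // mulrnBl -(mulmxnr (F h)) uE (mulmxDr (F h)) Ay //.
  by rewrite opprD addrACA subrr addr0.
exists (psi0 + q *m u); split.
  by rewrite mulmxDr (mulmxA j q) jq0 mul0mx addr0 (mulmxA j rho) jrho mul1mx.
move=> h Hh; rewrite mulmxDr (mulmxA (M h)) eqq cE // cu // mulmxBr -mulmxA.
by rewrite addrA subrK.
Qed.

(** An equivariant map to a permutation lattice amounts to one functional for each orbit of basis
    vectors, invariant under a stabilizer. Each is extended by [flasque_extend_invariant], then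
    transported along its orbit. *)
Lemma flasque_extend l m n r (L : lattice gT l) (M : lattice gT m)
    (F : lattice gT n) (P : lattice gT r) j q (a : 'M[int]_(l, r)) :
  short_exact L M F j q -> flasque F -> permutation_lattice P ->
  equivariant L P a ->
  exists a' : 'M[int]_(m, r), equivariant M P a' /\ j *m a' = a.
Proof.
move=> ex flF /perm_latticeP[B [B' [s [BB' B'B PB s1 sM]]]] eqa.
have [[eqj _] _ _ _] := ex.
have [rho [h_ [hP rhoE]]] := orbit_transversal [group of [set: gT]] s1 sM.
have sV i : s (h_ i)^-1%g i = rho i.
  by have [_ Eh] := hP i; rewrite -{2}Eh -sM mulgV s1.
have PmE g i k : (B *m P g *m B') i k = (k == s g i)%:R.
  have := congr1 (mulmxr B') (PB g i); rewrite /= -!row_mul BB' row1.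
  by move/rowP/(_ k); rewrite !mxE eqxx.
have colPm k (X : 'M[int]_(k, r)) g i :
    col (s g i) (X *m (B *m P g *m B')) = col i X.
  apply/colP=> x; rewrite !mxE (bigD1 i) //= PmE eqxx mulr1 big1 ?addr0 // => y ne.
  rewrite PmE; case: eqP => [E|_]; last by rewrite mulr0.
  case/eqP: ne; rewrite -[y]s1 -[i]s1 -(mulgV g) !sM.
  by rewrite E.
pose a0 := a *m B'.
have a0R g i : L g *m col (s g i) a0 = col i a0.
  rewrite -[RHS](colPm _ _ g) -colMx; congr (col _ _).
  by rewrite /a0 !mulmxA eqa -!mulmxA (mulmxA B') B'B mul1mx.
have stab_group t : group_set [set h | s h t == t].
  apply/group_setP; split=> [|g h]; first by rewrite inE s1.
  by rewrite !inE sM => /eqP-> /eqP->.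
have expsi t : exists psi : 'cV[int]_m,
    j *m psi = col t a0 /\ forall h, s h t = t -> M h *m psi = psi.
  have [|psi [jpsi psiH]] := flasque_extend_invariant (H := Group (stab_group t))
    (phi := col t a0) ex flF.
    by move=> h; rewrite inE => /eqP Eh; rewrite -[in LHS]Eh a0R.
  by exists psi; split=> // h Eh; apply: psiH; rewrite inE Eh.
have [psi psiP] := choice expsi.
(* Equivariance forces M(g) times column [s g i] to be column i; with [h_ i] carrying [rho i] to i,
   this determines column i from the one at [rho i]. *)
pose a1 := \matrix_(x, i) (M (h_ i)^-1%g *m psi (rho i)) x 0.
have a1E i : col i a1 = M (h_ i)^-1%g *m psi (rho i).
  by apply/colP=> x; rewrite !mxE.
have a1R g i : M g *m col (s g i) a1 = col i a1.
  rewrite !a1E rhoE ?inE // mulmxA -actM.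
  set k := (h_ i * g * (h_ (s g i))^-1)%g.
  have [_ Ek] := psiP (rho i); rewrite -[in RHS](Ek k) ?mulmxA -?actM.
    by rewrite /k !mulgA mulVg mul1g.
  have [_ Eh] := hP i; have [_ Eg] := hP (s g i).
  by rewrite /k !sM Eh -[RHS](rhoE i g) ?inE // -[RHS]sV.
exists (a1 *m B); split=> [g|].
  rewrite -[in RHS]mulmxA -[B *m P g]mulmx1 -B'B !mulmxA; congr (_ *m _).
  rewrite -!mulmxA; apply/matrixP=> x k.
  have [i ->] : exists i, k = s g i.
    by exists (s g^-1%g k); rewrite -sM mulVg s1.
  have /colP/(_ x) := a1R g i; rewrite -[in RHS](colPm _ a1 g i) => E.
  transitivity ((M g *m col (s g i) a1) x 0); first by rewrite -colMx [RHS]mxE.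
  by rewrite E [LHS]mxE !mulmxA.
rewrite mulmxA -[a]mulmx1 -B'B mulmxA; congr (_ *m _).
apply/matrixP=> x i.
have : j *m col i a1 = col i a0.
  rewrite a1E mulmxA -eqj -mulmxA; have [-> _] := psiP (rho i).
  by rewrite -[in LHS]sV a0R.
by rewrite -colMx => /colP/(_ x); rewrite [LHS]mxE [RHS]mxE.
Qed.

End FiniteGroup.

Lemma eq_col R m n (Y Z : 'M[R]_(m, n)) : (forall i, col i Y = col i Z) -> Y = Z.
Proof. by move=> eqYZ; apply: trmx_inj; apply/row_matrixP=> i; rewrite -!tr_col eqYZ. Qed.

Section PermAct.
Variables (G : groupType) (r : nat) (s : G -> 'I_r -> 'I_r).
Hypotheses (s1 : forall i, s 1%g i = i).
Hypothesis sM : forall g h i, s (g * h)%g i = s h (s g i).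

Definition perm_act g : 'M[int]_r := \matrix_i delta_mx 0 (s g i).

Fact perm_act1 : perm_act 1%g = 1%:M.
Proof. by apply/row_matrixP=> i; rewrite rowK row1 s1. Qed.

Fact perm_actM g h : perm_act (g * h)%g = perm_act g *m perm_act h.
Proof. by apply/row_matrixP=> i; rewrite row_mul !rowK -rowE rowK sM. Qed.

Definition perm_lattice : lattice G r := Lattice perm_act1 perm_actM.

Lemma perm_latticeE : permutation_lattice perm_lattice.
Proof. by apply: (@perm_lattice_of_action _ _ _ s) => g i; rewrite rowK. Qed.

End PermAct.

(** * Existence of flasque resolutions *)

Section FlasqueResolution.
Variables (gT : finGroupType) (n : nat) (N : lattice gT n).

(** N is embedded in the functions on a finite G-set X of functionals which, for every subgroup H,
    contains generators of the H-invariant functionals. Thus every H-invariant functional on N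
    extends invariantly to P, and this kills \hat H^{-1}(H, F). *)
Lemma flasque_resolution :
  exists (r s : nat) (P : lattice gT r) (F : lattice gT s) j q,
    [/\ permutation_lattice P, flasque F & short_exact N P F j q].
Proof.
have exE (H : {group gT}) : exists E : 'M[int]_n,
    (forall h, h \in H -> N h *m E = E) /\
    (forall phi : 'cV_n, (forall h, h \in H -> N h *m phi = phi) -> E *m phi = phi).
  (* After transposition, H-invariant functionals form a common kernel. [K' *m K] is an integral
     projector onto it, so the columns of its transpose generate these functionals. *)
  pose C h := if h \in H then (N h - 1%:M)^T else 0.
  have [s [K [K' [_ KC ker]]]] := int_common_kernel_basis C.
  exists (K' *m K)^T; split=> [h Hh | phi Hphi].
    apply: trmx_inj; rewrite trmx_mul trmxK -mulmxA; congr (_ *m _).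
    have := KC h; rewrite /C Hh linearB /= trmx1 mulmxBr mulmx1.
    by move/eqP; rewrite subr_eq0 => /eqP.
  apply: trmx_inj; rewrite trmx_mul trmxK mulmxA; apply: ker => h.
  rewrite /C; case: ifP => [Hh|_]; last by rewrite mulmx0.
  by rewrite -trmx_mul mulmxBl mul1mx Hphi // subrr trmx0.
have {exE} [E EP] := choice exE.
have EH (H : {group gT}) h : h \in H -> N h *m E H = E H by move: h; case: (EP H).
have Efix (H : {group gT}) (phi : 'cV_n) :
  (forall h, h \in H -> N h *m phi = phi) -> E H *m phi = phi.
  by case: (EP H) => _; apply.
(* X consists of the G-translates of the columns of all the matrices [E H]. *)
pose f (x : {group gT} * 'I_n * gT) : 'cV[int]_n := N x.2 *m col x.1.2 (E x.1.1).
pose X := seq_sub (codom f).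
have memX x : f x \in codom f by apply: codom_f.
have subX g (x : X) : N g *m ssval x \in codom f.
  case: x => v /= /codomP[[[H i] h] ->].
  by rewrite /f /= mulmxA -actM -[N _ *m _]/(f (H, i, (g * h)%g)).
pose sX g (x : X) : X := SeqSub (subX g^-1%g x).
pose r := #|{: X}|.
pose vec (i : 'I_r) : 'cV[int]_n := ssval (enum_val i : X).
pose s g (i : 'I_r) : 'I_r := enum_rank (sX g (enum_val i)).
have sE g i : vec (s g i) = N g^-1%g *m vec i.
  by rewrite /vec enum_rankK.
have s_inj (i i' : 'I_r) : vec i = vec i' -> i = i'.
  by move=> eq_i; apply: enum_val_inj; apply: val_inj.
have s1 i : s 1%g i = i by apply: s_inj; rewrite sE invg1 act1 mul1mx.
have sM g h i : s (g * h)%g i = s h (s g i).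
  by apply: s_inj; rewrite !sE invMg actM mulmxA.
pose P := perm_lattice s1 sM.
pose j : 'M[int]_(n, r) := \matrix_(a, i) vec i a 0.
have colj i : col i j = vec i by apply/colP=> a; rewrite !mxE.
have colPs g i k (Y : 'M[int]_(k, r)) : col (s g i) (Y *m P g) = col i Y.
  apply/colP=> a; rewrite !mxE (bigD1 i) //= !mxE !eqxx mulr1 big1 ?addr0 //.
  move=> i' ne; rewrite !mxE eqxx /=; case: eqP => [E'|_]; last by rewrite mulr0.
  case/eqP: ne; rewrite -[i']s1 -[i]s1 -(mulgV g) !sM; congr (s _ _).
  exact/esym.
have s_surj g k : exists i, k = s g i.
  by exists (s g^-1%g k); rewrite -sM mulVg s1.
have eqj : equivariant N P j.
  move=> g; apply: eq_col => k; have [i ->] := s_surj g k.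
  by rewrite colPs colMx !colj sE mulmxA -actM mulgV act1 mul1mx.
(* The trivial subgroup contributes the coordinate functionals, which give [j] an integral
   retraction [j']. *)
have E1 : E 1%G = 1%:M.
  have Hb b h : h \in 1%G -> N h *m delta_mx b 0 = delta_mx b 0 :> 'cV_n.
    by move/set1gP->; rewrite act1 mul1mx.
  apply/matrixP=> a b; have /colP/(_ a) := Efix _ _ (Hb b).
  by rewrite -colE [LHS]mxE => ->; rewrite !mxE eqxx andbT.
have mem1 b : delta_mx b 0 \in codom f.
  apply/codomP; exists (1%G, b, 1%g); rewrite /f /= E1 act1 mul1mx.
  by rewrite -[LHS]mul1mx colE.
pose xb b : 'I_r := enum_rank (SeqSub (mem1 b) : X).
have xbE b : col (xb b) j = delta_mx b 0 by rewrite colj /vec enum_rankK.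
pose j' : 'M[int]_(r, n) := \matrix_(i, b) (i == xb b)%:R.
have jj' : j *m j' = 1%:M.
  apply/matrixP=> a b; rewrite [LHS]mxE (bigD1 (xb b)) //= [j' _ _]mxE eqxx mulr1.
  rewrite big1 ?addr0 => [|i /negPf ne]; last by rewrite [j' _ _]mxE ne mulr0.
  have /colP/(_ a) := xbE b; rewrite mxE => ->.
  by rewrite !mxE andbT.
(* F is realized on the kernel of [j'], a complement of N in P. *)
have [t [sg [K' [sgK' sgj' ker]]]] := int_kernel_basis j'.
pose q := (1%:M - j' *m j) *m K'.
have sgq : sg *m q = 1%:M.
  by rewrite mulmxA mulmxBr mulmx1 mulmxA sgj' mul0mx subr0.
have jq : j *m q = 0 by rewrite mulmxA mulmxBr mulmx1 mulmxA jj' mul1mx subrr mul0mx.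
have qsg : q *m sg = 1%:M - j' *m j.
  apply/row_matrixP=> i; rewrite 2!row_mul; apply: ker.
  by rewrite -row_mul mulmxBl mul1mx -mulmxA jj' mulmx1 subrr row0.
clearbody q.
pose actF g := sg *m P g *m q.
have actF1 : actF 1%g = 1%:M by rewrite /actF act1 mulmx1.
have qF g : P g *m q = q *m actF g.
  rewrite /actF !mulmxA qsg !mulmxBl mul1mx -(mulmxA j') -eqj -!mulmxA jq.
  by rewrite !mulmx0 subr0.
have actFM g h : actF (g * h)%g = actF g *m actF h.
  by rewrite {2}/actF -[RHS]mulmxA -qF /actF actM !mulmxA.
pose F := Lattice actF1 actFM.
have ex : short_exact N P F j q.
  split=> [|v vj|w|u].
  - by split.
  - by rewrite -[v]mulmx1 -jj' mulmxA vj mul0mx.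
  - split=> [wq|[v ->]]; last by rewrite -mulmxA jq mulmx0.
    exists (w *m j'); rewrite -mulmxA; apply/eqP.
    by rewrite -subr_eq0 -[in X in X - _](mulmx1 w) -mulmxBr -qsg mulmxA wq mul0mx.
  by exists (u *m sg); rewrite -mulmxA sgq mulmx1.
exists r, t, P, F, j, q; split=> //; first exact: perm_latticeE.
move=> H v; rewrite -/(norm_mx F H) => vN.
(* If v has norm zero in F, the norm of its lift [r0] lies in N; it is the image of [t0], which is
   H-invariant. *)
pose r0 := v *m sg; pose t0 := r0 *m norm_mx P H *m j'.
have t0E : t0 *m j = r0 *m norm_mx P H.
  rewrite /t0 -mulmxA; apply/eqP; rewrite eq_sym -subr_eq0.
  rewrite -[X in X - _](mulmx1 (r0 *m _)) -mulmxBr -qsg mulmxA -(mulmxA r0).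
  by rewrite (@equivariant_norm _ _ _ P F) // mulmxA -(mulmxA v) sgq mulmx1 vN mul0mx.
clearbody t0.
have t0H h : h \in H -> t0 *m N h = t0.
  move=> Hh; rewrite -[t0 *m N h]mulmx1 -jj' mulmxA -(mulmxA t0) eqj mulmxA t0E.
  by rewrite -(mulmxA r0) norm_mx_act // -t0E -mulmxA jj' mulmx1.
have memE b : col b (E H) \in codom f.
  by apply/codomP; exists (H, b, 1%g); rewrite /f /= act1 mul1mx.
pose y b : 'I_r := enum_rank (SeqSub (memE b) : X).
have yE b : col (y b) j = col b (E H) by rewrite colj /vec enum_rankK.
have sy h b : h \in H -> s h (y b) = y b.
  move=> Hh; apply: s_inj; rewrite sE -colj yE -colMx EH //.
  by rewrite groupV.
(* [y b] is a point of X fixed by H, where the norm of [r0] has the value |H| r0(y b). Hence [t0]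
   agrees with |H| [Y] on invariant functionals, and [t0 *m j] is the norm of [Y *m j]. Therefore
   [r0 - Y *m j] has norm zero in P, which is flasque, and it still maps to v. *)
pose Y := \row_b r0 0 (y b).
have t0Y : t0 *m E H = Y *+ #|H|.
  apply: eq_col => b; rewrite colMx -yE -colMx t0E mulmx_sumr.
  apply/colP=> a; rewrite !mxE summxE mulmxnE mxE (ord1 a) -sumr_const.
  apply: eq_bigr => h Hh; rewrite -[in LHS](sy h b) //.
  by have /colP/(_ 0) := colPs h (y b) 1%N r0; rewrite [LHS]mxE [RHS]mxE.
have H_gt0 : (#|H|%:R : int) != 0 by rewrite pnatr_eq0 -lt0n cardG_gt0.
have t0fix (phi : 'cV_n) : (forall h, h \in H -> N h *m phi = phi) ->
    t0 *m phi = (Y *m phi) *+ #|H|.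
  move=> Hphi; rewrite -{1}(Efix H phi Hphi) mulmxA t0Y.
  by apply/colP=> a; rewrite mulmxnE !mxE -sumrMnl; apply: eq_bigr => b _;
    rewrite mulmxnE mulrnAl.
have r1N : (r0 - Y *m j) *m norm_mx P H = 0.
  apply/eqP; rewrite mulmxBl subr_eq0 -t0E -mulmxA -(equivariant_norm H eqj) mulmxA.
  apply/eqP/eq_col => i; rewrite !colMx -mulmxA.
  have := t0fix (norm_mx N H *m col i j).
  rewrite mulmxA {1}/norm_mx mulmx_sumr (eq_bigr _ t0H) sumr_const => t0i.
  apply/colP=> a; apply: (mulfI H_gt0); rewrite !mulr_natl -!mulmxnE -t0i.
    by rewrite mulmxnE !mxE -sumrMnl; apply: eq_bigr => b _; rewrite mulmxnE mulrnAl.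
  by move=> h Hh; rewrite mulmxA act_norm_mx.
have [w wE] := flasque_perm (perm_latticeE s1 sM) r1N.
exists (fun h => w h *m q).
rewrite -[v]mulmx1 -sgq mulmxA -/r0 -(subrK (Y *m j) r0) mulmxDl -(mulmxA Y) jq.
rewrite mulmx0 addr0 wE mulmx_suml; apply: eq_bigr => h _.
by rewrite mulmxBl -!mulmxA qF.
Qed.

End FlasqueResolution.

(** * Conditions (2) and (3) over a finite group *)

Definition p_factorizable (G : groupType) (p n : nat) (N : lattice G n) : Prop :=
  exists (m r t : nat) (M : lattice G m) (P : lattice G r)
         (Q : lattice G t) (j : 'M[int]_(n, m)) (q : 'M[int]_(m, t))
         (a : 'M[int]_(n, r)) (b : 'M[int]_(r, m)) (d : int),
    [/\ permutation_lattice P /\ permutation_lattice Q,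
        short_exact N M Q j q,
        equivariant N P a /\ equivariant P M b,
        ~~ (p %| d)%Z
      & a *m b = d%:M *m j].

Definition factors_through_permutation (G : groupType) (p n : nat)
    (N : lattice G n) : Prop :=
  exists (r : nat) (P : lattice G r) (f : 'M[int]_(n, r)) (h : 'M[int]_(r, n))
         (d : int),
  [/\ permutation_lattice P, equivariant N P f, equivariant P N h,
      ~~ (p %| d)%Z & f *m h = d%:M].

Lemma denq_dvd (x d : int) : d != 0 -> (denq (x%:~R / d%:~R) %| d)%Z.
Proof.
move=> nz_d; set r : rat := _ / _.
have dQ : (d%:~R : rat) != 0 by rewrite intr_eq0.
have E : x * denq r = numq r * d.
  by apply: (@intr_inj rat); rewrite !intrM numqE [RHS]mulrAC divfK.
have := dvdz_mull x (dvdzz (denq r)); rewrite E Gauss_dvdzr //.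
by rewrite coprimezE coprime_sym coprime_num_den.
Qed.

Lemma map_intr_inj m n :
  injective (map_mx intr : 'M[int]_(m, n) -> 'M[rat]_(m, n)).
Proof.
move=> A B /matrixP eqAB; apply/matrixP=> i j.
by have := eqAB i j; rewrite !mxE => /intr_inj.
Qed.

Section PInvertible.
Variables (G : groupType) (p : nat) (p_prime : prime p).

Lemma factors_p_invertible n (N : lattice G n) :
  factors_through_permutation p N -> p_invertible p N.
Proof.
case=> r [P [f [h [d [permP eqf eqh pd fh]]]]].
have nz_d : d != 0 by apply: contraNneq pd => ->; rewrite dvdz0.
have dQ : (d%:~R : rat) != 0 by rewrite intr_eq0.
exists r, P, (map_mx intr f), (d%:~R^-1 *: map_mx intr h); split=> //.
- split=> [i k | g]; last by rewrite -!map_mxM eqf.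
  by rewrite mxE denq_int /= dvdn1; apply: contraL p_prime => /eqP->.
- split=> [i k | g]; last by rewrite -scalemxAr -scalemxAl -!map_mxM eqh.
  rewrite !mxE mulrC; apply: contra pd => pden.
  by rewrite (dvdz_trans _ (denq_dvd (h i k) nz_d)).
by rewrite -scalemxAr -map_mxM fh map_scalar_mx scale_scalar_mx mulVf.
Qed.

(** The product of all the denominators is prime to p and clears them. *)
Lemma Zp_hom_clear m n (M : lattice G m) (N : lattice G n) f :
  Zp_hom p M N f ->
  exists (c : int) (f0 : 'M[int]_(m, n)),
    [/\ ~~ (p %| c)%Z, equivariant M N f0 & map_mx intr f0 = c%:~R *: f].
Proof.
case=> Zf eqf; pose c : int := \prod_(x : 'I_m * 'I_n) denq (f x.1 x.2).
have pc : ~~ (p %| c)%Z.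
  rewrite /c; elim/big_ind: _ => [|x y px py|x _].
  - by rewrite dvdzE /= dvdn1; apply: contraL p_prime => /eqP->.
  - by rewrite dvdzE abszM Euclid_dvdM // negb_or -!dvdzE px.
  - exact: Zf.
have cf i k : exists z : int, z%:~R = c%:~R * f i k.
  exists (numq (f i k) * \prod_(x | x != (i, k)) denq (f x.1 x.2)).
  by rewrite /c [in RHS](bigD1 (i, k)) // !intrM numqE /= mulrAC [RHS]mulrC mulrA mulrAC.
pose f0 i k := projT1 (cid (cf i k)).
have f0E : map_mx intr (\matrix_(i, k) f0 i k) = c%:~R *: f.
  by apply/matrixP=> i k; rewrite !mxE (projT2 (cid (cf i k))).
exists c, (\matrix_(i, k) f0 i k); split=> // g.
apply: map_intr_inj.
by rewrite !map_mxM f0E -scalemxAr -scalemxAl eqf.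
Qed.

Lemma p_invertible_factors n (N : lattice G n) :
  p_invertible p N -> factors_through_permutation p N.
Proof.
case=> r [P [f [h [permP homf homh fh]]]].
have [c [f0 [pc eqf0 f0E]]] := Zp_hom_clear homf.
have [e [h0 [pe eqh0 h0E]]] := Zp_hom_clear homh.
exists r, P, f0, h0, (c * e); split=> //.
  by rewrite dvdzE abszM Euclid_dvdM // negb_or -!dvdzE pc.
apply: map_intr_inj.
rewrite map_mxM f0E h0E -scalemxAr -scalemxAl fh scalerA map_scalar_mx.
by rewrite scale_scalar_mx mulr1 /= intrM 1?mulrC.
Qed.

Lemma equivariantB m n (M : lattice G m) (N : lattice G n) f h :
  equivariant M N f -> equivariant M N h -> equivariant M N (f - h).
Proof. by move=> eqf eqh g; rewrite mulmxBr mulmxBl eqf eqh. Qed.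

Lemma equivariant_scale n (N : lattice G n) (d : int) : equivariant N N d%:M.
Proof. by move=> g; rewrite scalar_mxC. Qed.

Lemma equivariant_row m n r (M : lattice G m) (N : lattice G n) (R : lattice G r)
    f h : equivariant M N f -> equivariant M R h ->
  equivariant M (dsum N R) (row_mx f h).
Proof.
move=> eqf eqh g; rewrite /= /dsum_act mul_mx_row mul_row_block.
by rewrite !mulmx0 addr0 add0r eqf eqh.
Qed.

Lemma equivariant_col m n r (M : lattice G m) (N : lattice G n) (R : lattice G r)
    f h : equivariant N M f -> equivariant R M h ->
  equivariant (dsum N R) M (col_mx f h).
Proof.
move=> eqf eqh g; rewrite /= /dsum_act mul_block_col mul_col_mx.
by rewrite !mul0mx addr0 add0r eqf eqh.
Qed.

Lemma short_exact_factor l m n r (L : lattice G l) (M : lattice G m)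
    (N : lattice G n) (R : lattice G r) j q (f : 'M[int]_(m, r)) :
  short_exact L M N j q -> equivariant M R f -> j *m f = 0 ->
  exists h, equivariant N R h /\ f = q *m h.
Proof.
move=> ex eqf jf; have [[eqj eqq] _ _ _] := ex.
have [sg [rho [sgq jrho sumE jq0 sgrho]]] := short_exact_split ex.
have fE : f = q *m (sg *m f).
  by rewrite mulmxA -[LHS]mul1mx -sumE mulmxDl -mulmxA jf mulmx0 add0r.
exists (sg *m f); split=> // g.
rewrite -[LHS]mul1mx -sgq -!mulmxA; congr (_ *m _).
by rewrite (mulmxA q) -eqq -mulmxA -fE eqf.
Qed.

End PInvertible.

Section FlasqueClass.
Variables (gT : finGroupType) (p : nat) (p_prime : prime p).
Variables (n : nat) (N : lattice gT n).

(** Since Q is flasque, [i] extends along [j] to [e : M -> R]; since F is flasque, [a] extends along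
    [i] to [a' : R -> P]. Then d - a' b e vanishes on N, hence equals pi h, and d on F is the sum of
    h pi, through R, and f c, through Q. Composition is from left to right. *)
Lemma factorizable_flasque_class :
  p_factorizable p N -> flasque_class_p_invertible p N.
Proof.
case=> m [r [t [M [P [Q [j [q [a [b [d [[permP permQ] exM [eqa eqb] pd ab]]]]]]]]]]].
have [u [s [R [F [i [pi [permR flF exR]]]]]]] := flasque_resolution N.
have [[eqj eqq] _ _ _] := exM; have [[eqi eqpi] _ _ _] := exR.
have [_ [_ [_ _ _ jq _]]] := short_exact_split exM.
have [sg [rho [sgpi irho sumE ipi _]]] := short_exact_split exR.
have [e [eqe je]] := flasque_extend exM (flasque_perm permQ) permR eqi.
have [a' [eqa' ia']] := flasque_extend exR flF permP eqa.
have eqab : equivariant R M (a' *m b) by apply: equivariant_comp eqb.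
have iab : i *m (a' *m b) = d%:M *m j by rewrite mulmxA ia' ab.
have [||h [eqh hE]] := short_exact_factor (R := R) (f := d%:M - a' *m b *m e) exR.
- apply: equivariantB; first exact: equivariant_scale.
  exact: equivariant_comp eqab eqe.
- by rewrite mulmxBr (mulmxA i) iab -mulmxA je -scalar_mxC subrr.
have [||c [eqc cE]] := short_exact_factor (R := F) (f := e *m pi) exM.
- exact: equivariant_comp eqe eqpi.
- by rewrite mulmxA je ipi.
have [||f [eqf fE]] := short_exact_factor (R := Q) (f := a' *m b *m q) exR.
- exact: equivariant_comp eqab eqq.
- by rewrite mulmxA iab -mulmxA jq mulmx0.
exists s, F; split.
  exists u, s, R, F, i, pi; split=> //.
  exact: stably_equivalent_refl.
apply: factors_p_invertible => //.
exists (u + t)%N, (dsum R Q), (row_mx h f), (col_mx pi c), d; split=> //.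
- exact: perm_lattice_dsum.
- exact: equivariant_row.
- exact: equivariant_col.
have : pi *m (row_mx h f *m col_mx pi c) = pi *m d%:M.
  rewrite mul_row_col mulmxDr !mulmxA -hE -fE -[_ *m q *m c]mulmxA -cE.
  by rewrite !mulmxA -mulmxDl subrK scalar_mxC.
by move/(congr1 (mulmx sg)); rewrite !(mulmxA sg) sgpi !mul1mx.
Qed.

(** M is the pull-back of R and P1 over F, and R -> M is the map r |-> (d r, al (pi r)), which lands
    in the pull-back because [al] followed by [be] is d. *)
Lemma flasque_class_factorizable :
  flasque_class_p_invertible p N -> p_factorizable p N.
Proof.
case=> n' [N' [[u [s [R [F [i [pi [permR _ exR st]]]]]]] pinv]].
have [w [P0 [f0 [h0 [d [permP0 eqf0 eqh0 pd fh0]]]]]] := p_invertible_factors p_prime pinv.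
case: st => v [v' [S [S' [permS permS' [x [y [eqx eqy xy _]]]]]]].
have [[eqi eqpi] _ kerpi surpi] := exR.
have [sg [rho [sgpi irho sumE ipi sgrho]]] := short_exact_split exR.
(* F is a direct summand of N' + S' up to isomorphism. On S' the factorization of d is the identity
   followed by d, whence the extra summand S'. *)
pose P1 := dsum P0 S'.
pose al := row_mx 1%:M 0 *m x *m block_mx f0 0 0 1%:M : 'M_(s, w + v').
pose be := block_mx h0 0 0 d%:M *m y *m col_mx 1%:M 0 : 'M_(w + v', s).
have eqblock a b c e (A : lattice gT a) (B : lattice gT b) (C : lattice gT c)
    (E : lattice gT e) f h : equivariant A B f -> equivariant C E h ->
    equivariant (dsum A C) (dsum B E) (block_mx f 0 0 h).
  move=> eqf eqh g; rewrite /= /dsum_act !mulmx_block.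
  by rewrite !(mul0mx, mulmx0, addr0, add0r) eqf eqh.
have eq1 a (A : lattice gT a) : equivariant A A 1%:M by exact: equivariant_scale.
have eq0 a b (A : lattice gT a) (B : lattice gT b) : equivariant A B 0.
  by move=> g; rewrite mulmx0 mul0mx.
have eqal : equivariant F P1 al.
  apply: equivariant_comp (eqblock _ _ _ _ _ _ _ _ _ _ eqf0 (eq1 _ _)).
  apply: equivariant_comp eqx.
  exact: equivariant_row.
have eqbe : equivariant P1 F be.
  apply: (equivariant_comp (N := dsum F S)); last exact: equivariant_col.
  apply: equivariant_comp eqy.
  by apply: eqblock => //; apply: equivariant_scale.
have albe : al *m be = d%:M.
  rewrite /al /be -!mulmxA (mulmxA (block_mx f0 _ _ _)) mulmx_block.
  rewrite !(mul0mx, mulmx0, addr0, add0r) fh0 mul1mx -scalar_mx_block.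
  rewrite mul_scalar_mx -!scalemxAr (mulmxA x) xy mul1mx mul_row_col mulmx1.
  by rewrite mul0mx addr0 scale_scalar_mx mulr1.
clearbody al be.
(* The pull-back of R and P1 over F, in the coordinates given by a splitting
   of pi. *)
pose ta g := (sg *m R g - F g *m sg) *m rho.
have sgR g : sg *m R g = ta g *m i + F g *m sg.
  rewrite /ta -[LHS]mulmx1 -sumE mulmxDr !mulmxA mulmxBl.
  rewrite -(mulmxA _ sg) sgrho mulmx0 subr0; congr (_ + _).
  by rewrite -(mulmxA sg) eqpi mulmxA sgpi mul1mx.
pose actM' g := block_mx (N g) 0 (be *m ta g) (P1 g) : 'M_(n + (w + v')).
(* [em] embeds the pull-back in R + P1 and has a right inverse, so the laws of an action, and later
   the equivariance of R -> M, are checked there. *)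
pose em := block_mx i 0 (be *m sg) 1%:M : 'M_(n + (w + v'), u + (w + v')).
pose em' := block_mx rho 0 (- (be *m sg *m rho)) 1%:M : 'M_(u + (w + v'), n + (w + v')).
have emem' : em *m em' = 1%:M.
  rewrite /em /em' mulmx_block !(mul0mx, mulmx0, addr0, add0r) mul1mx mulmx1.
  by rewrite irho -mulmxA sgrho mulmx0 oppr0 addr0 -scalar_mx_block.
have emE g : em *m dsum R P1 g = actM' g *m em.
  rewrite /em /actM' [dsum R P1 g]/= /dsum_act !mulmx_block.
  rewrite !(mul0mx, mulmx0, addr0, add0r) mulmx1 mul1mx eqi.
  by rewrite -(mulmxA be) sgR mulmxDr !mulmxA eqbe.
have aM1 : actM' 1%g = 1%:M.
  have := emE 1%g; rewrite act1 mulmx1 => /(congr1 (mulmxr em')) /=.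
  by rewrite -mulmxA emem' mulmx1.
have aMM g h : actM' (g * h)%g = actM' g *m actM' h.
  have := emE (g * h)%g; rewrite actM mulmxA emE -mulmxA emE mulmxA.
  by move/(congr1 (mulmxr em')); rewrite /= -mulmxA -[X in _ = X]mulmxA emem' !mulmx1.
pose M := Lattice aM1 aMM.
exists (n + (w + v'))%N, u, (w + v')%N, M, R, P1, (row_mx 1%:M 0), (col_mx 0 1%:M).
exists i, (row_mx (d%:M *m rho) (pi *m al)), d; split=> //.
- by split=> //; apply: perm_lattice_dsum.
- split=> [|z|z|z].
  + split=> g; rewrite /= /actM'.
      by rewrite mul_row_block mul_mx_row !(mul1mx, mul0mx, mulmx0, mulmx1, addr0).
    by rewrite mul_block_col [RHS]mul_col_mx !(mul1mx, mul0mx, mulmx0, mulmx1, add0r).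
  + by rewrite mul_mx_row mulmx1 => /(congr1 lsubmx); rewrite row_mxKl linear0.
  + split=> [|[z' ->]]; last by rewrite -mulmxA mul_row_col mul1mx mul0mx addr0 mulmx0.
    rewrite -{1}[z]hsubmxK mul_row_col mulmx0 mulmx1 add0r => z0.
    by exists (lsubmx z); rewrite mul_mx_row mulmx1 mulmx0 -z0 hsubmxK.
  + by exists (row_mx 0 z); rewrite mul_row_col mulmx1 mul0mx add0r.
- split=> // g.
  have emi : row_mx (d%:M *m rho) (pi *m al) *m em = row_mx d%:M (pi *m al).
    rewrite /em mul_row_block mulmx0 add0r mulmx1; congr row_mx.
    rewrite -(mulmxA d%:M) -(mulmxA pi) (mulmxA al) albe !mul_scalar_mx.
    by rewrite -scalemxAr -scalerDr sumE scale_scalar_mx mulr1.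
  have : (R g *m row_mx (d%:M *m rho) (pi *m al)) *m em
      = (row_mx (d%:M *m rho) (pi *m al) *m actM' g) *m em.
    rewrite -[RHS]mulmxA -emE mulmxA emi -mulmxA emi.
    rewrite [dsum R P1 g]/= /dsum_act mul_row_block mul_mx_row.
    by rewrite !(mulmx0, addr0, add0r) scalar_mxC mulmxA eqpi -!mulmxA eqal.
  move/(congr1 (mulmxr em')); rewrite /= -mulmxA -[X in _ = X]mulmxA emem'.
  by rewrite !mulmx1.
rewrite !mul_mx_row (mulmxA i pi) ipi mul0mx mulmx0 mulmx1 mul_scalar_mx.
by rewrite -scalemxAr irho scale_scalar_mx mulr1.
Qed.

End FlasqueClass.

(** * Galois theory *)

Section Subrings.

(** The closure proof is an argument, so that the closure structure can be inferred from the
    predicate itself. *)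
Definition subring_pred (R : nzRingType) (S : {pred R}) (_ : subring_closed S) :
  {pred R} := S.
HB.instance Definition _ (R : nzRingType) (S : {pred R}) (S_sub : subring_closed S) :=
  GRing.isSubringClosed.Build R (subring_pred S_sub) S_sub.

Record subring (R : nzRingType) (S : {pred R}) (S_sub : subring_closed S) :=
  Subring { subring_val :> R; _ : subring_val \in subring_pred S_sub }.

HB.instance Definition _ (R : nzRingType) (S : {pred R}) (S_sub : subring_closed S) :=
  [isSub for @subring_val R S S_sub].
HB.instance Definition _ (R : nzRingType) (S : {pred R}) (S_sub : subring_closed S) :=
  [Choice of subring S_sub by <:].
HB.instance Definition _ (R : nzRingType) (S : {pred R}) (S_sub : subring_closed S) :=
  [SubChoice_isSubNzRing of subring S_sub by <:].
HB.instance Definition _ (R : comNzRingType) (S : {pred R}) (S_sub : subring_closed S) :=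
  [SubNzRing_isSubComNzRing of subring S_sub by <:].
HB.instance Definition _ (R : nzRingType) (S : {pred R}) (S_sub : subring_closed S) :=
  GRing.RMorphism.copy (@subring_val R S S_sub) (val : subring S_sub -> R).

Definition subfield_pred (F : fieldType) (S : {pred F}) (_ : divring_closed S) :
  {pred F} := S.
HB.instance Definition _ (F : fieldType) (S : {pred F}) (S_div : divring_closed S) :=
  GRing.isDivringClosed.Build F (subfield_pred S_div) S_div.

Record subfieldt (F : fieldType) (S : {pred F}) (S_div : divring_closed S) :=
  Subfieldt { subfieldt_val :> F; _ : subfieldt_val \in subfield_pred S_div }.

HB.instance Definition _ (F : fieldType) (S : {pred F}) (S_div : divring_closed S) :=
  [isSub for @subfieldt_val F S S_div].
HB.instance Definition _ (F : fieldType) (S : {pred F}) (S_div : divring_closed S) :=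
  [Choice of subfieldt S_div by <:].
HB.instance Definition _ (F : fieldType) (S : {pred F}) (S_div : divring_closed S) :=
  [SubChoice_isSubUnitRing of subfieldt S_div by <:].
HB.instance Definition _ (F : fieldType) (S : {pred F}) (S_div : divring_closed S) :=
  [SubNzRing_isSubComNzRing of subfieldt S_div by <:].
HB.instance Definition _ (F : fieldType) (S : {pred F}) (S_div : divring_closed S) :=
  [SubComUnitRing_isSubIntegralDomain of subfieldt S_div by <:].
HB.instance Definition _ (F : fieldType) (S : {pred F}) (S_div : divring_closed S) :=
  [SubIntegralDomain_isSubField of subfieldt S_div by <:].

End Subrings.

Lemma rmorphism_of_fun (R S : pzRingType) (f : R -> S) :
  (forall x y, f (x - y) = f x - f y) -> (forall x y, f (x * y) = f x * f y) ->
  f 1 = 1 -> exists g : {rmorphism R -> S}, g =1 f.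
Proof.
move=> fB fM f1.
pose fz := GRing.isZmodMorphism.Build R S f fB.
pose fm := GRing.isMonoidMorphism.Build R S f (f1, fM).
pose g : {rmorphism R -> S} := HB.pack f fz fm.
by exists g.
Qed.

Lemma irreducible_coprimep (F : fieldType) (r p : {poly F}) :
  irreducible_poly r -> coprimep r p = ~~ (r %| p).
Proof.
move=> irr_r; apply/idP/idP=> [co_rp|].
  apply/negP=> rp; have [gt1 _] := irr_r.
  by move: co_rp gt1; rewrite /coprimep (eqp_size (dvdp_gcd_idl rp)) => /eqP->.
apply: contraR => co_rp; have gr := irr_r.2 _ co_rp (dvdp_gcdl r p).
by rewrite -(eqp_dvdl _ gr) dvdp_gcdr.
Qed.

Section MinimalPolynomial.
Variables (F K : fieldType) (j : {rmorphism F -> K}) (x : K).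

Lemma irreducible_root_poly (q : {poly F}) : q != 0 -> root (map_poly j q) x ->
  exists r, [/\ irreducible_poly r, root (map_poly j r) x
    & forall P, root (map_poly j P) x = (r %| P)].
Proof.
move=> nz_q qx.
have [r /andP[nz_r rx] min_r] : exists2 r : {poly F},
    (r != 0) && root (map_poly j r) x
    & forall q, root (map_poly j q) x -> q != 0 -> (size r <= size q)%N.
  have [n sz_n] := ubnP (size q); elim: n => // n IHn in q nz_q qx sz_n *.
  have [[q' [q'x nz_q' lt_q']]|min_q] := pselect (exists q',
    [/\ root (map_poly j q') x, q' != 0 & (size q' < size q)%N]).
    by apply: (IHn q') => //; apply: leq_trans lt_q' _.
  exists q => [|q' q'x nz_q']; first by rewrite nz_q.
  by rewrite leqNgt; apply/negP=> lt; apply: min_q; exists q'.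
exists r; split=> // [|P]; first exact/(subfx_irreducibleP rx nz_r).
apply/idP/idP=> [Px | /dvdpP[s ->]]; last by rewrite rmorphM rootM rx orbT.
apply/modp_eq0P/eqP; apply: contraT => nz_m.
have : root (map_poly j (P %% r)) x.
  move: Px; rewrite {1}(divp_eq P r) rmorphD rmorphM /= /root !hornerE.
  by rewrite (rootP rx) mulr0 add0r.
by move/min_r/(_ nz_m); rewrite leqNgt ltn_modp nz_r.
Qed.

End MinimalPolynomial.

(** * Extension of embeddings into a separable closure *)

Section SeparableClosure.
Variables (k ks : fieldType) (i : {rmorphism k -> ks}).
Hypothesis ks_closure : is_sep_closure i.

Lemma separable_splits (q : {poly ks}) : separable_poly q ->
  exists rs, q %= \prod_(r <- rs) ('X - r%:P).
Proof.
have [n sz_n] := ubnP (size q); elim: n => // n IHn in q sz_n * => sep_q.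
have [sz1|gt1] := leqP (size q) 1.
  exists [::]; rewrite big_nil -size_poly_eq1 eqn_leq sz1 size_poly_gt0.
  exact: separable_poly_neq0.
have [x /factor_theorem[q' Dq]] := ks_closure.2 q sep_q gt1.
have := sep_q; rewrite Dq separable_mul => /and3P[sep_q' _ _].
have nz_q' := separable_poly_neq0 sep_q'.
have [|rs Drs] := IHn q' _ sep_q'.
  by move: sz_n; rewrite Dq size_mul ?polyXsubC_eq0 // size_XsubC addn2 ltnS.
by exists (x :: rs); rewrite big_cons mulrC eqp_mull.
Qed.

(** Zorn's lemma for partial homomorphisms, represented by their graphs: sets of pairs closed under
    the field operations that contain all (e x, f x). *)
Lemma embedding_extends (F0 : fieldType) (j : {rmorphism k -> F0})
    (e f : {rmorphism F0 -> ks}) :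
  (forall c, e (j c) = i c) -> (forall c, f (j c) = i c) ->
  exists h : {rmorphism ks -> ks}, forall x, h (e x) = f x.
Proof.
move=> ej fj.
pose good (A : ks * ks -> Prop) := [/\ forall x, A (e x, f x),
  forall a b, A a -> A b -> A (a.1 - b.1, a.2 - b.2),
  forall a b, A a -> A b -> A (a.1 * b.1, a.2 * b.2),
  forall a, A a -> A (a.1^-1, a.2^-1) & forall y, A (0, y) -> y = 0].
(* The union of the empty chain is empty, so goodness is required of nonempty sets only. *)
pose P (A : ks * ks -> Prop) := (exists a, A a) -> good A.
have [C FP totF | A [PA maxA]] := @classical_sets.Zorn_bigcup _ P.
  case=> [a [X CX Xa]]; split.
  - by move=> x; exists X => //; have [] := FP X CX (ex_intro _ a Xa).
  - move=> b c [Y CY Yb] [Z CZ Zc].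
    have [sub|sub] := totF _ _ CY CZ.
      have [_ H _ _ _] := FP Z CZ (ex_intro _ c Zc).
      by exists Z => //; apply: H => //; apply: sub.
    have [_ H _ _ _] := FP Y CY (ex_intro _ b Yb).
    by exists Y => //; apply: H => //; apply: sub.
  - move=> b c [Y CY Yb] [Z CZ Zc].
    have [sub|sub] := totF _ _ CY CZ.
      have [_ _ H _ _] := FP Z CZ (ex_intro _ c Zc).
      by exists Z => //; apply: H => //; apply: sub.
    have [_ _ H _ _] := FP Y CY (ex_intro _ b Yb).
    by exists Y => //; apply: H => //; apply: sub.
  - move=> b [Y CY Yb]; exists Y => //.
    by have [_ _ _ H _] := FP Y CY (ex_intro _ b Yb); apply: H.
  - move=> y [Y CY Yy].
    by have [_ _ _ _ H] := FP Y CY (ex_intro _ _ Yy); apply: H.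
have base : good (fun a => exists x, a = (e x, f x)).
  split=> [x|a b [x ->] [y ->]|a b [x ->] [y ->]|a [x ->]|y [x [x0 ->]]].
  - by exists x.
  - by exists (x - y); rewrite !rmorphB.
  - by exists (x * y); rewrite !rmorphM.
  - by exists x^-1; rewrite !fmorphV.
  - have /eqP := esym x0; rewrite fmorph_eq0 => /eqP ->.
    by rewrite rmorph0.
have {PA} goodA : good A.
  apply: PA; apply: contrapT => noA.
  apply: (maxA (fun a => exists x, a = (e x, f x))) => //.
  split=> [a Aa|sub]; first by case: noA; exists a.
  by apply: noA; exists (e 0, f 0); apply: sub; exists 0.
have [Aef AB AM AV A0] := goodA.
have A1 : A (1, 1) by have := Aef 1; rewrite !rmorph1.
have Afun x y y' : A (x, y) -> A (x, y') -> y = y'.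
  move=> Ay Ay'; have := AB _ _ Ay Ay'; rewrite /= subrr => /A0/eqP.
  by rewrite subr_eq0 => /eqP.
pose D : {pred ks} := [pred x | `[< exists y, A (x, y) >]].
have DP x : reflect (exists y, A (x, y)) (x \in D) by apply: (iffP (asboolP _)).
have D_div : divring_closed D.
  split=> [|x y /DP[x' Ax] /DP[y' Ay]|x y /DP[x' Ax] /DP[y' Ay]]; apply/DP.
  - by exists 1.
  - by exists (x' - y'); apply: (AB _ _ Ax Ay).
  - by exists (x' / y'); apply: (AM _ _ Ax (AV _ Ay)).
pose K : fieldType := subfieldt D_div.
have exphi (z : K) : exists y, A (subfieldt_val z, y) by case: z => x /= /DP.
have [phi phiA] := choice exphi.
have [ph phE] : exists ph : {rmorphism K -> ks}, ph =1 phi.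
  apply: rmorphism_of_fun => [x y|x y|].
  - by apply: Afun (phiA _) _; apply: (AB _ _ (phiA x) (phiA y)).
  - by apply: Afun (phiA _) _; apply: (AM _ _ (phiA x) (phiA y)).
  - exact: (Afun 1 _ _ (phiA 1) A1).
pose io : {rmorphism K -> ks} := (val : K -> ks).
have phA (z : K) : A (io z, ph z) by rewrite phE; apply: phiA.
have Dfull x : x \in D.
  have DK c : i c \in D by apply/DP; exists (i c); rewrite -{1}ej -fj.
  pose jk c : K := Subfieldt (DK c).
  have [j' j'E] : exists j' : {rmorphism k -> K}, j' =1 jk.
    by apply: rmorphism_of_fun => [a b|a b|]; apply: val_inj;
      rewrite /= ?rmorphB ?rmorphM ?rmorph1.
  have ioj c : io (j' c) = i c by rewrite j'E.
  have phj c : ph (j' c) = i c.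
    by apply: Afun (phA _) _; rewrite ioj -{1}ej -fj.
  have [q [sep_q qx]] := ks_closure.1 x.
  have nz_q : map_poly j' q != 0 by rewrite map_poly_eq0 separable_poly_neq0.
  have [|r [irr_r rx rP]] := @irreducible_root_poly _ _ io x _ nz_q.
    by rewrite -map_poly_comp (eq_map_poly ioj).
  have rq : r %| map_poly j' q by rewrite -rP -map_poly_comp (eq_map_poly ioj).
  have sep_r : separable_poly (map_poly ph r).
    have sep_iq : separable_poly (map_poly i q) by rewrite separable_map.
    apply: dvdp_separable sep_iq.
    by rewrite -(eq_map_poly phj) map_poly_comp dvdp_map.
  have [|y ry] := ks_closure.2 _ sep_r.
    by rewrite size_map_poly; case: irr_r.
  (* If x is outside the domain K, its minimal polynomial r over K has separable image under [ph],
     hence a root y. The graph of p(x) |-> p(y), for p over K, is larger than A. *)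
  pose B (a : ks * ks) := exists p : {poly K},
    a = ((map_poly io p).[x], (map_poly ph p).[y]).
  have subAB a : A a -> B a.
    case: a => a1 a2 Aa; have Da : a1 \in D by apply/DP; exists a2.
    exists (Subfieldt Da)%:P; rewrite !map_polyC !hornerC /=; congr (_, _).
    exact: Afun Aa (phA (Subfieldt Da)).
  have goodB : good B.
    split=> [z|_ _ [p1 ->] [p2 ->]|_ _ [p1 ->] [p2 ->]|_ [p ->]|z [p [p0 ->]]].
    - exact/subAB/Aef.
    - by exists (p1 - p2); rewrite !rmorphB /= !hornerE.
    - by exists (p1 * p2); rewrite !rmorphM /= !hornerE.
    (* If r divides p, both values are 0 and so are their inverses; otherwise a Bezout relation
       inverts p modulo r, at x and at y alike. *)
    - have [rp|] := boolP (r %| p).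
        have /dvdpP[s ->] := rp; exists 0; rewrite !rmorphM !rmorph0 /=.
        by rewrite !hornerE (rootP rx) (rootP ry) !mulr0 invr0.
      rewrite -irreducible_coprimep // => /Bezout_eq1_coprimepP[[u v] /= uv1].
      have Ev (h : {rmorphism K -> ks}) z : root (map_poly h r) z ->
          (map_poly h v).[z] = (map_poly h p).[z]^-1.
        move=> rz; have := congr1 (fun t => (map_poly h t).[z]) uv1.
        rewrite rmorphD !rmorphM rmorph1 /= !hornerE (rootP rz) mulr0 add0r.
        by rewrite mulrC => /mulr1_eq.
      by exists v; rewrite !Ev.
    - have : root (map_poly io p) x by apply/rootP.
      rewrite rP => /dvdpP[s ->].
      by rewrite rmorphM /= hornerE (rootP ry) mulr0.
  apply: contrapT => /negP Dx; apply: (maxA B) => //.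
  split=> // subBA; case/negP: Dx; apply/DP; exists y; apply: subBA.
  by exists 'X; rewrite !map_polyX !hornerX.
have [h hA] := choice (fun x => DP x (Dfull x)).
have [h' h'E] : exists h' : {rmorphism ks -> ks}, h' =1 h.
  apply: rmorphism_of_fun => [x y|x y|].
  - by apply: Afun (hA _) _; apply: (AB _ _ (hA x) (hA y)).
  - by apply: Afun (hA _) _; apply: (AM _ _ (hA x) (hA y)).
  - exact: Afun (hA _) A1.
exists h' => x; rewrite h'E; exact: Afun (hA _) (Aef x).
Qed.

End SeparableClosure.

(** The base field grows with each adjunction, hence the induction on [s] for all [F] at once. The
    tower is finally viewed over the bottom field. *)
Lemma adjoin_embedding (ks : fieldType) (s : seq ks) :
  forall (F : fieldType) (io : {rmorphism F -> ks}),
  (forall x, x \in s -> exists2 q : {poly F}, q != 0 & root (map_poly io q) x) ->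
  exists (L : fieldExtType F) (e : {rmorphism L -> ks}) (zs : seq L),
    (forall c : F, e c%:A = io c) /\ map e zs = s.
Proof.
elim: s => [|x s IHs] F io alg_s.
  exists F^o, (io : {rmorphism F^o -> ks}), [::]; split=> // c.
  by rewrite /GRing.scale /= mulr1.
have [q nz_q qx] := alg_s x (mem_head _ _).
have [r [irr_r rx _]] := irreducible_root_poly nz_q qx.
have nz_r := irredp_neq0 irr_r.
pose K : fieldExtType F := SubFieldExtType rx irr_r.
pose eK : {rmorphism K -> ks} := @subfx_inj F ks io x r.
have eK_base c : eK c%:A = io c by apply: subfx_inj_base.
have [|L [e [zs [eC Ds]]]] := IHs K eK.
  move=> y s_y; have [|q' nz_q' q'y] := alg_s y; first by rewrite inE s_y orbT.
  exists (map_poly (in_alg K) q'); first by rewrite map_poly_eq0.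
  by rewrite -map_poly_comp (eq_map_poly eK_base).
exists (baseFieldType L), (e : {rmorphism baseFieldType L -> ks}).
exists ((subfx_root io x r : K)%:A :: zs); split=> [c | /=].
  by rewrite baseField_scaleE eC eK_base.
by rewrite Ds eC; congr (_ :: _); apply: subfx_inj_root.
Qed.

Section SeparableClosure.
Variables (k ks : fieldType) (i : {rmorphism k -> ks}).
Hypothesis ks_closure : is_sep_closure i.

(** An endomorphism over k is onto: it maps injectively to itself the finite set of roots of a
    separable polynomial over k that kills y. *)
Lemma endo_kaut (h : {rmorphism ks -> ks}) : (forall c, h (i c) = i c) ->
  exists s : kaut i, s =1 h.
Proof.
move=> hi; have surj y : exists x, h x = y.
  have [q [sep_q qy]] := ks_closure.1 y.
  have [|rs Drs] := separable_splits ks_closure (q := map_poly i q).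
    by rewrite separable_map.
  have rsE z : (z \in rs) = root (map_poly i q) z.
    by rewrite (eqp_root Drs) root_prod_XsubC.
  have Urs : uniq rs.
    by rewrite -separable_prod_XsubC -(eqp_separable Drs) separable_map.
  have [|||_ /(_ y)] := @uniq_min_size _ (map h rs) rs.
  - by rewrite map_inj_uniq //; apply: fmorph_inj.
  - move=> _ /mapP[z + ->]; rewrite !rsE => qz.
    have := rmorph_root h qz.
    by rewrite -map_poly_comp (eq_map_poly hi).
  - by rewrite size_map.
  by rewrite rsE qy => /mapP[x _ ->]; exists x.
have [g hg] := choice surj.
have hI : injective h by apply: fmorph_inj.
have gh : cancel h g by move=> x; apply: hI; rewrite hg.
have [g' g'E] : exists g' : {rmorphism ks -> ks}, g' =1 g.
  apply: rmorphism_of_fun => [x y|x y|]; apply: hI.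
  - by rewrite rmorphB !hg.
  - by rewrite rmorphM !hg.
  - by rewrite rmorph1 hg.
have hK : cancel h g' by move=> x; rewrite g'E.
have gK : cancel g' h by move=> x; rewrite g'E hg.
by exists (KAut hK gK hi).
Qed.

(** L is a splitting field of the product of separable polynomials that kill the elements of [s]. *)
Lemma finite_galois_cover (s : seq ks) :
  exists (L : splittingFieldType k) (e : {rmorphism L -> ks}),
    [/\ galois 1%AS {:L}%AS, forall c : k, e c%:A = i c
      & forall x, x \in s -> exists y, e y = x].
Proof.
have [q qP] := choice ks_closure.1.
have sep_iq x : separable_poly (map_poly i (q x)).
  by have [sep _] := qP x; rewrite separable_map.
have [rs rsP] := choice (fun x => separable_splits ks_closure (sep_iq x)).
have rsE x z : (z \in rs x) = root (map_poly i (q x)) z.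
  by rewrite (eqp_root (rsP x)) root_prod_XsubC.
pose S := flatten (map rs s).
have Salg x : x \in S -> exists2 q' : {poly k}, q' != 0 & root (map_poly i q') x.
  case/flattenP=> _ /mapP[y _ ->]; rewrite rsE => qx; exists (q y) => //.
  by apply: separable_poly_neq0; case: (qP y).
have [L0 [e0 [ys [e0C Dys]]]] := adjoin_embedding Salg.
(* Passing to the subfield generated by the roots ensures that L is generated by them, as a
   splitting field requires. *)
pose L : fieldExtType k := subvs_of <<1 & ys>>; pose toL := linfun (vsval : L -> L0).
have [zs Dzs] : {zs | map toL zs = ys}.
  exists (map (vsproj _) ys); rewrite -map_comp map_id_in // => y ys_y.
  by rewrite /= lfunE /= vsprojK ?seqv_sub_adjoin.
pose e : {rmorphism L -> ks} := (e0 \o (vsval : L -> L0)).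
have eC (c : k) : e c%:A = i c.
  by rewrite -e0C /=; congr (e0 _); apply: (rmorph_alg (vsval : {lrmorphism L -> L0})).
have ezs : map e zs = S.
  transitivity (map e0 (map toL zs)); last by rewrite Dzs.
  by rewrite -map_comp; apply: eq_map => z; rewrite /= lfunE.
have defL : <<1 & zs>>%VS = {:L}%VS.
  set Lzs := LHS; pose Lys := (toL @: Lzs)%VS; apply/vspaceP=> u.
  have: val u \in Lys by rewrite /Lys aimg_adjoin_seq aimg1 Dzs (valP u).
  by case/memv_imgP=> v Lzs_v; rewrite memvf lfunE => /val_inj->.
have emap (p : {poly k}) : map_poly e (map_poly (in_alg L) p) = map_poly i p.
  by rewrite -map_poly_comp; apply: eq_map_poly => c; rewrite -eC.
pose Q := \prod_(x <- s) q x.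
have split_ax : SplittingField.axiom L.
  exists (map_poly (in_alg L) Q); first exact: alg_polyOver.
  exists zs => //; rewrite -(eqp_map e) emap.
  rewrite rmorph_prod rmorph_prod /=.
  under [X in _ %= X]eq_bigr => z _ do rewrite rmorphB /= map_polyX map_polyC.
  rewrite -(big_map e predT (fun z => 'X - z%:P)) ezs /S.
  elim: s {Q S Salg Dys ezs} => [|x s IHs]; first by rewrite !big_nil eqpxx.
  rewrite /= big_cat big_cons; apply: (eqp_trans (eqp_mulr _ (rsP x))).
  exact: eqp_mull.
pose mix := FieldExt_isSplittingField.Build k L split_ax.
pose L' : splittingFieldType k := HB.pack (FieldExt.sort L) mix.
exists L', e; split=> // [|x s_x]; last first.
  have /mapP[y _ ->] : x \in map e zs; last by exists y.
  rewrite ezs; apply/flattenP; exists (rs x); first exact: map_f.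
  by rewrite rsE; case: (qP x).
rewrite /galois sub1v normalFieldf andbT /=.
have : separable 1 <<1 & (zs : seq L')>>.
  apply/separable_Fadjoin_seq/allP=> z zs_z; apply/separable_elementP.
  have : e z \in S by rewrite -ezs map_f.
  case/flattenP=> _ /mapP[y _ ->]; rewrite rsE => qz.
  exists (map_poly (in_alg L') (q y)); split.
  - exact: alg_polyOver.
  - by rewrite -(fmorph_root e) emap.
  - by rewrite separable_map; case: (qP y).
by rewrite defL.
Qed.

Section GaloisSub.
Variables (L : splittingFieldType k) (e : {rmorphism L -> ks}).
Hypothesis eC : forall c : k, e c%:A = i c.

Lemma gal_lift (g : gal_of {:L}%AS) : exists s : kaut i, forall x, s (e x) = e (g x).
Proof.
have [eg egE] : exists eg : {rmorphism L -> ks}, eg =1 e \o g.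
  by exists (e \o g).
have [||h hE] := embedding_extends ks_closure (j := in_alg L) (e := e) (f := eg).
- exact: eC.
- move=> c; rewrite egE /= -eC; congr (e _).
  by rewrite linearZ /= rmorph1.
have [|s sE] := @endo_kaut h; last by exists s => x; rewrite sE hE egE.
by move=> c; rewrite -eC hE egE /=; congr (e _); rewrite linearZ /= rmorph1.
Qed.

(** L is normal: s (e x) is a root of the minimal polynomial of x, whose roots all lie in the image
    of [e]. *)
Lemma gal_restrict (s : kaut i) : exists g : gal_of {:L}%AS, forall x, s (e x) = e (g x).
Proof.
have exr x : exists y, e y = s (e x).
  have /normalFieldP/(_ x (memvf x))[r _ Dr] := normalFieldf (L := L) 1%AS.
  have := root_minPoly 1%AS x; rewrite -(fmorph_root e) -(fmorph_root s).
  have -> : map_poly s (map_poly e (minPoly 1%AS x)) = map_poly e (minPoly 1%AS x).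
    have /polyOver1P[q ->] := minPolyOver 1%AS x.
    rewrite -!map_poly_comp; apply: eq_map_poly => c /=.
    by rewrite eC kautP.
  rewrite Dr rmorph_prod /= => rt.
  have : s (e x) \in map e r.
    rewrite -root_prod_XsubC big_map; move: rt; congr (root _ _).
    by apply: eq_bigr => z _; rewrite rmorphB /= map_polyX map_polyC.
  by case/mapP=> y _ ->; exists y.
have [g gE] := choice exr.
have eI : injective e by apply: fmorph_inj.
have [g' g'E] : exists g' : {rmorphism L -> L}, g' =1 g.
  apply: rmorphism_of_fun => [x y|x y|]; apply: eI.
  - by rewrite !(gE, rmorphB).
  - by rewrite !(gE, rmorphM).
  - by rewrite gE !rmorph1.
have gZ : scalable g'.
  move=> c x; rewrite -mulr_algl rmorphM; rewrite -[RHS]mulr_algl; congr (_ * _).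
  by apply: eI; rewrite g'E gE eC kautP.
pose sc := GRing.isScalable.Build k L L *:%R g' gZ.
pose gl : {lrmorphism L -> L} := HB.pack (GRing.RMorphism.sort g') sc.
have hom : kHom 1 {:L} (linfun gl) by rewrite k1HomE linfun_is_ahom.
have [|x _ xE] := kHom_to_gal (M := {:L}%AS) _ (normalFieldf 1%AS) hom.
  by rewrite sub1v subvv.
exists x => y; rewrite -xE ?memvf // lfunE /=.
by rewrite g'E gE.
Qed.

End GaloisSub.

End SeparableClosure.

(** * Passage between lattices over Gal(k) and over Gal(L/k) *)

Section Deflation.
Variables (k ks : fieldType) (i : {rmorphism k -> ks}).
Hypothesis ks_closure : is_sep_closure i.

(** Continuity is stated one vector at a time; the finitely many basis vectors give one open
    subgroup acting trivially. *)
Lemma gal_lattice_open n (X : gal_lattice i n) :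
  exists S : seq ks, forall s : kaut i, {in S, forall x, s x = x} -> X s = 1%:M.
Proof.
have [S SP] := choice (fun r : 'I_n => gal_cont X (delta_mx 0 r)).
exists (flatten [seq S r | r : 'I_n]) => s sS.
apply/row_matrixP=> r; rewrite rowE SP ?row1 // => x Sx; apply: sS.
by apply/flattenP; exists (S r) => //; apply: map_f; rewrite mem_enum.
Qed.

Variables (L : splittingFieldType k) (e : {rmorphism L -> ks}).
Hypothesis eC : forall c : k, e c%:A = i c.

Lemma restrict_uniq (s : kaut i) (g h : gal_of {:L}%AS) :
  (forall x, s (e x) = e (g x)) -> (forall x, s (e x) = e (h x)) -> g = h.
Proof.
move=> sg sh; apply/eqP/gal_eqP => x _; apply: (fmorph_inj e).
by rewrite -sg sh.
Qed.

Lemma deflation_exists n (X : gal_lattice i n) :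
  (forall s : kaut i, (forall x, s (e x) = e x) -> X s = 1%:M) ->
  exists N : lattice (gal_of {:L}%AS) n, deflation e X N.
Proof.
move=> XL; have [l lP] := choice (gal_lift ks_closure eC).
have uniq_lift (s t : kaut i) : (forall x, s (e x) = t (e x)) -> X s = X t.
  move=> st; rewrite -[s]mulg1 -(mulVg t) mulgA actM XL ?mul1mx // => x.
  by rewrite /= st kautK.
pose N g := X (l g).
have N1 : N 1%g = 1%:M by apply: XL => x; rewrite lP gal_id.
have NM g h : N (g * h)%g = N g *m N h.
  by rewrite -actM; apply: uniq_lift => x; rewrite /= !lP galM ?memvf.
exists (Lattice N1 NM) => s g sg.
by apply: uniq_lift => x; rewrite sg lP.
Qed.

Lemma inflation_exists n (N : lattice (gal_of {:L}%AS) n) :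
  exists X : gal_lattice i n, deflation e X N.
Proof.
have [r rP] := choice (gal_restrict eC).
pose X s := N (r s).
have X1 : X 1%g = 1%:M.
  by rewrite /X (@restrict_uniq 1%g (r 1%g) 1%g) ?act1 // => x; rewrite gal_id.
have XM s t : X (s * t)%g = X s *m X t.
  rewrite -actM; congr (N _); apply: (@restrict_uniq (s * t)%g) => // x.
  by rewrite /= !rP galM ?memvf.
have cont (v : 'rV[int]_n) : exists S : seq ks,
    forall s : kaut i, {in S, forall x, s x = x} -> v *m Lattice X1 XM s = v.
  exists (map e (vbasis {:L}%VS)) => s sS; rewrite /= /X.
  rewrite (@restrict_uniq s (r s) 1%g) ?act1 ?mulmx1 // => x; rewrite gal_id.
  rewrite (coord_vbasis (memvf x)) !rmorph_sum /=; apply: eq_bigr => j _.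
  rewrite -[_ *: _]mulr_algl !rmorphM /= eC kautP; congr (_ * _).
  by apply: sS; apply/map_f/mem_nth; rewrite size_tuple.
exists (GalLattice cont) => s g sg; congr (N _); exact: restrict_uniq sg.
Qed.

Lemma permutation_deflation n (X : gal_lattice i n) N : deflation e X N ->
  permutation_lattice X -> permutation_lattice N.
Proof.
move=> XN [B uB XB]; exists B => // g r.
by have [s /XN <-] := gal_lift ks_closure eC g.
Qed.

Lemma permutation_inflation n (X : gal_lattice i n) N : deflation e X N ->
  permutation_lattice N -> permutation_lattice X.
Proof.
move=> XN [B uB NB]; exists B => // s r.
by have [g /XN ->] := gal_restrict eC s.
Qed.

Lemma equivariant_deflation m n (X : gal_lattice i m) (Y : gal_lattice i n) N O f :
  deflation e X N -> deflation e Y O -> equivariant X Y f -> equivariant N O f.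
Proof.
move=> XN YO eqf g; have [s sg] := gal_lift ks_closure eC g.
by rewrite -(XN s) // -(YO s).
Qed.

Lemma equivariant_inflation m n (X : gal_lattice i m) (Y : gal_lattice i n) N O f :
  deflation e X N -> deflation e Y O -> equivariant N O f -> equivariant X Y f.
Proof.
move=> XN YO eqf s; have [g sg] := gal_restrict eC s.
by rewrite (XN s g) // (YO s g).
Qed.

Lemma factorizable_inflation p n (X : gal_lattice i n) N : deflation e X N ->
  p_factorizable p N -> p_factorization p X.
Proof.
move=> XN [m [r [t [M [P [Q [j [q [a [b [d [[pP pQ] ex [eqa eqb] pd ab]]]]]]]]]]]].
have [M' MM'] := inflation_exists M; have [P' PP'] := inflation_exists P.
have [Q' QQ'] := inflation_exists Q; have [[eqj eqq] jI qK qS] := ex.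
exists m, r, t, M', P', Q', j, q, a, b, d; split=> //.
- by split; [apply: permutation_inflation PP' pP | apply: permutation_inflation QQ' pQ].
- split=> //; split; first exact: equivariant_inflation XN MM' eqj.
  exact: equivariant_inflation MM' QQ' eqq.
- split; first exact: equivariant_inflation XN PP' eqa.
  exact: equivariant_inflation PP' MM' eqb.
Qed.

End Deflation.

Section LargeGaloisExtension.
Variables (k ks : fieldType) (i : {rmorphism k -> ks}).
Hypothesis ks_closure : is_sep_closure i.

(** M, P and Q are lattices over Gal(L/k) as soon as L contains the finite set [S] whose pointwise
    stabilizer acts trivially on all three. *)
Lemma factorization_open p n (X : gal_lattice i n) : p_factorization p X ->
  exists S : seq ks, forall (L : splittingFieldType k) (e : {rmorphism L -> ks}) N,
    (forall c : k, e c%:A = i c) -> (forall x, x \in S -> exists y, e y = x) ->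
    deflation e X N -> p_factorizable p N.
Proof.
move=> [m [r [t [M [P [Q [j [q [a [b [d [[pP pQ] ex [eqa eqb] pd ab]]]]]]]]]]]].
have [SM MS] := gal_lattice_open M; have [SP PS] := gal_lattice_open P.
have [SQ QS] := gal_lattice_open Q; have [[eqj eqq] jI qK qS] := ex.
exists (SM ++ SP ++ SQ) => L e N eC Se XN.
have trivL S' (s : kaut i) : {subset S' <= SM ++ SP ++ SQ} ->
    (forall x, s (e x) = e x) -> {in S', forall x, s x = x}.
  by move=> sub sL x /sub/Se[y <-].
have [|M' MM'] := deflation_exists ks_closure eC (X := M).
  by move=> s sL; apply/MS/trivL => // x xS; rewrite mem_cat xS.
have [|P' PP'] := deflation_exists ks_closure eC (X := P).
  by move=> s sL; apply/PS/trivL => // x xS; rewrite !mem_cat xS orbT.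
have [|Q' QQ'] := deflation_exists ks_closure eC (X := Q).
  by move=> s sL; apply/QS/trivL => // x xS; rewrite !mem_cat xS !orbT.
have perm_def := permutation_deflation ks_closure eC.
have eq_def := equivariant_deflation ks_closure eC.
exists m, r, t, M', P', Q', j, q, a, b, d; split=> //.
- by split; [apply: perm_def PP' pP | apply: perm_def QQ' pQ].
- split=> //; split; first exact: eq_def XN MM' eqj.
  exact: eq_def MM' QQ' eqq.
- split; first exact: eq_def XN PP' eqa.
  exact: eq_def PP' MM' eqb.
Qed.

Lemma flasque_class_factorization (T : groupvar k) p (p_prime : prime p) n
    (That : gal_lattice i n) :
  torus_flasque_class_p_invertible T p That -> p_factorization p That.
Proof.
case=> L [e [N [[_ eC] _ TN /(flasque_class_factorizable p_prime) fN]]].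
exact: factorizable_inflation eC _ _ _ _ TN fN.
Qed.

End LargeGaloisExtension.

(** * Localizations and Laurent polynomials *)

Section FractionField.
Variable A : idomainType.
Local Notation tofrac := (@FracField.tofrac A).

Lemma fraction_ratio (z : {fraction A}) :
  exists a b : A, b != 0 /\ z = tofrac a / tofrac b.
Proof.
elim/quotW: z => z; have nzd : \d_z != 0 by apply: denom_ratioP.
exists (\n_z), (\d_z); split=> //.
apply: (canRL (mulfK _)); first by rewrite tofrac_eq0.
unlock FracField.tofrac; rewrite -[LHS]FracField.pi_mul /FracField.mulf.
rewrite !numden_Ratio ?oner_neq0 // mulr1; apply/eqmodP/eqP => /=.
by rewrite !numden_Ratio ?oner_neq0 // mulr1 mulrC.
Qed.

Lemma fraction_hom_eq (F : fieldType) (f g : {rmorphism {fraction A} -> F}) :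
  (forall a, f (tofrac a) = g (tofrac a)) -> f =1 g.
Proof.
by move=> fg z; have [a [b [_ ->]]] := fraction_ratio z; rewrite !fmorph_div !fg.
Qed.

Lemma fraction_extend (F : fieldType) (h : {rmorphism A -> F}) : injective h ->
  exists h' : {rmorphism {fraction A} -> F}, forall a, h' (tofrac a) = h a.
Proof.
move=> hI; have h_eq0 a : (h a == 0) = (a == 0) by rewrite -(rmorph0 h) (inj_eq hI).
have [n_ nP] := choice fraction_ratio; have [d_ dP] := choice nP.
pose f z := h (n_ z) / h (d_ z).
have fE a b : b != 0 -> f (tofrac a / tofrac b) = h a / h b.
  move=> nzb; have [nzd Ez] := dP (tofrac a / tofrac b).
  apply/eqP; rewrite /f eqr_div ?h_eq0 // -!rmorphM (inj_eq hI).
  move/eqP: Ez; rewrite eqr_div ?tofrac_eq0 // -!tofracM tofrac_eq.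
  by rewrite eq_sym.
have [f' f'E] : exists f' : {rmorphism {fraction A} -> F}, f' =1 f.
  apply: rmorphism_of_fun => [x y|x y|].
  - have [a [b [nzb ->]]] := fraction_ratio x; have [c [d [nzd ->]]] := fraction_ratio y.
    rewrite !fE // -mulNr addf_div ?tofrac_eq0 // -tofracN -!tofracM -tofracD fE ?mulf_neq0 //.
    by rewrite -mulNr addf_div ?h_eq0 // rmorphD !rmorphM rmorphN.
  - have [a [b [nzb ->]]] := fraction_ratio x; have [c [d [nzd ->]]] := fraction_ratio y.
    by rewrite !fE // !mulf_div -!tofracM fE ?mulf_neq0 // !rmorphM.
  - by have := fE 1 1 (oner_neq0 _); rewrite !rmorph1 !divr1.
exists f' => a; rewrite f'E.
by have := fE a 1 (oner_neq0 _); rewrite !rmorph1 !divr1.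
Qed.

End FractionField.

(** * Localization at one element *)

Section Localization.
Variables (A : idomainType) (D : A).
Hypothesis nz_D : D != 0.
Local Notation tofrac := (@FracField.tofrac A).

(** A[1/D] is a subring of the fraction field, so that it is a domain and its elements are rational
    functions through [val]. *)
Definition loc_pred : {pred {fraction A}} :=
  [pred z | `[< exists N f, z * tofrac D ^+ N = tofrac f >]].

Lemma loc_predP z :
  reflect (exists N f, z * tofrac D ^+ N = tofrac f) (z \in loc_pred).
Proof. exact: asboolP. Qed.

Fact loc_closed : subring_closed loc_pred.
Proof.
split=> [|x y /loc_predP[N [f Ef]] /loc_predP[M [g Eg]]
         |x y /loc_predP[N [f Ef]] /loc_predP[M [g Eg]]]; apply/loc_predP.
- by exists 0, 1; rewrite expr0 mulr1 tofrac1.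
- exists (N + M)%N, (f * D ^+ M - g * D ^+ N).
  by rewrite tofracB !tofracM !tofracXn -Ef -Eg exprD; ring.
- by exists (N + M)%N, (f * g); rewrite exprD mulrACA Ef Eg tofracM.
Qed.

Definition loc := subring loc_closed.

Lemma tofrac_loc a : tofrac a \in loc_pred.
Proof. by apply/loc_predP; exists 0, a; rewrite expr0 mulr1. Qed.

Definition loc_of (a : A) : loc := Subring (tofrac_loc a).

Fact loc_of_zmod : zmod_morphism loc_of.
Proof. by move=> a b; apply: val_inj; rewrite /= tofracB. Qed.
Fact loc_of_monoid : monoid_morphism loc_of.
Proof. by split=> [|a b]; apply: val_inj; rewrite /= ?tofrac1 ?tofracM. Qed.
HB.instance Definition _ := GRing.isZmodMorphism.Build A loc loc_of loc_of_zmod.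
HB.instance Definition _ := GRing.isMonoidMorphism.Build A loc loc_of loc_of_monoid.

Lemma locP (z : loc) : exists N f, z * loc_of D ^+ N = loc_of f.
Proof.
case: z => z zP; have /loc_predP[N [f Ef]] := zP; exists N, f.
by apply: val_inj; rewrite /= -Ef rmorphXn.
Qed.

Lemma loc_inv : exists w : loc, loc_of D * w = 1.
Proof.
have Dw : (tofrac D)^-1 \in loc_pred.
  by apply/loc_predP; exists 1%N, 1; rewrite expr1 mulVf ?tofrac_eq0 ?tofrac1.
by exists (Subring Dw); apply: val_inj; rewrite /= mulfV ?tofrac_eq0.
Qed.

Lemma loc_hom_eq (R : comPzRingType) (f g : {rmorphism loc -> R}) :
  (forall a, f (loc_of a) = g (loc_of a)) -> f =1 g.
Proof.
move=> fg z; have [N [a Ea]] := locP z; have [w Dw] := loc_inv.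
have Dw1 (h : {rmorphism loc -> R}) : h (loc_of D) * h w = 1 by rewrite -rmorphM Dw rmorph1.
have hz (h : {rmorphism loc -> R}) : h z = h (loc_of a) * h w ^+ N.
  by rewrite -Ea rmorphM rmorphXn -mulrA -exprMn Dw1 expr1n mulr1.
have gw : g w = f w.
  by rewrite -[LHS]mulr1 -(Dw1 f) fg mulrA (mulrC (g w)) (Dw1 g) mul1r.
by rewrite !hz fg gw.
Qed.

Lemma loc_extend (R : comPzRingType) (h : {rmorphism A -> R}) (w : R) :
  h D * w = 1 -> exists h' : {rmorphism loc -> R}, forall a, h' (loc_of a) = h a.
Proof.
move=> Dw; have [N_ NP] := choice locP; have [f_ fP] := choice NP.
pose h0 z := h (f_ z) * w ^+ N_ z.
have DwX N : h D ^+ N * w ^+ N = 1 by rewrite -exprMn Dw expr1n.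
have locI : injective loc_of.
  by move=> a b /(congr1 val)/eqP; rewrite /= tofrac_eq => /eqP.
have hE z N f : z * loc_of D ^+ N = loc_of f -> h0 z = h f * w ^+ N.
  move=> Ef; have : f_ z * D ^+ N = f * D ^+ N_ z.
    by apply: locI; rewrite !rmorphM !rmorphXn /= -fP -Ef mulrAC.
  move/(congr1 (fun t => h t * w ^+ N * w ^+ N_ z)).
  rewrite !rmorphM !rmorphXn => E; rewrite /h0.
  transitivity (h (f_ z) * h D ^+ N * w ^+ N * w ^+ N_ z).
    by rewrite -(mulrA _ (h D ^+ N)) DwX mulr1.
  rewrite E -[RHS]mulr1 -(DwX (N_ z)); ring.
have [h' h'E] : exists h' : {rmorphism loc -> R}, h' =1 h0.
  apply: rmorphism_of_fun => [x y|x y|].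
  - rewrite (hE (x - y) (N_ x + N_ y)%N (f_ x * D ^+ N_ y - f_ y * D ^+ N_ x)).
      rewrite rmorphB !rmorphM !rmorphXn exprD /h0.
      rewrite mulrBl; congr (_ - _).
        by rewrite -[RHS]mulr1 -(DwX (N_ y)); ring.
      by rewrite -[RHS]mulr1 -(DwX (N_ x)); ring.
    by rewrite rmorphB !rmorphM !rmorphXn /= -!fP exprD; ring.
  - rewrite (hE (x * y) (N_ x + N_ y)%N (f_ x * f_ y)).
      by rewrite rmorphM exprD mulrACA.
    by rewrite rmorphM /= -!fP exprD mulrACA.
  - by rewrite (hE 1 0 1) ?rmorph1 ?expr0 ?mulr1.
exists h' => a; rewrite h'E (hE _ 0 a) ?expr0 ?mulr1 //.
Qed.

End Localization.

Section PolynomialEvaluation.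
Variables (K : comNzRingType) (n : nat).

Lemma mpoly_eval_exists (R : comPzRingType) (phi : {rmorphism K -> R}) (v : 'I_n -> R) :
  exists h : {rmorphism {mpoly K[n]} -> R},
    (forall c, h c%:MP = phi c) /\ (forall l, h 'X_l = v l).
Proof.
(* Algebras may be zero rings, whereas [mmap] is applied to a nontrivial one. *)
have [E|ne] := eqVneq (1 : R) 0.
  have R0 (x y : R) : x = y by rewrite -[x]mulr1 -[y]mulr1 E !mulr0.
  have [|||h hE] := @rmorphism_of_fun {mpoly K[n]} R (fun=> 0) => //.
  by exists h; split=> *; apply: R0.
pose R' : comNzRingType := HB.pack R (GRing.PzSemiRing_isNonZero.Build R ne).
pose h : {rmorphism {mpoly K[n]} -> R'} := mmap (phi : {rmorphism K -> R'}) v.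
exists h; split=> [c|l]; first by rewrite /h /= mmapC.
by rewrite /h /= mmapX mmap1U.
Qed.

Lemma mpoly_hom_eq (R : pzRingType) (f g : {rmorphism {mpoly K[n]} -> R}) :
  (forall c, f c%:MP = g c%:MP) -> (forall l, f 'X_l = g 'X_l) -> f =1 g.
Proof.
move=> fgC fgX p; rewrite [p]mpolyE !rmorph_sum; apply: eq_bigr => m _.
rewrite -mul_mpolyC !rmorphM fgC; congr (_ * _).
rewrite mpolyXE_id !rmorph_prod; apply: eq_bigr => l _.
by rewrite !rmorphXn fgX.
Qed.

End PolynomialEvaluation.

Section MonomialHom.
Variables (n : nat) (R : comPzRingType).

Lemma row_int_ind (P : 'rV[int]_n -> Prop) :
  P 0 -> (forall l, P (delta_mx 0 l)) -> (forall v w, P v -> P w -> P (v - w)) ->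
  forall v, P v.
Proof.
move=> P0 Pd PB.
have PN v : P v -> P (- v) by move=> Pv; rewrite -[- v]add0r; apply: PB.
have PD v w : P v -> P w -> P (v + w).
  by move=> Pv Pw; rewrite -[w]opprK; apply: PB => //; apply: PN.
move=> v; rewrite [v]row_sum_delta; apply: big_ind => // l _.
elim/int_rec: (v 0 l) => [|m IHm|m IHm].
- by rewrite scale0r.
- by rewrite intS scalerDl scale1r; apply: PD.
- by rewrite intS opprD scalerDl scaleN1r addrC; apply: PB.
Qed.

Lemma row_int_hom_eq (f g : 'rV[int]_n -> R) :
  f 0 = 1 -> g 0 = 1 -> {morph f : v w / v + w >-> v * w} ->
  {morph g : v w / v + w >-> v * w} ->
  (forall l, f (delta_mx 0 l) = g (delta_mx 0 l)) -> f =1 g.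
Proof.
move=> f0 g0 fD gD fg; apply: row_int_ind => [||v w Ev Ew]; first by rewrite f0.
  exact: fg.
have fN : f w * f (- w) = 1 by rewrite -fD subrr.
have gN : g w * g (- w) = 1 by rewrite -gD subrr.
rewrite fD gD Ev; congr (_ * _).
by rewrite -[LHS]mulr1 -gN -Ew mulrA (mulrC (f _)) fN mul1r.
Qed.

End MonomialHom.

(** * Laurent polynomials as the group algebra of Z^n *)

Section Laurent.
Variables (K : fieldType) (n : nat).
Local Notation P := {mpoly K[n]}.
Local Notation tofrac := (@FracField.tofrac P).

Definition ratfun : fieldType := {fraction {mpoly K[n]}}.

(** Inverting the product of all variables turns the polynomial ring into K[Z^n]. *)
Definition lauD : P := \prod_l 'X_l.

Fact lauD_neq0 : lauD != 0.
Proof. by apply/prodf_neq0 => l _; rewrite -msupp_eq0 msuppX. Qed.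

Definition lau := loc lauD.
Definition lauC (c : K) : lau := loc_of lauD c%:MP.

Fact lauC_zmod : zmod_morphism lauC.
Proof. by move=> a b; rewrite /lauC rmorphB /= rmorphB. Qed.
Fact lauC_monoid : monoid_morphism lauC.
Proof. by split=> [|a b]; rewrite /lauC ?rmorph1 // rmorphM /= rmorphM. Qed.
HB.instance Definition _ := GRing.isZmodMorphism.Build K lau lauC lauC_zmod.
HB.instance Definition _ := GRing.isMonoidMorphism.Build K lau lauC lauC_monoid.

Definition lau_alg : kalg K := KAlg (lauC : {rmorphism K -> lau}).

Definition xm (m : 'rV[int]_n) : ratfun := \prod_l (tofrac 'X_l) ^ (m 0 l).

Fact X_neq0 l : tofrac 'X_l != 0.
Proof. by rewrite tofrac_eq0 -msupp_eq0 msuppX. Qed.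

Lemma xm0 : xm 0 = 1.
Proof. by rewrite /xm big1 // => l _; rewrite mxE expr0z. Qed.

Lemma xmD : {morph xm : v w / v + w >-> v * w}.
Proof.
move=> v w; rewrite -big_split; apply: eq_bigr => l _ /=.
by rewrite mxE expfzDr ?X_neq0.
Qed.

Lemma xm_neq0 v : xm v != 0.
Proof. by apply/prodf_neq0 => l _; rewrite expfz_neq0 ?X_neq0. Qed.

Lemma xmN v : xm (- v) = (xm v)^-1.
Proof. by apply: (mulfI (xm_neq0 v)); rewrite -xmD subrr xm0 mulfV ?xm_neq0. Qed.

Lemma xm_delta l : xm (delta_mx 0 l) = tofrac 'X_l.
Proof.
rewrite /xm (bigD1 l) //= mxE !eqxx expr1z big1 ?mulr1 // => j /negPf ne.
by rewrite mxE ne andbF expr0z.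
Qed.

Lemma xm_nat (m : 'X_{1..n}) : xm (\row_l (m l)%:Z) = tofrac 'X_[m].
Proof.
rewrite mpolyXE_id rmorph_prod; apply: eq_bigr => l _.
by rewrite mxE rmorphXn -exprnP.
Qed.

Lemma lauD_xm : tofrac lauD = xm (const_mx 1).
Proof.
by rewrite rmorph_prod; apply: eq_bigr => l _; rewrite mxE expr1z.
Qed.

Lemma lauD_X N : lauD ^+ N = 'X_[[multinom N | l < n]].
Proof.
rewrite mpolyXE_id -prodrXl; apply: eq_bigr => l _.
by rewrite mnmE.
Qed.

Lemma xm_in m : xm m \in loc_pred lauD.
Proof.
suff: xm m \in loc_pred lauD /\ xm (- m) \in loc_pred lauD by case.
have [l1 _ lM] := loc_closed lauD.
elim/row_int_ind: m => [|l|v w [vin vin'] [win win']].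
- by rewrite oppr0 xm0.
- split; first by rewrite xm_delta tofrac_loc.
  apply/loc_predP; exists 1%N, (\prod_(j | j != l) 'X_j).
  rewrite expr1 /lauD (bigD1 l) //= tofracM mulrA xmN xm_delta.
  by rewrite mulVf ?mul1r ?X_neq0.
- by rewrite opprB !xmD; split; apply: lM.
Qed.

Definition lx m : lau := Subring (xm_in m).

Lemma lx0 : lx 0 = 1.
Proof. by apply: val_inj; rewrite /= xm0. Qed.

Lemma lxD : {morph lx : v w / v + w >-> v * w}.
Proof. by move=> v w; apply: val_inj; rewrite /= xmD. Qed.

Lemma lx_delta l : lx (delta_mx 0 l) = loc_of lauD 'X_l.
Proof. by apply: val_inj; rewrite /= xm_delta. Qed.

Lemma lx_nat (m : 'X_{1..n}) : lx (\row_l (m l)%:Z) = loc_of lauD 'X_[m].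
Proof. by apply: val_inj; rewrite /= xm_nat. Qed.

Lemma lx_unit m : lx m * lx (- m) = 1.
Proof. by rewrite -lxD subrr lx0. Qed.

Lemma lau_hom_eq (R : comPzRingType) (f g : {rmorphism lau -> R}) :
  (forall c, f (lauC c) = g (lauC c)) ->
  (forall l, f (lx (delta_mx 0 l)) = g (lx (delta_mx 0 l))) -> f =1 g.
Proof.
move=> fgC fgX; apply: (loc_hom_eq lauD_neq0).
apply: (@mpoly_hom_eq _ _ _ (f \o loc_of lauD) (g \o loc_of lauD)) => [c|l].
  exact: fgC.
by rewrite /= -lx_delta.
Qed.

Lemma lau_eval (R : comPzRingType) (phi : {rmorphism K -> R}) (v : 'rV[int]_n -> R) :
  v 0 = 1 -> {morph v : a b / a + b >-> a * b} ->
  exists h : {rmorphism lau -> R},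
    (forall c, h (lauC c) = phi c) /\ (forall m, h (lx m) = v m).
Proof.
move=> v0 vD.
have [h [hC hX]] := mpoly_eval_exists phi (fun l => v (delta_mx 0 l)).
have vprod (I : Type) (r : seq I) (P : pred I) F :
    v (\sum_(j <- r | P j) F j) = \prod_(j <- r | P j) v (F j).
  exact: (big_morph v vD v0).
have hD : h lauD * v (- \sum_l delta_mx 0 l) = 1.
  rewrite rmorph_prod /= (eq_bigr (fun l => v (delta_mx 0 l))) => [|l _]; last exact: hX.
  by rewrite -vprod -vD subrr.
have [h' h'E] := loc_extend hD.
exists h'; split=> [c|]; first by rewrite /= h'E hC.
apply: row_int_hom_eq => // [|a b|l]; first by rewrite lx0 rmorph1.
  by rewrite lxD rmorphM.
by rewrite lx_delta h'E hX.
Qed.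

Definition mshift N (m : 'rV[int]_n) : 'X_{1..n} :=
  [multinom absz (m 0%R l + N%:Z)%R | l < n].

Lemma xm_shift N (m : 'rV[int]_n) : (forall l, 0 <= m 0 l + N%:Z) ->
  xm m * tofrac lauD ^+ N = tofrac 'X_[mshift N m].
Proof.
move=> mN; rewrite -xm_nat; have -> : \row_l (mshift N m l)%:Z = m + const_mx 1 *+ N.
  apply/rowP=> l; rewrite mxE mnmE mxE mulmxnE mxE natz; exact: gez0_abs.
rewrite xmD lauD_xm; congr (_ * _).
by elim: N {mN} => [|N IHN]; rewrite ?xm0 // exprS mulrS xmD IHN.
Qed.

Lemma lcoef_exists (m : 'rV[int]_n) : exists c : lau -> K,
  {morph c : z w / z + w} /\
  forall a m', c (lauC a * lx m') = a * (m' == m)%:R.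
Proof.
have [N_ NP] := choice (locP (D := lauD)); have [f_ fP] := choice NP.
pose nn N := [forall l, 0 <= m 0 l + N%:Z].
(* The coefficient of x^m in f / (X_1 ... X_n)^N is that of f at m + N, or 0 if m + N has a negative
   entry. By [shift] it does not depend on the chosen denominator. *)
pose cf N (f : P) := if nn N then f@_(mshift N m) else 0.
have shift N f M : cf (N + M)%N (f * lauD ^+ M) = cf N f.
  rewrite /cf lauD_X; case: ifP => [/forallP nNM|nNM].
    case: ifP => [/forallP nN | /negbT/forallPn[l lP]].
      have -> : mshift (N + M) m = ([multinom M | l < n] + mshift N m)%MM.
        apply/mnmP=> l; rewrite mnmDE !mnmE.
        by have := nN l; have := nNM l; lia.
      by rewrite mcoeffMX.
    apply/eqP; rewrite mcoeff_eq0 (perm_mem (msuppMX _ _)).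
    apply/negP=> /mapP[m' _ /mnmP/(_ l)]; rewrite mnmDE !mnmE.
    by have := nNM l; lia.
  case: ifP => // /forallP nN; move/negP: nNM; case; apply/forallP=> l.
  by have := nN l; lia.
have cfD N f g : cf N (f + g) = cf N f + cf N g.
  by rewrite /cf; case: ifP; rewrite ?addr0 // mcoeffD.
pose c z := cf (N_ z) (f_ z).
have locI : injective (loc_of lauD).
  by move=> a b /(congr1 val)/eqP; rewrite /= tofrac_eq => /eqP.
have cE z N f : z * loc_of lauD lauD ^+ N = loc_of lauD f -> c z = cf N f.
  move=> Ef; rewrite /c -(shift _ _ N) -(shift N f (N_ z)) addnC; congr (cf _ _).
  by apply: locI; rewrite !rmorphM !rmorphXn /= -fP -Ef; ring.
exists c; split=> [z w|a m'].
  rewrite (cE (z + w) (N_ z + N_ w)%N (f_ z * lauD ^+ N_ w + f_ w * lauD ^+ N_ z)).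
    by rewrite cfD shift addnC shift.
  by rewrite rmorphD !rmorphM !rmorphXn /= -!fP exprD; ring.
pose N := (\sum_l absz (m' 0%R l))%N.
have mN' l : 0 <= m' 0 l + N%:Z.
  have : (absz (m' 0%R l) <= N)%N by rewrite /N (bigD1 l) //= leq_addr.
  by lia.
rewrite (cE _ N (a *: 'X_[mshift N m'])); last first.
  apply: val_inj; rewrite /= -mul_mpolyC tofracM -xm_shift //.
  by rewrite rmorphXn mulrA.
rewrite /cf; case: ifP => [/forallP nN|nN].
  rewrite mcoeffZ mcoeffX; congr (_ * (nat_of_bool _)%:R).
  apply/eqP/eqP => [/mnmP E|->//]; apply/rowP=> l.
  have := E l; rewrite !mnmE => El; suff: m' 0 l = m 0 l by [].
  by have := nN l; have := mN' l; lia.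
case: eqP => [E|_]; last by rewrite mulr0.
by move/forallP: nN; case=> l; rewrite -E.
Qed.

Lemma lauD_exp N : loc_of lauD lauD ^+ N = lx (const_mx N%:Z).
Proof.
apply: val_inj; rewrite rmorphXn /= lauD_xm.
have -> : const_mx N%:Z = const_mx 1 *+ N :> 'rV[int]_n.
  by apply/rowP=> l; rewrite mulmxnE !mxE natz.
by elim: N => [|N IHN]; rewrite ?xm0 // exprS mulrS xmD IHN.
Qed.

Lemma lau_expand (z : lau) : exists s : seq (K * 'rV[int]_n),
  z = \sum_(a <- s) lauC a.1 * lx a.2.
Proof.
have [N [f Ef]] := locP z.
exists [seq (f@_m, \row_l (m l)%:Z - const_mx N%:Z) | m <- msupp f].
rewrite big_map /=; have Du : lx (const_mx N%:Z) * lx (- const_mx N%:Z) = 1.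
  exact: lx_unit.
rewrite -[LHS]mulr1 -Du mulrA -lauD_exp Ef [in LHS](mpolyE f) rmorph_sum mulr_suml.
apply: eq_bigr => m _; rewrite lxD lx_nat mulrA -mul_mpolyC.
by rewrite rmorphM.
Qed.

End Laurent.

Section LaurentCoefficients.
Variables (K : fieldType) (n : nat).

Definition lcoef (m : 'rV[int]_n) : lau K n -> K := projT1 (cid (lcoef_exists K m)).

Lemma lcoefD m : {morph lcoef m : z w / z + w}.
Proof. exact: (projT2 (cid (lcoef_exists K m))).1. Qed.

Lemma lcoefE m a m' : lcoef m (lauC n a * lx K m') = a * (m' == m)%:R.
Proof. exact: (projT2 (cid (lcoef_exists K m))).2. Qed.

Lemma lcoef0 m : lcoef m 0 = 0.
Proof. by apply: (addrI (lcoef m 0)); rewrite -lcoefD !addr0. Qed.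

Lemma lcoef_sum m (I : Type) (r : seq I) (P : pred I) F :
  lcoef m (\sum_(j <- r | P j) F j) = \sum_(j <- r | P j) lcoef m (F j).
Proof. exact: (big_morph _ (lcoefD m) (lcoef0 m)). Qed.

Lemma lcoefM m a m' z :
  lcoef m (lauC n a * lx K m' * z) = a * lcoef (m - m') z.
Proof.
have [s ->] := lau_expand z; rewrite mulr_sumr !lcoef_sum mulr_sumr.
apply: eq_bigr => b _; rewrite mulrACA -rmorphM -lxD !lcoefE mulrA.
by rewrite [b.2 == _]eq_sym subr_eq [m == _]eq_sym addrC.
Qed.

Lemma lcoef_inj z : (forall m, lcoef m z = 0) -> z = 0.
Proof.
have [s ->] := lau_expand z; move: s => s.
have [N sN] := ubnP (size s); elim: N => // N IHN in s sN * => s0.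
case: s sN s0 => [|a s] sN s0; first by rewrite big_nil.
(* The terms with the exponent of the first one are collected. Their total is the coefficient of z
   there, hence zero, and fewer terms remain. *)
pose t := [seq b <- s | b.2 == a.2]; pose t' := [seq b <- s | b.2 != a.2].
have sE : \sum_(b <- a :: s) lauC n b.1 * lx K b.2 =
    lauC n (a.1 + \sum_(b <- t) b.1) * lx K a.2 + \sum_(b <- t') lauC n b.1 * lx K b.2.
  rewrite big_cons (bigID (fun b => b.2 == a.2)) /= addrA; congr (_ + _).
    rewrite (_ : lauC n (_ + _) = lauC n a.1 + \sum_(b <- t) lauC n b.1).
      rewrite mulrDl mulr_suml; congr (_ + _).
      by rewrite big_filter; apply: eq_bigr => b /eqP->.
    by rewrite rmorphD rmorph_sum.
  by rewrite big_filter.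
have c0 : a.1 + \sum_(b <- t) b.1 = 0.
  have := s0 a.2; rewrite sE lcoefD lcoefE eqxx mulr1 lcoef_sum.
  rewrite [X in _ + X]big1_seq ?addr0 // => b /andP[_].
  by rewrite mem_filter lcoefE => /andP[/negPf->]; rewrite mulr0.
move: s0; rewrite sE c0 rmorph0 mul0r add0r => s0.
apply: IHN => //; apply: leq_ltn_trans (_ : size s < N)%N; last by [].
by rewrite size_filter count_size.
Qed.

End LaurentCoefficients.

Section LaurentMaps.

Lemma lau_map (K K' : fieldType) (g : {rmorphism K -> K'}) n n' (B : 'M[int]_(n, n')) :
  exists h : {rmorphism lau K n -> lau K' n'},
    (forall c, h (lauC n c) = lauC n' (g c)) /\ (forall m, h (lx K m) = lx K' (m *m B)).
Proof.
apply: (lau_eval (@lauC K' n' \o g)) => [|v w]; first by rewrite mul0mx lx0.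
by rewrite mulmxDl lxD.
Qed.

Lemma lau_map_coef (K K' : fieldType) (g : {rmorphism K -> K'}) n n' (B : 'M[int]_(n, n'))
    (h : {rmorphism lau K n -> lau K' n'}) :
  (forall c, h (lauC n c) = lauC n' (g c)) -> (forall m, h (lx K m) = lx K' (m *m B)) ->
  injective (fun m : 'rV_n => m *m B) ->
  forall z m, lcoef (m *m B) (h z) = g (lcoef m z).
Proof.
move=> hC hX BI z m; have [s ->] := lau_expand z.
rewrite rmorph_sum !lcoef_sum rmorph_sum; apply: eq_bigr => a _.
by rewrite rmorphM hC hX !lcoefE rmorphM rmorph_nat (inj_eq BI).
Qed.

Lemma lau_map_inj (K K' : fieldType) (g : {rmorphism K -> K'}) n n' (B : 'M[int]_(n, n'))
    (h : {rmorphism lau K n -> lau K' n'}) :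
  (forall c, h (lauC n c) = lauC n' (g c)) -> (forall m, h (lx K m) = lx K' (m *m B)) ->
  injective (fun m : 'rV_n => m *m B) -> injective h.
Proof.
move=> hC hX BI; apply: raddf_inj => z hz0; apply: lcoef_inj => m.
apply/eqP; rewrite -(fmorph_eq0 g) -(lau_map_coef hC hX BI) hz0.
by rewrite lcoef0.
Qed.

End LaurentMaps.

(** The ring has no inversion operation, so negative powers are powers of the given inverses; [fE]
    shows that only differences of exponents matter. *)
Lemma units_monomial n (R : comPzRingType) (v w : 'I_n -> R) :
  (forall l, v l * w l = 1) ->
  exists V : 'rV[int]_n -> R,
    [/\ V 0 = 1, {morph V : a b / a + b >-> a * b} & forall l, V (delta_mx 0 l) = v l].
Proof.
move=> vw.
pose f l (z : int) := if z is Posz m then v l ^+ m else w l ^+ absz z.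
have vwX l m : v l ^+ m * w l ^+ m = 1 by rewrite -exprMn vw expr1n.
have fE l (p q : nat) : f l (p%:Z - q%:Z) = v l ^+ p * w l ^+ q.
  have fz z : exists p' q' : nat, z = p'%:Z - q'%:Z /\ f l z = v l ^+ p' * w l ^+ q'.
    case: z => m; first by exists m, 0; rewrite subr0 mulr1.
    by exists 0, m.+1; rewrite sub0r mul1r.
  have [p' [q' [E ->]]] := fz (p%:Z - q%:Z).
  have {}E : (p + q' = p' + q)%N by lia.
  rewrite -[RHS]mulr1 -(vwX l q') mulrACA -exprD E exprD.
  rewrite -[LHS]mulr1 -(vwX l q); ring.
have f0 l : f l 0 = 1 by rewrite /f expr0.
have fD l a b : f l (a + b) = f l a * f l b.
  have sp (z : int) : exists p q : nat, z = p%:Z - q%:Z.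
    by case: z => m; [exists m, 0; rewrite subr0 | exists 0, m.+1; rewrite sub0r].
  have [p [q ->]] := sp a; have [p' [q' ->]] := sp b.
  by rewrite addrACA -opprD -!PoszD !fE !exprD mulrACA.
exists (fun m => \prod_l f l (m 0 l)); split=> [|a b|l].
- by rewrite big1 // => l _; rewrite mxE.
- by rewrite -big_split; apply: eq_bigr => l _; rewrite mxE fD.
rewrite (bigD1 l) //= mxE !eqxx /= expr1 big1 ?mulr1 // => j /negPf ne.
by rewrite mxE ne andbF.
Qed.

Lemma lx_inj (K : fieldType) n : injective (@lx K n).
Proof.
have hE (a m : 'rV[int]_n) : lcoef m (lx K a) = (a == m)%:R :> K.
  by have := lcoefE m (1 : K) a; rewrite rmorph1 !mul1r.
move=> v w E; have := hE v v; rewrite E hE eqxx.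
by case: eqP => // _ /eqP; rewrite eq_sym oner_eq0.
Qed.

(* Comparing the coefficients of x^m y^m' in f(xy) = f(x) f(y) gives
   c_m [m = m'] = c_m c_m'. *)
Lemma grouplike_monomial (K : fieldType) n (z : lau K n)
    (D h1 h2 : {rmorphism lau K n -> lau K (n + n)}) :
  (forall c, D (lauC n c) = lauC (n + n) c) ->
  (forall m, D (lx K m) = lx K (m *m row_mx 1%:M 1%:M)) ->
  (forall c, h1 (lauC n c) = lauC (n + n) c) ->
  (forall m, h1 (lx K m) = lx K (m *m row_mx 1%:M 0)) ->
  (forall c, h2 (lauC n c) = lauC (n + n) c) ->
  (forall m, h2 (lx K m) = lx K (m *m row_mx 0 1%:M)) ->
  z != 0 -> D z = h1 z * h2 z -> exists m, z = lx K m.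
Proof.
move=> DC DX h1C h1X h2C h2X nz_z Dz.
have cD m m' : lcoef (row_mx m m') (D z) = lcoef m z * (m == m')%:R.
  have [s ->] := lau_expand z; rewrite rmorph_sum !lcoef_sum mulr_suml.
  apply: eq_bigr => a _; rewrite rmorphM DC DX !lcoefE -mulrA -natrM mulnb.
  congr (_ * (nat_of_bool _)%:R); rewrite mul_mx_row !mulmx1.
  apply/eqP/andP => [/eq_row_mx[-> ->]|[/eqP-> /eqP->]] //.
have c12 m m' : lcoef (row_mx m m') (h1 z * h2 z) = lcoef m z * lcoef m' z.
  have [s Es] := lau_expand z; rewrite {1 3}Es rmorph_sum mulr_suml !lcoef_sum mulr_suml.
  apply: eq_bigr => a _; rewrite rmorphM h1C h1X lcoefM lcoefE -!mulrA.
  congr (_ * _); rewrite mul_mx_row mulmx1 mulmx0.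
  have [t Et] := lau_expand z; rewrite Et rmorph_sum !lcoef_sum mulr_sumr.
  apply: eq_bigr => b _; rewrite rmorphM h2C h2X !lcoefE mulrCA; congr (_ * _).
  rewrite mul_mx_row mulmx1 mulmx0 -natrM mulnb; congr (nat_of_bool _)%:R.
  rewrite opp_row_mx add_row_mx oppr0 addr0.
  apply/eqP/andP => [/eq_row_mx[E ->]|[/eqP-> /eqP->]]; last by rewrite subrr.
  by split=> //; rewrite eq_sym -subr_eq0 -E.
have [m0 nz0] : exists m, lcoef m z != 0.
  apply: contrapT => /forallNP c0; case/eqP: nz_z; apply: lcoef_inj => m.
  by apply/eqP; apply: contra_notT (c0 m).
have cc m m' : lcoef m z * (m == m')%:R = lcoef m z * lcoef m' z.
  by rewrite -cD Dz c12.
have c0 m : lcoef m z = (m0 == m)%:R by apply: (mulfI nz0); rewrite -cc.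
exists m0; apply/eqP; rewrite -subr_eq0; apply/eqP/lcoef_inj => m.
have := lcoefE m (-1 : K) m0; rewrite rmorphN1 mulN1r lcoefD => ->.
by rewrite c0 mulN1r subrr.
Qed.

(** * The universal point of a split torus and its characters *)

Section UniversalPoint.
Variables (k K : fieldType) (i : {rmorphism k -> K}) (T : groupvar k).
Local Notation pt R := (points T (kres i R)).

Lemma character_kcomp (c : character T i) (R S : kalg K) (h : khom R S) (x : pt R) :
  c S (kcomp (kres_hom i h) x) = h (c R x).
Proof. by rewrite chi_nat. Qed.

Section Split.
Variables (n : nat) (c : 'I_n -> character T i).
Hypothesis cP : forall (R : kalg K) (u : 'I_n -> R),
  (forall l, exists v : R, u l * v = 1) ->
  exists! x : pt R, forall l, c l R x = u l.

Lemma split_eq (R : kalg K) (x y : pt R) : (forall l, c l R x = c l R y) -> x = y.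
Proof.
move=> xy; have [|z [zP zU]] := cP (R := R) (u := fun l => c l R y).
  by move=> l; apply: chi_unit.
by rewrite -(zU x xy) -(zU y (fun=> erefl)).
Qed.

(** Yoneda: a split torus is represented by K[Z^n]. The point [u] whose coordinates are the
    variables is universal, and no tensor product K (x) k[T] has to be formed. *)
Lemma universal_point_exists : exists u : pt (lau_alg K n),
  (forall l, c l (lau_alg K n) u = lx K (delta_mx 0 l)) /\
  forall (R : kalg K) (y : pt R), exists h : khom (lau_alg K n) R,
    kcomp (kres_hom i h) u = y.
Proof.
have [|u [uP _]] := cP (R := lau_alg K n) (u := fun l => lx K (delta_mx 0 l)).
  by move=> l; exists (lx K (- delta_mx 0 l)); apply: lx_unit.
exists u; split=> // R y.
have [w wP] := choice (fun l => chi_unit (c l) y).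
have [V [V0 VD Vd]] := units_monomial wP.
have [h [hC hX]] := lau_eval (kstr R) V0 VD.
exists (@KHom K (lau_alg K n) R h hC); apply: split_eq => l.
by rewrite character_kcomp uP /= hX Vd.
Qed.

Variable u : pt (lau_alg K n).
Hypothesis uX : forall l, c l (lau_alg K n) u = lx K (delta_mx 0 l).

(** The product of the two generic points over K[Z^(2n)] is the image of [u] under x |-> x y. So the
    value of a character at [u] is group-like, and [grouplike_monomial] applies. *)
Lemma character_monomial (ch : character T i) :
  exists m, ch (lau_alg K n) u = lx K m.
Proof.
pose mk (B : 'M[int]_(n, n + n)) := cid (lau_map (idfun : {rmorphism K -> K}) B).
pose H B : khom (lau_alg K n) (lau_alg K (n + n)) :=
  @KHom K (lau_alg K n) (lau_alg K (n + n)) (projT1 (mk B)) (projT2 (mk B)).1.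
have HC B a : H B (lauC n a) = lauC (n + n) a := (projT2 (mk B)).1 a.
have HX B m : H B (lx K m) = lx K (m *m B) := (projT2 (mk B)).2 m.
pose p B := kcomp (kres_hom i (H B)) u.
have mulE : p (row_mx 1%:M 1%:M) = gmul (p (row_mx 1%:M 0)) (p (row_mx 0 1%:M)).
  apply: split_eq => l; rewrite chiM !character_kcomp uX !HX -lxD -mulmxDr.
  by rewrite add_row_mx addr0 add0r.
have [v zv] := chi_unit ch u.
apply: (@grouplike_monomial _ _ _ (H (row_mx 1%:M 1%:M)) (H (row_mx 1%:M 0))
  (H (row_mx 0 1%:M))) => //.
  apply: contra_eq_neq zv => ->; rewrite mul0r eq_sym; exact: oner_neq0.
by rewrite -!(character_kcomp ch) -/(p _) mulE chiM.
Qed.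

End Split.

(** The splitting characters need not be the given basis of T^, and even the ranks n' and n are not
    known to agree. [VM] and [W] are the inverse changes of coordinates; the universal point is
    carried along them. *)
Lemma lattice_universal_point n (ev : 'rV[int]_n -> character T i) :
  is_torus i T ->
  (forall c : character T i, exists! v : 'rV[int]_n,
     forall (R : kalg K) (x : pt R), ev v R x = c R x) ->
  (forall v w (R : kalg K) (x : pt R), ev (v + w) R x = ev v R x * ev w R x) ->
  exists u : pt (lau_alg K n),
    (forall v, ev v (lau_alg K n) u = lx K v) /\
    forall (R : kalg K) (y : pt R), exists h : khom (lau_alg K n) R,
      kcomp (kres_hom i h) u = y.
Proof.
case=> n' [c cP] evU evD.
have [u' [u'X u'U]] := universal_point_exists cP.
have [V VP] := choice (fun v => character_monomial cP u'X (ev v)).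
have VD : {morph V : v w / v + w}.
  by move=> v w; apply: (@lx_inj K); rewrite lxD -!VP evD.
have [w wP] := choice (fun l => let: ex_intro v vP := evU (c l) in ex_intro _ v vP.1).
have Vw l : V (w l) = delta_mx 0 l.
  by apply: (@lx_inj K); rewrite -VP wP u'X.
pose VM : 'M[int]_(n, n') := \matrix_l V (delta_mx 0 l).
have VE v : V v = v *m VM.
  elim/row_int_ind: v => [|l|v v' Ev Ev'].
  - by rewrite mul0mx; apply: (addrI (V 0)); rewrite -VD !addr0.
  - by rewrite -rowE rowK.
  - by apply: (addIr (V v')); rewrite -VD subrK Ev Ev' mulmxBl subrK.
pose W : 'M[int]_(n', n) := \matrix_l w l.
have WV : W *m VM = 1%:M.
  by apply/row_matrixP=> l; rewrite row_mul rowK -VE Vw row1.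
have VW : VM *m W = 1%:M.
  apply/row_matrixP=> l; rewrite row_mul rowK row1; set v := delta_mx 0 l.
  have [v0 [_ v0U]] := evU (ev v).
  transitivity v0; last exact: v0U.
  apply/esym/v0U => R x; have [h <-] := u'U R x.
  by rewrite !character_kcomp !VP !VE -!mulmxA WV mulmx1.
have [f [fC fX]] := lau_map (idfun : {rmorphism K -> K}) W.
have [g [gC gX]] := lau_map (idfun : {rmorphism K -> K}) VM.
pose f' := @KHom K (lau_alg K n') (lau_alg K n) f fC.
pose g' := @KHom K (lau_alg K n) (lau_alg K n') g gC.
have fg : kcomp g' f' = kid _.
  apply: khom_eq; apply: (@lau_hom_eq _ _ _ (g \o f) idfun) => [a|l] /=.
    by rewrite fC gC.
  by rewrite fX gX -mulmxA WV mulmx1.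
exists (kcomp (kres_hom i f') u'); split=> [v|R y].
  by rewrite character_kcomp VP VE /= fX -mulmxA VW mulmx1.
have [h <-] := u'U R y; exists (kcomp h g'); apply: khom_eq => a /=.
by congr (h _); apply: (congr1 (fun t : khom (lau_alg K n') (lau_alg K n') => t (u' a)) fg).
Qed.

End UniversalPoint.

(** * Descent of the coordinate ring of a torus *)

Section IdealQuotient.

Definition ideal_pred (R : nzRingType) (S : {pred R}) (_ : idealr_closed S) : {pred R} := S.
HB.instance Definition _ (R : nzRingType) (S : {pred R}) (S_id : idealr_closed S) :=
  isIdealr.Build R (ideal_pred S_id) S_id.

Lemma quotient_exists (R : comNzRingType) (S : {pred R}) : idealr_closed S ->
  exists (Q : comNzRingType) (pi : {rmorphism R -> Q}), forall x, pi x = 0 <-> x \in S.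
Proof.
move=> S_id; pose I := ideal_pred S_id.
exists {ideal_quot I}, (\pi_{ideal_quot I})%qT => x.
rewrite -[x in x \in S]subr0 -[x - 0 \in S]/(x - 0 \in I) Quotient.idealrBE.
by rewrite -(rmorph0 (\pi_{ideal_quot I})%qT); split=> /eqP.
Qed.

End IdealQuotient.

(** * Injectivity of an algebra into its base change *)

Section BaseChange.
Variables (k K : fieldType) (i : {rmorphism k -> K}).
Hypothesis K_finite_union : forall s : seq K,
  exists (L : fieldExtType k) (e : {rmorphism L -> K}),
    (forall c : k, e c%:A = i c) /\ forall x, x \in s -> exists y, e y = x.

Variables (A : idomainType) (strA : {rmorphism k -> A}) (m : nat).
Variable f : {rmorphism {mpoly k[m]} -> A}.
Hypothesis fC : forall c, f c%:MP = strA c.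
Hypothesis f_surj : forall a, exists P, f P = a.

(** The ideal of K[X] generated by the kernel of [f]; the quotient by it is K (x) A. *)
Definition extended_kernel : {pred {mpoly K[m]}} := [pred P |
  `[< exists s : seq ({mpoly K[m]} * {mpoly k[m]}),
      (forall x, x \in s -> f x.2 = 0) /\
      P = \sum_(x <- s) x.1 * map_mpoly i x.2 >]].

Lemma extended_kernelP P : reflect (exists s : seq ({mpoly K[m]} * {mpoly k[m]}),
      (forall x, x \in s -> f x.2 = 0) /\
      P = \sum_(x <- s) x.1 * map_mpoly i x.2) (P \in extended_kernel).
Proof. exact: asboolP. Qed.

(* A k-linear retraction of k -> L, for L finite over k and large enough, turns
   an expression over K into one over k. *)
Lemma extended_kernel_descent (P : {mpoly k[m]}) :
  map_mpoly i P \in extended_kernel -> f P = 0.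
Proof.
case/extended_kernelP=> s [s0 Es].
have [L [e [eC eS]]] := K_finite_union (flatten [seq [seq x.1@_q | q <- msupp x.1] | x <- s]).
have [g gE] : exists g : {mpoly K[m]} * {mpoly k[m]} -> {mpoly L[m]},
    forall x, x \in s -> map_mpoly e (g x) = x.1.
  suff /choice[g gP] : forall x, exists y, x \in s -> map_mpoly e y = x.1 by exists g.
  move=> x; have [sx|] := boolP (x \in s); last by exists 0.
  have exc q : exists c, e c = x.1@_q.
    have [q_x|] := boolP (q \in msupp x.1); last first.
      by rewrite -mcoeff_eq0 => /eqP->; exists 0; rewrite rmorph0.
    apply: eS; apply/flattenP; exists [seq x.1@_q | q <- msupp x.1]; exact: map_f.
  have [c cE] := choice exc; exists (\sum_(q <- msupp x.1) c q *: 'X_[q]) => _.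
  rewrite rmorph_sum [RHS]mpolyE; apply: eq_bigr => q _.
  by rewrite /= map_mpolyZ map_mpolyX cE.
have eE (Q : {mpoly k[m]}) : map_mpoly e (map_mpoly (in_alg L) Q) = map_mpoly i Q.
  by apply/mpolyP=> q; rewrite !mcoeff_map_mpoly /= ?eC.
have {}Es : map_mpoly (in_alg L) P = \sum_(x <- s) g x * map_mpoly (in_alg L) x.2.
  have eI : injective (map_mpoly e : {mpoly L[m]} -> {mpoly K[m]}).
    move=> Q Q' E; apply/mpolyP=> q; apply: (fmorph_inj e).
    by have := congr1 (mcoeff q) E; rewrite !mcoeff_map_mpoly.
  apply: eI; rewrite eE Es rmorph_sum big_seq [RHS]big_seq; apply: eq_bigr => x sx.
  by rewrite rmorphM /= eE gE.
have [tau [tauD tauZ tau1]] : exists tau : L -> k, [/\ {morph tau : x y / x + y},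
    forall c x, tau (c *: x) = c * tau x & tau 1 = 1].
  have [j nz_j] : exists j, vector.coord (vbasis {:L}) j (1 : L) != 0.
    apply: contrapT => /forallNP c0; have /eqP := oner_neq0 L; case.
    rewrite (coord_vbasis (memvf 1)) big1 // => j _.
    by have /negP/negPn/eqP-> := c0 j; rewrite scale0r.
  exists (fun x => (vector.coord (vbasis {:L}) j 1)^-1 * vector.coord (vbasis {:L}) j x).
  split=> [x y|c x|]; first by rewrite linearD mulrDr.
    by rewrite linearZ mulrCA.
  by rewrite mulVf.
have tauB : zmod_morphism tau.
  by move=> x y; rewrite tauD -scaleN1r tauZ mulN1r.
pose t : {additive L -> A} := HB.pack (fun x => strA (tau x))
  (GRing.isZmodMorphism.Build L A (fun x => strA (tau x))
    (fun x y => etrans (congr1 strA (tauB x y)) (rmorphB strA _ _))).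
(* [Th] applies [tau] to the coefficients and [f] to the monomials. By [ThM] it is linear over k[X],
   so it kills everything generated by the kernel of [f]. *)
pose Th : {additive {mpoly L[m]} -> A} := mmap t (fun l => f 'X_l).
have ThX c q : Th (c *: 'X_[q]) = strA (tau c) * f 'X_[q].
  have [->|nz_c] := eqVneq c 0.
    by rewrite scale0r raddf0 -[tau 0]/(tau 0) -(scale0r 1) tauZ mul0r rmorph0 mul0r.
  rewrite /Th /= /mmap msuppMCX // big_seq1 mcoeffZ mcoeffX eqxx mulr1.
  congr (_ * _); rewrite mpolyXE_id rmorph_prod; apply: eq_bigr => l _.
  by rewrite rmorphXn.
have ThM Q (R : {mpoly k[m]}) : Th (Q * map_mpoly (in_alg L) R) = Th Q * f R.
  have expand (F : fieldType) (S : {mpoly F[m]}) :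
      exists t : seq (F * 'X_{1..m}), S = \sum_(x <- t) x.1 *: 'X_[x.2].
    by exists [seq (S@_r, r) | r <- msupp S]; rewrite big_map -mpolyE.
  have [tQ ->] := expand _ Q; have [tR ->] := expand _ R.
  rewrite mulr_suml !raddf_sum mulr_suml; apply: eq_bigr => x _.
  rewrite !mulr_sumr raddf_sum; apply: eq_bigr => y _ /=.
  rewrite map_mpolyZ map_mpolyX -scalerAl -scalerAr scalerA -mpolyXD !ThX mpolyXD.
  rewrite -mul_mpolyC !rmorphM fC mulr_algr tauZ rmorphM /=; ring.
have : Th (map_mpoly (in_alg L) P) = f P.
  have := ThM 1 P; rewrite mul1r => ->.
  have := ThX 1 0%MM; rewrite scale1r mpolyX0 tau1 !rmorph1 mul1r => ->.
  by rewrite mpolyX0 rmorph1 mul1r.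
rewrite Es raddf_sum big_seq big1 // => x sx.
by rewrite ThM s0 // mulr0.
Qed.

(** The quotient of K[X] by [extended_kernel] contains A, by [extended_kernel_descent], which also
    shows that it is not the zero ring. *)
Lemma base_change_embedding : exists (R : kalg K) (y : {rmorphism A -> R}),
  (forall c, y (strA c) = kstr R (i c)) /\ injective y.
Proof.
have id_cl : idealr_closed extended_kernel.
  split=> [||a P Q /extended_kernelP[s [s0 ->]] /extended_kernelP[t [t0 ->]]].
  - by apply/extended_kernelP; exists [::]; rewrite big_nil.
  - apply/negP; rewrite -(rmorph1 (map_mpoly i)) => /extended_kernel_descent.
    by rewrite rmorph1 => /eqP; rewrite oner_eq0.
  apply/extended_kernelP; exists ([seq (a * x.1, x.2) | x <- s] ++ t).
  split=> [x|]; last first.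
    rewrite big_cat big_map mulr_sumr; congr (_ + _); apply: eq_bigr => x _.
    by rewrite mulrA.
  by rewrite mem_cat => /orP[/mapP[x' /s0 + ->]|/t0].
have [Q [pi piP]] := quotient_exists id_cl.
have [l lP] := choice f_surj.
pose y a := pi (map_mpoly i (l a)).
have yE P : y (f P) = pi (map_mpoly i P).
  apply/eqP; rewrite -subr_eq0 -!rmorphB; apply/eqP/piP.
  apply/extended_kernelP; exists [:: (1, l (f P) - P)].
  split=> [x|]; last by rewrite big_seq1 mul1r.
  by rewrite inE => /eqP->; rewrite rmorphB lP subrr.
have [y' y'E] : exists y' : {rmorphism A -> Q}, y' =1 y.
  apply: rmorphism_of_fun => [a b|a b|].
  - by rewrite -(lP a) -(lP b) -rmorphB !yE !rmorphB.
  - by rewrite -(lP a) -(lP b) -rmorphM !yE !rmorphM.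
  - by rewrite -(rmorph1 f) yE !rmorph1.
pose strQ : {rmorphism K -> Q} := pi \o @mpolyC m K.
exists (KAlg strQ), y'; split=> [c|].
  by rewrite y'E -fC yE map_mpolyC.
apply: raddf_inj => a; rewrite /= y'E => /piP/extended_kernel_descent.
by rewrite lP.
Qed.

End BaseChange.

(** * Galois descent: traces and Speiser's theorem *)

Section GaloisCoordinates.
Variables (E : fieldType) (G : finGroupType) (al : G -> {rmorphism E -> E}).
Hypothesis al1 : forall x, al 1%g x = x.
Hypothesis alM : forall g h x, al (g * h)%g x = al h (al g x).
Hypothesis al_faithful : forall g, g != 1%g -> exists x, al g x != x.

(* E (x) E maps to the product of copies of E indexed by G; an element with
   given components is a product of elements vanishing at one factor each. *)
Lemma galois_coordinates : exists s : seq (E * E),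
  forall g, \sum_(x <- s) x.1 * al g x.2 = (g == 1%g)%:R.
Proof.
suff [s [s1 s0]] : exists s : seq (E * E), \sum_(x <- s) x.1 * x.2 = 1 /\
    forall h, h \in [seq h <- enum G | h != 1%g] -> \sum_(x <- s) x.1 * al h x.2 = 0.
  exists s => g; have [->|ne] := eqVneq g 1%g.
    by rewrite -[RHS]s1; apply: eq_bigr => x _; rewrite al1.
  by apply: s0; rewrite mem_filter ne mem_enum.
have : 1%g \notin [seq h <- enum G | h != 1%g] by rewrite mem_filter eqxx.
elim: [seq h <- enum G | h != 1%g] => [|h l IHl].
  by move=> _; exists [:: (1, 1)]; split=> //; rewrite big_seq1 mul1r.
rewrite inE negb_or eq_sym => /andP[ne_h /IHl[s [s1 s0]]].
have [|a ne_a] := al_faithful (g := h^-1%g); first by rewrite invg_eq1.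
pose b := al h^-1%g a; have nz : a - b != 0 by rewrite subr_eq0 eq_sym.
(* This element has component (a - g(b)) / (a - b) at g: it is 1 at the identity and 0 at h, because
   h(b) = a. *)
pose t := [:: (a / (a - b), 1); (- (a - b)^-1, b)].
have tE g : \sum_(y <- t) y.1 * al g y.2 = (a - al g b) / (a - b).
  by rewrite big_cons big_seq1 /= rmorph1 mulr1 mulNr mulrBl [al g b * _]mulrC.
exists [seq (x.1 * y.1, x.2 * y.2) | x <- s, y <- t].
have prodE g : \sum_(x <- [seq (x.1 * y.1, x.2 * y.2) | x <- s, y <- t]) x.1 * al g x.2
    = (\sum_(x <- s) x.1 * al g x.2) * ((a - al g b) / (a - b)).
  rewrite big_allpairs_dep -tE mulr_suml; apply: eq_bigr => x _; rewrite mulr_sumr.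
  by apply: eq_bigr => y _ /=; rewrite rmorphM mulrACA.
split=> [|g].
  have := prodE 1%g; under eq_bigr => x _ do rewrite al1.
  move=> ->; under eq_bigr => x _ do rewrite al1.
  by rewrite s1 al1 mul1r divff.
rewrite prodE inE => /orP[/eqP->|/s0->]; last by rewrite mul0r.
by rewrite /b -alM mulVg al1 subrr mul0r mulr0.
Qed.

Definition al_trace x := \sum_g al g x.

Lemma al_trace_fix h x : al h (al_trace x) = al_trace x.
Proof.
rewrite rmorph_sum [RHS](reindex_inj (mulIg h)) /=.
by apply: eq_bigr => g _; rewrite alM.
Qed.

(** If every trace were zero, summing over g the identities of [galois_coordinates] would give 0 =
    1. A non-zero trace is invariant and can be divided out. *)
Lemma al_trace1 : exists c, al_trace c = 1.
Proof.
have [s sE] := galois_coordinates.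
have [y /eqP nz_y] : exists y, al_trace y <> 0.
  apply: contrapT => /forallNP tr0; have /eqP := oner_neq0 E; apply.
  have : \sum_(x <- s) x.1 * al_trace x.2 = 0.
    by rewrite big1 // => x _; have /contrapT-> := tr0 x.2; rewrite mulr0.
  under eq_bigr => x _ do rewrite mulr_sumr.
  rewrite exchange_big /=; under eq_bigr => g _ do rewrite sE.
  by rewrite (bigD1 1%g) //= eqxx big1 ?addr0 // => g /negPf->.
exists ((al_trace y)^-1 * y); rewrite -[RHS](mulVf nz_y) [in RHS]/al_trace mulr_sumr.
by apply: eq_bigr => g _; rewrite rmorphM fmorphV al_trace_fix.
Qed.

(** Triviality of H^1(G, GL_N(E)). Averaging by [p] produces vectors fixed by the twisted action; by
    [galois_coordinates] each v is a combination of averages of its multiples, so the averages span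
    E^N, and N independent ones are the columns of B. *)
Lemma speiser N (A : G -> 'M[E]_N) : A 1%g = 1%:M ->
  (forall g h, A (g * h)%g = map_mx (al h) (A g) *m A h) ->
  exists2 B : 'M[E]_N, B \in unitmx & forall g, map_mx (al g) B = A g *m B.
Proof.
move=> A1 AM; have [s sE] := galois_coordinates.
pose p (v : 'cV[E]_N) : 'cV[E]_N := \sum_g map_mx (al g) (A g^-1%g *m v).
have mapM g h m q (X : 'M[E]_(m, q)) :
    map_mx (al (g * h)%g) X = map_mx (al h) (map_mx (al g) X).
  by apply/matrixP=> a b; rewrite !mxE alM.
have map1 m q (X : 'M[E]_(m, q)) : map_mx (al 1%g) X = X.
  by apply/matrixP=> a b; rewrite !mxE al1.
have AAV h : A h *m map_mx (al h) (A h^-1%g) = 1%:M.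
  by apply: mulmx1C; rewrite -AM mulVg.
have pfix h v : map_mx (al h) (p v) = A h *m p v.
  rewrite raddf_sum mulmx_sumr [RHS](reindex_inj (mulIg h)) /=.
  apply: eq_bigr => g _; rewrite -mapM invMg AM -mulmxA [in RHS]map_mxM -mapM.
  by rewrite mulgA mulVg mul1g mulmxA AAV mul1mx.
pose I := ('I_(size s) * 'I_N)%type.
pose xs (a : 'I_(size s)) := nth (0, 0) s a.
pose W := \matrix_(i < N, t < #|{: I}|)
  p ((xs (enum_val t).1).2 *: delta_mx (enum_val t).2 0) i 0.
pose C := \matrix_(t < #|{: I}|, j < N)
  ((xs (enum_val t).1).1 * ((enum_val t).2 == j)%:R).
have span v : \sum_(x <- s) x.1 *: p (x.2 *: v) = v.
  under eq_bigr do rewrite scaler_sumr.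
  rewrite exchange_big /= (bigD1 1%g) //= [X in _ + X]big1 ?addr0 => [|g ne_g].
    under eq_bigr do rewrite invg1 A1 mul1mx map1 scalerA.
    rewrite -scaler_suml (eq_bigr (fun x => x.1 * al 1%g x.2)); last by move=> x _; rewrite al1.
    by rewrite sE eqxx scale1r.
  under eq_bigr do rewrite -scalemxAr map_mxZ scalerA.
  by rewrite -scaler_suml sE (negPf ne_g) scale0r.
have WC : W *m C = 1%:M.
  apply/matrixP=> i j; have /colP/(_ i) := span (delta_mx j 0).
  rewrite [RHS]mxE andbT => Eij; rewrite [RHS]mxE -Eij [LHS]mxE.
  rewrite (reindex (@enum_rank I)) /=; last first.
    exact/onW_bij/enum_rank_bij.
  rewrite (eq_bigr (fun t => W i (enum_rank (t.1, t.2)) * C (enum_rank (t.1, t.2)) j));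
    last by case.
  rewrite -(pair_bigA _ (fun a b => W i (enum_rank (a, b)) * C (enum_rank (a, b)) j)) /=.
  rewrite (big_nth (0, 0)) big_mkord summxE; apply: eq_bigr => a _.
  rewrite (bigD1 j) //= !mxE enum_rankK /= eqxx mulr1 big1 ?addr0 => [|b /negPf ne].
    by rewrite mulrC.
  by rewrite [C _ _]mxE enum_rankK /= ne !mulr0.
have rfW : row_full W^T.
  by apply/row_fullP; exists C^T; rewrite -trmx_mul WC trmx1.
pose f := fullrankfun rfW; pose B := (rowsub f W^T)^T.
have colB a : exists v, col a B = p v.
  exists ((xs (enum_val (f a)).1).2 *: delta_mx (enum_val (f a)).2 0).
  by apply/colP=> i; rewrite !mxE.
exists B; first by rewrite unitmx_tr fullrowsub_unit.
move=> g; apply: eq_col => a; rewrite colMx -map_col.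
by have [v ->] := colB a; rewrite pfix.
Qed.

End GaloisCoordinates.

Section GaloisRmorphism.
Variables (k : fieldType) (L : splittingFieldType k).
Local Notation G := (gal_of {:L}%AS).

Definition galr (g : G) : {rmorphism L -> L} := g.

Lemma galr1 x : galr 1%g x = x. Proof. exact: gal_id. Qed.

Lemma galrM g h x : galr (g * h)%g x = galr h (galr g x).
Proof. by apply: galM; apply: memvf. Qed.

Lemma galr_faithful g : g != 1%g -> exists x, galr g x != x.
Proof.
move=> ne; apply: contrapT => /forallNP fix_g; case/eqP: ne; apply/eqP/gal_eqP => x _.
by rewrite gal_id; have /negP/negPn/eqP := fix_g x.
Qed.

Lemma galr_alg g (c : k) : galr g c%:A = c%:A.
Proof. by change (g c%:A = c%:A); rewrite linearZ /= rmorph1. Qed.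

Lemma galr_fixed (x : L) : galois 1%AS {:L}%AS -> (forall g, galr g x = x) ->
  exists c : k, x = c%:A.
Proof.
move=> /galois_fixedField fixE xfix; apply/vlineP.
rewrite -[<[_]>%VS]/(1%VS : {vspace L}) -[1%VS]/(1%AS : {vspace L}) -fixE.
by apply/fixedFieldP => [|g _]; [apply: memvf | apply: xfix].
Qed.

End GaloisRmorphism.

Section LaurentAction.
Variables (k : fieldType) (L : splittingFieldType k) (n : nat).
Local Notation G := (gal_of {:L}%AS).
Variable N : lattice G n.
Local Notation lau := (lau L n).

Definition lact (g : G) : {rmorphism lau -> lau} := projT1 (cid (lau_map (galr g) (N g))).

Lemma lactC g c : lact g (lauC n c) = lauC n (galr g c).
Proof. exact: (projT2 (cid (lau_map (galr g) (N g)))).1. Qed.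

Lemma lactX g m : lact g (lx L m) = lx L (m *m N g).
Proof. exact: (projT2 (cid (lau_map (galr g) (N g)))).2. Qed.

Lemma lact1 z : lact 1%g z = z.
Proof.
apply: (lau_hom_eq (f := lact 1%g) (g := idfun)) => [c|l].
  by rewrite lactC galr1.
by rewrite lactX act1 mulmx1.
Qed.

Lemma lactM g h z : lact (g * h)%g z = lact h (lact g z).
Proof.
apply: (lau_hom_eq (f := lact (g * h)%g) (g := lact h \o lact g)) => [c|l] /=.
  by rewrite !lactC galrM.
by rewrite !lactX actM mulmxA.
Qed.

Definition ltrace z := \sum_g lact g z.

Lemma ltrace_fix h z : lact h (ltrace z) = ltrace z.
Proof.
rewrite rmorph_sum [RHS](reindex_inj (mulIg h)) /=.
by apply: eq_bigr => g _; rewrite lactM.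
Qed.

Lemma ltraceC c : ltrace (lauC n c) = lauC n (al_trace (@galr k L) c).
Proof. by rewrite rmorph_sum; apply: eq_bigr => g _; rewrite lactC. Qed.

Lemma ltrace_mul c z : (forall g, lact g z = z) ->
  ltrace (lauC n c * z) = lauC n (al_trace (@galr k L) c) * z.
Proof.
move=> zfix; rewrite -ltraceC mulr_suml; apply: eq_bigr => g _.
by rewrite rmorphM zfix.
Qed.

(** Dual bases for the trace: the elements of L[N], and those of L, are recovered with coefficients
    in L from invariants. *)
Lemma galois_coords : exists s : seq (L * L),
  (forall z, z = \sum_(x <- s) lauC n x.1 * ltrace (lauC n x.2 * z)) /\
  forall c, c = \sum_(x <- s) x.1 * al_trace (@galr k L) (x.2 * c).
Proof.
have [s sE] := galois_coordinates (@galr1 k L) (@galrM k L) (@galr_faithful k L).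
exists s; split=> [z|c].
  under eq_bigr do rewrite mulr_sumr.
  rewrite exchange_big /= (bigD1 1%g) //= [X in _ + X]big1 ?addr0 => [|g ne].
    under eq_bigr do rewrite rmorphM lactC mulrA -rmorphM.
    by rewrite -mulr_suml -rmorph_sum sE eqxx rmorph1 mul1r lact1.
  under eq_bigr do rewrite rmorphM lactC mulrA -rmorphM.
  by rewrite -mulr_suml -rmorph_sum sE (negPf ne) rmorph0 mul0r.
under eq_bigr do rewrite mulr_sumr.
rewrite exchange_big /= (bigD1 1%g) //= [X in _ + X]big1 ?addr0 => [|g ne].
  under eq_bigr do rewrite rmorphM mulrA.
  by rewrite -mulr_suml sE eqxx galr1 mul1r.
under eq_bigr do rewrite rmorphM mulrA.
by rewrite -mulr_suml sE (negPf ne) mul0r.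
Qed.

End LaurentAction.

(** * The invariant ring as a form of L[N] *)

Section Model.
Variables (k : fieldType) (L : splittingFieldType k) (n : nat).
Local Notation G := (gal_of {:L}%AS).
Variable N : lattice G n.
Hypothesis galL : galois 1%AS {:L}%AS.
Variables (A : idomainType) (strA : {rmorphism k -> A}) (u : {rmorphism A -> lau L n}).

(* A is the coordinate ring of the k-torus split by L with character lattice N,
   namely the ring of G-invariants of the group algebra L[N]. *)
Definition torus_model : Prop :=
  [/\ forall c : k, u (strA c) = lauC n c%:A, injective u
    & forall z, (forall g, lact N g z = z) <-> exists a, u a = z].

Hypothesis model : torus_model.
Let uC : forall c : k, u (strA c) = lauC n c%:A. Proof. by case: model. Qed.
Let uI : injective u. Proof. by case: model. Qed.
Let uP : forall z, (forall g, lact N g z = z) <-> exists a, u a = z.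
Proof. by case: model. Qed.

Lemma lact_model g a : lact N g (u a) = u a.
Proof. by have /(_ g) := (uP (u a)).2 (ex_intro _ a erefl). Qed.

Lemma model_span z : exists s : seq (L * A), z = \sum_(x <- s) lauC n x.1 * u x.2.
Proof.
have [s [sE _]] := galois_coords N.
have [f fE] := choice (fun w => (uP (ltrace N w)).1 (fun h => ltrace_fix N h w)).
exists [seq (x.1, f (lauC n x.2 * z)) | x <- s]; rewrite big_map {1}[z]sE.
by apply: eq_bigr => x _ /=; rewrite fE.
Qed.

Lemma trace_base c : exists c0 : k, al_trace (@galr k L) c = c0%:A.
Proof.
apply: galr_fixed => // g; exact: (al_trace_fix (@galrM k L)).
Qed.

(** This is the injectivity of L (x) A -> L[N]. The traces of the multiples b z of a relation z are
    relations over k, which hold in A itself; [galois_coords] recombines them. *)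
Lemma model_relation (R : kalg L) (y : {rmorphism A -> R}) (s : seq (L * A)) :
  (forall c, y (strA c) = kstr R c%:A) ->
  \sum_(x <- s) lauC n x.1 * u x.2 = 0 -> \sum_(x <- s) kstr R x.1 * y x.2 = 0.
Proof.
move=> yC s0; have [t [_ tE]] := galois_coords N.
have [tr trE] := choice trace_base.
have E b : \sum_(x <- s) strA (tr (b * x.1)) * x.2 = 0.
  apply: uI; rewrite rmorph0 rmorph_sum /=.
  transitivity (ltrace N (lauC n b * \sum_(x <- s) lauC n x.1 * u x.2)); last first.
    by rewrite s0 mulr0 /ltrace big1 // => g _; rewrite rmorph0.
  rewrite mulr_sumr /ltrace; under [RHS]eq_bigr do rewrite rmorph_sum.
  rewrite exchange_big; apply: eq_bigr => x _ /=.
  rewrite rmorphM uC -trE -(ltrace_mul (N := N)); last by move=> g; apply: lact_model.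
  by apply: eq_bigr => g _; rewrite (rmorphM (@lauC L n)) mulrA.
transitivity (\sum_(b <- t) kstr R b.1 * y (\sum_(x <- s) strA (tr (b.2 * x.1)) * x.2)).
  under [RHS]eq_bigr do rewrite rmorph_sum mulr_sumr.
  rewrite exchange_big; apply: eq_bigr => x _ /=.
  rewrite {1}(tE x.1) rmorph_sum mulr_suml; apply: eq_bigr => b _.
  by rewrite !rmorphM /= yC -trE mulrA.
by rewrite big1 // => b _; rewrite E rmorph0 mulr0.
Qed.

(** L[N] is L (x) A: it is spanned by the products of elements of L and A, and [model_relation]
    makes the extension of [y] well defined. *)
Lemma model_universal (R : kalg L) (y : {rmorphism A -> R}) :
  (forall c, y (strA c) = kstr R c%:A) ->
  exists h : khom (lau_alg L n) R, forall a, h (u a) = y a.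
Proof.
move=> yC; have [r rE] := choice model_span.
pose ev (s : seq (L * A)) := \sum_(x <- s) kstr R x.1 * y x.2.
have evE s t : \sum_(x <- s) lauC n x.1 * u x.2 = \sum_(x <- t) lauC n x.1 * u x.2 ->
    ev s = ev t.
  move=> st; apply/eqP; rewrite -subr_eq0.
  have := @model_relation R y (s ++ [seq (- x.1, x.2) | x <- t]) yC.
  rewrite !big_cat !big_map /=.
  have oppE (S : pzRingType) (f : {rmorphism L -> S}) (g : A -> S) :
      \sum_(x <- t) f (- x.1) * g x.2 = - \sum_(x <- t) f x.1 * g x.2.
    by rewrite -sumrN; apply: eq_bigr => x _; rewrite rmorphN mulNr.
  by rewrite !oppE st subrr => /(_ erefl) E; apply/eqP.
pose h z := ev (r z).
have hE s : h (\sum_(x <- s) lauC n x.1 * u x.2) = ev s.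
  by apply: evE; rewrite -rE.
have hCu c a : h (lauC n c * u a) = kstr R c * y a.
  by rewrite -[X in h X](big_seq1 +%R (c, a) (fun x => lauC n x.1 * u x.2)) hE /ev big_seq1.
have [h' h'E] : exists h' : {rmorphism lau L n -> R}, h' =1 h.
  apply: rmorphism_of_fun => [z w|z w|].
  - rewrite [z in LHS]rE [w in LHS]rE -sumrN.
    rewrite [X in h (_ + X)](eq_bigr (fun x => lauC n (- x.1) * u x.2)); last first.
      by move=> x _; rewrite rmorphN mulNr.
    rewrite -(big_map (fun x => (- x.1, x.2)) predT (fun x => lauC n x.1 * u x.2)).
    rewrite -big_cat hE /ev big_cat big_map; congr (_ + _).
    by rewrite -sumrN; apply: eq_bigr => x _; rewrite rmorphN mulNr.
  - have -> : z * w = \sum_(x <- [seq (x.1 * y.1, x.2 * y.2) | x <- r z, y <- r w])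
        lauC n x.1 * u x.2.
      rewrite big_allpairs_dep {1}(rE z) {1}(rE w) mulr_suml.
      apply: eq_bigr => x _; rewrite mulr_sumr; apply: eq_bigr => x' _.
      by rewrite /= !rmorphM mulrACA.
    rewrite hE /ev big_allpairs_dep mulr_suml; apply: eq_bigr => x _.
    by rewrite mulr_sumr; apply: eq_bigr => x' _; rewrite /= !rmorphM mulrACA.
  - by have := hCu 1 1; rewrite !rmorph1 !mulr1.
have h'C c : h' (kstr (lau_alg L n) c) = kstr R c.
  by have := hCu c 1; rewrite !rmorph1 !mulr1 h'E.
exists (@KHom L (lau_alg L n) R h' h'C) => a.
by have := hCu 1 a; rewrite !rmorph1 !mul1r -h'E.
Qed.

Lemma model_hom_eq (R : comPzRingType) (f h : {rmorphism lau L n -> R}) :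
  (forall c, f (lauC n c) = h (lauC n c)) -> (forall a, f (u a) = h (u a)) -> f =1 h.
Proof.
move=> fhC fhu z; have [s ->] := model_span z; rewrite !rmorph_sum.
by apply: eq_bigr => x _; rewrite !rmorphM fhC fhu.
Qed.

End Model.

Section Span.
Variables (K : fieldType) (n : nat) (A : comNzRingType) (u : {rmorphism A -> lau K n}).

Definition lau_span : {pred lau K n} := [pred z |
  `[< exists s : seq (K * A), z = \sum_(x <- s) lauC n x.1 * u x.2 >]].

Lemma lau_spanP z : reflect (exists s : seq (K * A), z = \sum_(x <- s) lauC n x.1 * u x.2)
  (z \in lau_span).
Proof. exact: asboolP. Qed.

Lemma lau_span_closed : subring_closed lau_span.
Proof.
split=> [|_ _ /lau_spanP[s ->] /lau_spanP[t ->]|_ _ /lau_spanP[s ->] /lau_spanP[t ->]];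
  apply/lau_spanP.
- by exists [:: (1, 1)]; rewrite big_seq1 !rmorph1 mulr1.
- exists (s ++ [seq (- x.1, x.2) | x <- t]); rewrite big_cat big_map /= -sumrN.
  by congr (_ + _); apply: eq_bigr => x _; rewrite rmorphN mulNr.
exists [seq (x.1 * y.1, x.2 * y.2) | x <- s, y <- t].
rewrite big_allpairs_dep mulr_suml; apply: eq_bigr => x _; rewrite mulr_sumr.
by apply: eq_bigr => y _; rewrite /= !rmorphM mulrACA.
Qed.

Lemma lau_spanC c : lauC n c \in lau_span.
Proof. by apply/lau_spanP; exists [:: (c, 1)]; rewrite big_seq1 rmorph1 mulr1. Qed.

Lemma lau_span_mem a : u a \in lau_span.
Proof. by apply/lau_spanP; exists [:: (1, a)]; rewrite big_seq1 rmorph1 mul1r. Qed.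

Lemma lau_span_full :
  (forall l, lx K (delta_mx 0 l) \in lau_span) ->
  (forall l, lx K (- delta_mx 0 l) \in lau_span) -> forall z, z \in lau_span.
Proof.
have [s1 sB sM] := lau_span_closed => sX sXN z.
have sx m : lx K m \in lau_span /\ lx K (- m) \in lau_span.
  elim/row_int_ind: m => [|l|v w [vin vin'] [win win']].
  - by rewrite oppr0 lx0.
  - by split.
  - by rewrite opprB !lxD; split; apply: sM.
have [s ->] := lau_expand z.
have s0 : 0 \in lau_span by rewrite -(subrr 1); apply: sB.
have sD x y : x \in lau_span -> y \in lau_span -> x + y \in lau_span.
  by move=> sx' sy; rewrite -[y]opprK; apply: (sB) => //; rewrite -[- y]sub0r; apply: sB.
apply: (big_ind (fun y => y \in lau_span)) => // x _; apply: sM; first exact: lau_spanC.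
by case: (sx x.2).
Qed.

End Span.

(** * The coordinate ring of T from its functor of points *)

Section TorusModel.
Variables (k ks : fieldType) (i : {rmorphism k -> ks}).
Hypothesis ks_closure : is_sep_closure i.
Variables (T : groupvar k) (n : nat) (That : gal_lattice i n).
Variable ev : 'rV[int]_n -> character T i.
Hypothesis evA : forall (s : kaut i) v (R : kalg ks) (x : points T (kres i R)),
  ev (v *m That s) R x = ev v (kres s R) (twist s x).
Variable u : points T (kres i (lau_alg ks n)).
Hypothesis evu : forall v, ev v (lau_alg ks n) u = lx ks v.
Hypothesis uU : forall (R : kalg ks) (y : points T (kres i R)),
  exists h : khom (lau_alg ks n) R, kcomp (kres_hom i h) u = y.

Local Notation A := (Defs.coord T).
Let ur : {rmorphism A -> lau ks n} := kfun u.

(** The twisted universal point factors through the universal one. The factoring map is s-semilinear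
    because its target carries the structure map twisted by s. *)
Lemma twist_map (s : kaut i) : exists h : {rmorphism lau ks n -> lau ks n},
  [/\ forall c, h (lauC n c) = lauC n (s c), forall v, h (lx ks v) = lx ks (v *m That s)
    & forall a, h (u a) = u a].
Proof.
have [h hE] := uU (twist s u).
exists (kfun h : {rmorphism lau ks n -> lau ks n}); split=> [c|v|a].
- exact: (khomP h).
- have := character_kcomp (ev v) h u; rewrite hE -evA !evu.
  by move/esym.
- exact: (congr1 (fun t : points T (kres i (kres s (lau_alg ks n))) => t a) hE).
Qed.

(** [u] already takes values in the subring R spanned by [ks] and the image of k[T], so it comes
    from a point [y] over R. The characters of [y] lie in R, and their images are the monomials. *)
Lemma ks_span z : z \in lau_span ur.
Proof.
pose SR := subring (lau_span_closed ur).
pose sC c : SR := Subring (lau_spanC ur c).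
have [sC' sC'E] : exists f : {rmorphism ks -> SR}, f =1 sC.
  by apply: rmorphism_of_fun => [a b|a b|]; apply: val_inj;
    rewrite /= ?rmorphB ?rmorphM ?rmorph1.
pose su a : SR := Subring (lau_span_mem ur a).
have [su' su'E] : exists f : {rmorphism A -> SR}, f =1 su.
  by apply: rmorphism_of_fun => [a b|a b|]; apply: val_inj;
    rewrite /= ?rmorphB ?rmorphM ?rmorph1.
pose R : kalg ks := KAlg sC'.
have su'C c : (su' : {rmorphism coord_alg T -> kres i R}) (kstr (coord_alg T) c)
    = kstr (kres i R) c.
  by rewrite su'E; apply: val_inj; rewrite /= sC'E /=; apply: (khomP u).
pose y : points T (kres i R) := KHom su'C.
pose inc : {rmorphism R -> lau_alg ks n} := (@subring_val _ _ (lau_span_closed ur)).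
have incC c : inc (kstr R c) = kstr (lau_alg ks n) c by rewrite /= sC'E.
pose inc' : khom R (lau_alg ks n) := KHom incC.
have incy : kcomp (kres_hom i inc') y = u.
  by apply: khom_eq => a; rewrite /= su'E.
have [h hE] := uU y.
have xin v : lx ks v \in lau_span ur.
  rewrite -evu -incy -hE character_kcomp character_kcomp.
  by case: (h _).
by apply: lau_span_full.
Qed.

(** The embedding of k[T] into its base change is a point of T, hence factors through [u]. *)
Lemma universal_point_inj : injective ur.
Proof.
have [m [f f_surj]] := affvar_ft T.
have fin (s : seq ks) : exists (L : fieldExtType k) (e : {rmorphism L -> ks}),
    (forall c : k, e c%:A = i c) /\ forall x, x \in s -> exists y, e y = x.
  by have [L [e [_ eC es]]] := finite_galois_cover ks_closure s; exists L, e.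
have [R [y [yC yI]]] := base_change_embedding fin (khomP f) f_surj.
have [h hE] := uU (@KHom k (coord_alg T) (kres i R) y yC).
move=> a b uab; apply: yI.
have E c : h (u c) = y c by apply: (congr1 (fun t : points T (kres i R) => t c) hE).
by rewrite -!E; congr (h _).
Qed.

Lemma torus_model_exists (S : seq ks) :
  exists (L : splittingFieldType k) (e : {rmorphism L -> ks})
         (N : lattice (gal_of {:L}%AS) n) (uL : {rmorphism A -> lau L n})
         (eL : {rmorphism lau L n -> lau ks n}),
  [/\ galois 1%AS {:L}%AS, forall c : k, e c%:A = i c,
      forall x, x \in S -> exists y, e y = x & deflation e That N] /\
  [/\ torus_model N (coord_str T) uL, forall c, eL (lauC n c) = lauC n (e c),
      forall v, eL (lx L v) = lx ks v & forall a, eL (uL a) = u a].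
Proof.
have [m [f f_surj]] := affvar_ft T.
have [ST STP] := gal_lattice_open That.
have [ex exE] := choice (fun z => @lau_expand ks n z).
have [sp spE] := choice (fun z => lau_spanP ur z (ks_span z)).
(* L must contain the coefficients of the images in ks[T^] of generators of k[T], and those that
   express the variables and their inverses through k[T]. *)
pose S1 := flatten [seq unzip1 (ex (u (f 'X_l))) | l : 'I_m].
pose S2 := flatten [seq unzip1 (sp (lx ks (delta_mx 0 l))) | l : 'I_n].
pose S3 := flatten [seq unzip1 (sp (lx ks (- delta_mx 0 l))) | l : 'I_n].
have [L [e [galL eC eS]]] := finite_galois_cover ks_closure (S ++ ST ++ S1 ++ S2 ++ S3).
have [|N TN] := deflation_exists ks_closure eC (X := That).
  move=> s sL; apply: STP => x xS; have [|y <-] := eS x; last exact: sL.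
  by rewrite !mem_cat xS orbT.
have [eL [eLC eLX']] := lau_map e (1%:M : 'M[int]_n).
have eLX v : eL (lx L v) = lx ks v by rewrite eLX' mulmx1.
have eLI : injective eL.
  by apply: (lau_map_inj eLC eLX') => v w; rewrite !mulmx1.
have lift_seq (X : Type) (s : seq (ks * X)) : {subset unzip1 s <= S1 ++ S2 ++ S3} ->
    exists t : seq (L * X), s = [seq (e x.1, x.2) | x <- t].
  elim: s => [|[c x] s IHs] sub; first by exists [::].
  have [|t ->] := IHs; first by move=> y ys; apply: sub; rewrite inE ys orbT.
  have [|c' <-] := eS c; last by exists ((c', x) :: t).
  by rewrite 2!mem_cat sub ?orbT // mem_head.
have exp l : exists z, eL z = u (f 'X_l).
  have [|t Et] := @lift_seq _ (ex (u (f 'X_l))).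
    move=> c cin; rewrite mem_cat; apply/orP; left; apply/flattenP.
    by exists (unzip1 (ex (u (f 'X_l)))) => //; apply: map_f; rewrite mem_enum.
  exists (\sum_(x <- t) lauC n x.1 * lx L x.2); rewrite [RHS]exE Et big_map rmorph_sum.
  by apply: eq_bigr => x _; rewrite rmorphM eLC eLX.
have [pX pXE] := choice exp.
have [w [wC wX]] := mpoly_eval_exists (@lauC L n \o in_alg L) pX.
have wE P : eL (w P) = u (f P).
  apply: (@mpoly_hom_eq _ _ _ (eL \o w) (ur \o f)) => [c|l] /=.
    by rewrite wC eLC /= eC [f _](khomP f); apply/esym; apply: (khomP u).
  by rewrite wX pXE.
have [l lP] := choice f_surj.
have [uL uLE] : exists g : {rmorphism A -> lau L n}, g =1 (fun a => w (l a)).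
  apply: rmorphism_of_fun => [a b|a b|]; apply: eLI.
  - by rewrite rmorphB !wE !lP; apply: (rmorphB ur).
  - by rewrite rmorphM !wE !lP; apply: (rmorphM ur).
  - by rewrite wE lP [RHS]rmorph1; apply: (rmorph1 ur).
have eLu a : eL (uL a) = u a by rewrite uLE wE lP.
exists L, e, N, uL, eL; split; split=> //.
  by move=> x xS; apply: eS; rewrite mem_cat xS.
have uLC (c : k) : uL (coord_str T c) = lauC n c%:A.
  by apply: eLI; rewrite eLu eLC eC; apply: (khomP u).
have uLI : injective uL.
  by move=> a b E; apply: universal_point_inj; rewrite /ur /= -!eLu E.
have fixu g a : lact N g (uL a) = uL a.
  have [s sE] := gal_lift ks_closure eC g.
  have [h [hC hX hu]] := twist_map s.
  apply: eLI; rewrite eLu -[RHS]hu -eLu.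
  apply: (lau_hom_eq (f := eL \o lact N g) (g := h \o eL)) => [c|j] /=.
    by rewrite lactC !eLC hC sE.
  by rewrite lactX !eLX hX (TN s g).
have full z : z \in lau_span uL.
  apply: lau_span_full => j.
    have [|t Et] := @lift_seq _ (sp (lx ks (delta_mx 0 j))).
      move=> c cin; rewrite !mem_cat; apply/orP; right; apply/orP; left; apply/flattenP.
      by exists (unzip1 (sp (lx ks (delta_mx 0 j)))) => //; apply: map_f; rewrite mem_enum.
    apply/lau_spanP; exists t; apply: eLI; rewrite eLX [LHS]spE Et big_map rmorph_sum.
    by apply: eq_bigr => x _; rewrite rmorphM eLC eLu.
  have [|t Et] := @lift_seq _ (sp (lx ks (- delta_mx 0 j))).
    move=> c cin; rewrite !mem_cat; apply/orP; right; apply/orP; right; apply/flattenP.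
    by exists (unzip1 (sp (lx ks (- delta_mx 0 j)))) => //; apply: map_f; rewrite mem_enum.
  apply/lau_spanP; exists t; apply: eLI; rewrite eLX [LHS]spE Et big_map rmorph_sum.
  by apply: eq_bigr => x _; rewrite rmorphM eLC eLu.
split=> // z; split=> [zfix|[a <-] g]; last exact: fixu.
have [c c1] := al_trace1 (@galr1 k L) (@galrM k L) (@galr_faithful k L).
have [s Es] := lau_spanP _ _ (full z).
have [tr trE] := choice (trace_base galL).
(* An invariant z is the trace of c z, with c of trace 1. Expanding z over k[T] turns this trace
   into an element of k[T]. *)
exists (\sum_(x <- s) coord_str T (tr (c * x.1)) * x.2).
have <- : ltrace N (lauC n c * z) = z by rewrite ltrace_mul // c1 rmorph1 mul1r.
rewrite Es mulr_sumr /ltrace; under [RHS]eq_bigr do rewrite rmorph_sum.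
rewrite exchange_big rmorph_sum; apply: eq_bigr => x _ /=.
rewrite rmorphM uLC -trE -(ltrace_mul (N := N)) /ltrace.
  by apply: eq_bigr => g _; rewrite (rmorphM (@lauC L n)) mulrA.
by move=> g; apply: fixu.
Qed.

End TorusModel.

(** * Splitting of T over the finite extension L *)

Section SplitOverFiniteExtension.
Variables (k ks : fieldType) (i : {rmorphism k -> ks}) (T : groupvar k) (n : nat).
Variable ev : 'rV[int]_n -> character T i.
Variable u : points T (kres i (lau_alg ks n)).
Hypothesis evu : forall v, ev v (lau_alg ks n) u = lx ks v.
Hypothesis uU : forall (R : kalg ks) (y : points T (kres i R)),
  exists h : khom (lau_alg ks n) R, kcomp (kres_hom i h) u = y.
Variables (L : splittingFieldType k) (e : {rmorphism L -> ks}).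
Hypothesis galL : galois 1%AS {:L}%AS.
Hypothesis eC : forall c : k, e c%:A = i c.
Variables (N : lattice (gal_of {:L}%AS) n).
Variables (uL : {rmorphism Defs.coord T -> lau L n}) (eL : {rmorphism lau L n -> lau ks n}).
Hypothesis model : torus_model N (coord_str T) uL.
Hypothesis eLC : forall c, eL (lauC n c) = lauC n (e c).
Hypothesis eLX : forall v, eL (lx L v) = lx ks v.
Hypothesis eLu : forall a, eL (uL a) = u a.

Local Notation pt R := (points T (kres (in_alg L) R)).

Lemma pt_base (R : kalg L) (y : pt R) c : y (coord_str T c) = kstr R c%:A.
Proof. exact: (khomP y). Qed.

Definition pt_hom (R : kalg L) (y : pt R) : khom (lau_alg L n) R :=
  projT1 (cid (model_universal galL model (pt_base y))).

Lemma pt_homE (R : kalg L) (y : pt R) a : pt_hom y (uL a) = y a.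
Proof. exact: (projT2 (cid (model_universal galL model (pt_base y)))). Qed.

Lemma pt_hom_uniq (R : kalg L) (y : pt R) (h : khom (lau_alg L n) R) :
  (forall a, h (uL a) = y a) -> forall z, pt_hom y z = h z.
Proof.
move=> hE; apply: (model_hom_eq model (f := kfun (pt_hom y)) (h := kfun h)) => [c|a].
  by rewrite [LHS](khomP (pt_hom y)); apply/esym/(khomP h).
by rewrite hE; apply: pt_homE.
Qed.

Fact uL_base c : (uL : {rmorphism coord_alg T -> kres (in_alg L) (lau_alg L n)})
  (kstr (coord_alg T) c) = kstr (kres (in_alg L) (lau_alg L n)) c.
Proof. by case: model => uC _ _; apply: uC. Qed.

Definition uLpt : pt (lau_alg L n) := KHom uL_base.

Definition chi_val l (R : kalg L) (y : pt R) : R := pt_hom y (lx L (delta_mx 0 l)).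

Fact chi_val_unit l (R : kalg L) (y : pt R) : exists v : R, chi_val l y * v = 1.
Proof.
exists (pt_hom y (lx L (- delta_mx 0 l))).
by rewrite -(rmorphM (kfun (pt_hom y))) lx_unit (rmorph1 (kfun (pt_hom y))).
Qed.

Fact chi_val_nat l (R S : kalg L) (h : khom R S) (y : pt R) :
  h (chi_val l y) = chi_val l (kcomp (kres_hom (in_alg L) h) y).
Proof.
rewrite /chi_val (@pt_hom_uniq _ _ (kcomp h (pt_hom y))) // => a.
by rewrite /= pt_homE.
Qed.

(** The group law is not given by a formula over L. The identity is verified after embedding
    L[Z^(2n)] in ks[Z^(2n)], where the characters [ev] are multiplicative. *)
Lemma chi_val_generic l (B1 B2 : 'M[int]_(n, n + n))
    (h1 h2 : khom (lau_alg L n) (lau_alg L (n + n))) :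
  (forall v, h1 (lx L v) = lx L (v *m B1)) -> (forall v, h2 (lx L v) = lx L (v *m B2)) ->
  chi_val l (gmul (kcomp (kres_hom (in_alg L) h1) uLpt) (kcomp (kres_hom (in_alg L) h2) uLpt))
    = lx L (delta_mx 0 l *m (B1 + B2)).
Proof.
move=> h1X h2X; set g := gmul _ _.
have [e2 [e2C e2X']] := lau_map e (1%:M : 'M[int]_(n + n)).
have e2X v : e2 (lx L v) = lx ks v by rewrite e2X' mulmx1.
have e2I : injective e2.
  by apply: (lau_map_inj e2C e2X') => v w; rewrite !mulmx1.
have e2k c : (e2 : {rmorphism kres (in_alg L) (lau_alg L (n + n)) ->
      kres i (lau_alg ks (n + n))}) (kstr (kres (in_alg L) (lau_alg L (n + n))) c)
    = kstr (kres i (lau_alg ks (n + n))) c.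
  by rewrite /= e2C eC.
pose E2 : khom (kres (in_alg L) (lau_alg L (n + n))) (kres i (lau_alg ks (n + n))) := KHom e2k.
have [H HE] := uU (kcomp E2 g).
have Hg a : H (u a) = e2 (g a).
  exact: (congr1 (fun t : points T (kres i (lau_alg ks (n + n))) => t a) HE).
have e2H z : e2 (pt_hom g z) = H (eL z).
  apply: (model_hom_eq model (f := e2 \o kfun (pt_hom g)) (h := kfun H \o eL)) => [c|a] /=.
    by rewrite [pt_hom g _](khomP (pt_hom g)) /= e2C eLC; apply/esym/(khomP H).
  by rewrite pt_homE eLu Hg.
apply: e2I; rewrite /chi_val e2H eLX -evu.
have := character_kcomp (ev (delta_mx 0 l)) H u; rewrite HE /g gmul_nat chiM => <-.
have one (B : 'M[int]_(n, n + n)) (h : khom (lau_alg L n) (lau_alg L (n + n))) :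
    (forall v, h (lx L v) = lx L (v *m B)) ->
    ev (delta_mx 0 l) (lau_alg ks (n + n)) (kcomp E2 (kcomp (kres_hom (in_alg L) h) uLpt))
      = lx ks (delta_mx 0 l *m B).
  move=> hX; have [H' [H'C H'X]] := lau_map (idfun : {rmorphism ks -> ks}) B.
  pose K' := @KHom ks (lau_alg ks n) (lau_alg ks (n + n)) H' H'C.
  have -> : kcomp E2 (kcomp (kres_hom (in_alg L) h) uLpt) = kcomp (kres_hom i K') u.
    apply: khom_eq => a /=; rewrite -eLu.
    apply: (lau_hom_eq (f := e2 \o kfun h) (g := H' \o eL)) => [c|j] /=.
      by rewrite [h _](khomP h) /= e2C eLC H'C.
    by rewrite hX e2X eLX H'X.
  by rewrite character_kcomp evu /= H'X.
by rewrite (one B1) // (one B2) // -lxD mulmxDr e2X.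
Qed.

Fact chi_valM l (R : kalg L) (x y : pt R) :
  chi_val l (gmul x y) = chi_val l x * chi_val l y.
Proof.
have mk (B : 'M[int]_(n, n + n)) : exists h : khom (lau_alg L n) (lau_alg L (n + n)),
    forall v, h (lx L v) = lx L (v *m B).
  have [h [hC hX]] := lau_map (idfun : {rmorphism L -> L}) B.
  by exists (@KHom L (lau_alg L n) (lau_alg L (n + n)) h hC).
have [h1 h1X] := mk (row_mx 1%:M 0); have [h2 h2X] := mk (row_mx 0 1%:M).
(* [V] specializes the generic pair of points to (x, y), which reduces multiplicativity to
   [chi_val_generic]. *)
pose V (v : 'rV[int]_(n + n)) := pt_hom x (lx L (lsubmx v)) * pt_hom y (lx L (rsubmx v)).
have [||H [HC HX]] := lau_eval (kstr R) (v := V).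
- rewrite /V !linear0 lx0; rewrite (rmorph1 (kfun (pt_hom x))) (rmorph1 (kfun (pt_hom y))).
  by rewrite mulr1.
- move=> v w; rewrite /V !linearD !lxD.
  by rewrite (rmorphM (kfun (pt_hom x))) (rmorphM (kfun (pt_hom y))) mulrACA.
pose H' := @KHom L (lau_alg L (n + n)) R H HC.
have xE : kcomp (kres_hom (in_alg L) H') (kcomp (kres_hom (in_alg L) h1) uLpt) = x.
  apply: khom_eq => a; rewrite -[RHS]pt_homE /=; apply/esym.
  apply: (lau_hom_eq (f := kfun (pt_hom x)) (g := H \o kfun h1)) => [c|j] /=.
    by rewrite [h1 _](khomP h1) /= HC; apply: (khomP (pt_hom x)).
  rewrite h1X HX /V mul_mx_row row_mxKl row_mxKr mulmx1 mulmx0 lx0.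
  by rewrite (rmorph1 (kfun (pt_hom y))) mulr1.
have yE : kcomp (kres_hom (in_alg L) H') (kcomp (kres_hom (in_alg L) h2) uLpt) = y.
  apply: khom_eq => a; rewrite -[RHS]pt_homE /=; apply/esym.
  apply: (lau_hom_eq (f := kfun (pt_hom y)) (g := H \o kfun h2)) => [c|j] /=.
    by rewrite [h2 _](khomP h2) /= HC; apply: (khomP (pt_hom y)).
  rewrite h2X HX /V mul_mx_row row_mxKl row_mxKr mulmx1 mulmx0 lx0.
  by rewrite (rmorph1 (kfun (pt_hom x))) mul1r.
rewrite -{1}xE -{1}yE -gmul_nat -chi_val_nat (chi_val_generic l h1X h2X) /= HX /V.
by rewrite add_row_mx addr0 add0r mul_mx_row mulmx1 row_mxKl row_mxKr.
Qed.

Definition chi_char l : character T (in_alg L) :=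
  Character (@chi_val_unit l) (@chi_valM l) (@chi_val_nat l).

Lemma split_over_finite : split_over T (in_alg L).
Proof.
exists n, chi_char => R w wunit.
have [w' w'P] := choice wunit.
have [V [V0 VD Vd]] := units_monomial w'P.
have [h [hC hX]] := lau_eval (kstr R) V0 VD.
pose h' := @KHom L (lau_alg L n) R h hC.
exists (kcomp (kres_hom (in_alg L) h') uLpt); split=> [l|y yP] /=.
  by rewrite -chi_val_nat /chi_val (@pt_hom_uniq _ _ (kid _)) //= hX Vd.
apply: khom_eq => a; rewrite -[RHS]pt_homE /=.
apply: (lau_hom_eq (f := h) (g := kfun (pt_hom y))) => [c|l].
  by rewrite hC; apply/esym/(khomP (pt_hom y)).
by rewrite hX Vd -yP.
Qed.

End SplitOverFiniteExtension.

(** * Multiplication by d on a torus *)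

Lemma rat_map (K K' : fieldType) n n' (h : {rmorphism lau K n -> lau K' n'}) :
  injective h -> exists h' : {rmorphism ratfun K n -> ratfun K' n'},
    forall z : lau K n, h' (val z) = val (h z).
Proof.
move=> hI.
pose h0 : {rmorphism {mpoly K[n]} -> ratfun K' n'} :=
  (@subring_val _ _ (loc_closed (lauD K' n'))) \o h \o (@loc_of _ (lauD K n)).
have [|h' h'E] := @fraction_extend _ _ h0.
  move=> a b /val_inj/hI/(congr1 val)/eqP.
  by rewrite /= tofrac_eq => /eqP.
exists h'; apply: (@loc_hom_eq _ _ (lauD_neq0 K n) _
  (h' \o @subring_val _ _ (loc_closed (lauD K n)))
  ((@subring_val _ _ (loc_closed (lauD K' n'))) \o h)) => a /=.
by rewrite h'E.
Qed.

Lemma lau_ratio (K : fieldType) n (z : ratfun K n) :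
  exists a b : lau K n, b != 0 /\ z = val a / val b.
Proof.
have [a [b [nz_b ->]]] := fraction_ratio z.
exists (loc_of _ a), (loc_of _ b); split=> //.
by apply: contra nz_b => /eqP/(congr1 val)/eqP; rewrite /= tofrac_eq0.
Qed.

Lemma val_eq0 (K : fieldType) n (z : lau K n) : (val z == 0) = (z == 0).
Proof. by rewrite -(rmorph0 (val : lau K n -> ratfun K n)) (inj_eq val_inj). Qed.

(** * The Galois action on rational functions *)

Section RationalFunctions.
Variables (k : fieldType) (L : splittingFieldType k) (n : nat).
Local Notation G := (gal_of {:L}%AS).
Variable N : lattice G n.
Local Notation E := (ratfun L n).
Local Notation Lam := (lau L n).

Lemma lact_inj g : injective (lact N g).
Proof.
move=> z w /(congr1 (lact N g^-1%g)).
by rewrite -!lactM mulgV !lact1.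
Qed.

Definition ract (g : G) : {rmorphism E -> E} := projT1 (cid (rat_map (@lact_inj g))).

Lemma ract_val g (z : Lam) : ract g (val z) = val (lact N g z).
Proof. exact: (projT2 (cid (rat_map (@lact_inj g)))). Qed.

Lemma ract_xm g v : ract g (xm L v) = xm L (v *m N g).
Proof. by have := ract_val g (lx L v); rewrite lactX. Qed.

Definition ratC (c : L) : E := val (lauC n c).

Lemma ract_C g c : ract g (ratC c) = ratC (galr g c).
Proof. by rewrite ract_val lactC. Qed.

Lemma ract1 z : ract 1%g z = z.
Proof.
have [a [b [_ ->]]] := lau_ratio z.
by rewrite fmorph_div !ract_val !lact1.
Qed.

Lemma ractM g h z : ract (g * h)%g z = ract h (ract g z).
Proof.
have vE a : ract (g * h)%g (val (a : Lam)) = ract h (ract g (val a)).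
  by rewrite ract_val lactM -ract_val -ract_val.
by have [a [b [_ ->]]] := lau_ratio z; rewrite 3!fmorph_div vE vE.
Qed.

Lemma ract_faithful g : g != 1%g -> exists z, ract g z != z.
Proof.
move/(@galr_faithful k L) => [c ne]; exists (ratC c); rewrite ract_C.
apply: contra ne => /eqP/val_inj E; apply/eqP; apply: (fmorph_inj (@lauC L n)).
exact: E.
Qed.

Section Model.
Hypothesis galL : galois 1%AS {:L}%AS.
Variables (A : idomainType) (strA : {rmorphism k -> A}) (u : {rmorphism A -> Lam}).
Hypothesis model : torus_model N strA u.

Definition uE : {rmorphism A -> E} := (@subring_val _ _ (loc_closed (lauD L n))) \o u.

Lemma uE_inj : injective uE.
Proof. by case: model => _ uI _ a b /val_inj/uI. Qed.

Lemma uE_eq0 a : (uE a == 0) = (a == 0).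
Proof. by rewrite -(rmorph0 uE) (inj_eq uE_inj). Qed.

Lemma ract_uE g a : ract g (uE a) = uE a.
Proof. by rewrite ract_val (lact_model model). Qed.

(** Multiplying by the other conjugates of the denominator replaces it by its norm; then the
    numerator is invariant too. *)
Lemma ract_invariant z : (forall g, ract g z = z) ->
  exists a b : A, b != 0 /\ z = uE a / uE b.
Proof.
move=> zfix; have [f [h [nz_h Ez]]] := lau_ratio z.
pose H := \prod_g lact N g h.
have Hfix g : lact N g H = H.
  rewrite rmorph_prod [RHS](reindex_inj (mulIg g)).
  by apply: eq_bigr => g' _; apply/esym/lactM.
have nz_H : val H != 0.
  rewrite rmorph_prod; apply/prodf_neq0 => g _; rewrite val_eq0.
  by rewrite -(rmorph0 (lact N g)) (inj_eq (@lact_inj g)).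
pose F := f * \prod_(g | g != 1%g) lact N g h.
have FE : z * val H = val F.
  have -> : H = h * \prod_(g | g != 1%g) lact N g h by rewrite /H (bigD1 1%g) //= lact1.
  by rewrite Ez !(rmorphM (@subring_val _ _ (loc_closed (lauD L n)))) mulrA divfK ?val_eq0.
have Ffix g : lact N g F = F.
  apply: val_inj; rewrite -ract_val -FE rmorphM zfix ract_val Hfix.
  by [].
case: model => _ _ uP; have [b Eb] := (uP H).1 Hfix; have [a Ea] := (uP F).1 Ffix.
exists a, b; rewrite -uE_eq0 /uE /= Eb Ea; split=> //.
by rewrite -FE mulfK.
Qed.

Lemma uF_exists : exists uF : {rmorphism {fraction A} -> E},
  forall a, uF (FracField.tofrac a) = uE a.
Proof. exact: fraction_extend uE_inj. Qed.

Definition uF : {rmorphism {fraction A} -> E} := projT1 (cid uF_exists).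

Lemma uF_frac a : uF (FracField.tofrac a) = uE a.
Proof. exact: (projT2 (cid uF_exists)). Qed.

Lemma ract_uF g z : ract g (uF z) = uF z.
Proof.
have [a [b [_ ->]]] := fraction_ratio z.
by rewrite !fmorph_div !uF_frac !ract_uE.
Qed.

Lemma uF_invariant z : (forall g, ract g z = z) -> exists w, uF w = z.
Proof.
move=> /ract_invariant[a [b [_ ->]]]; exists (FracField.tofrac a / FracField.tofrac b).
by rewrite fmorph_div !uF_frac.
Qed.

Section Multiplication.
Variable d : int.
Hypothesis nz_d : d != 0.

Lemma mul_inj : injective (fun v : 'rV[int]_n => v *m d%:M).
Proof.
move=> v w; rewrite !mul_mx_scalar => /rowP E; apply/rowP=> l.
by have := E l; rewrite !mxE => /(mulfI nz_d).
Qed.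

Definition phi : {rmorphism Lam -> Lam} :=
  projT1 (cid (lau_map (idfun : {rmorphism L -> L}) (d%:M : 'M[int]_n))).

Lemma phiC c : phi (lauC n c) = lauC n c.
Proof. exact: (projT2 (cid (lau_map (idfun : {rmorphism L -> L}) d%:M))).1. Qed.

Lemma phiX v : phi (lx L v) = lx L (v *m d%:M).
Proof. exact: (projT2 (cid (lau_map (idfun : {rmorphism L -> L}) d%:M))).2. Qed.

Lemma phi_inj : injective phi.
Proof. exact: (@lau_map_inj _ _ idfun _ _ _ _ phiC phiX mul_inj). Qed.

Lemma phi_lact g z : lact N g (phi z) = phi (lact N g z).
Proof.
apply: (lau_hom_eq (f := lact N g \o phi) (g := phi \o lact N g)) => [c|l] /=.
  by rewrite phiC !lactC phiC.
by rewrite phiX !lactX phiX -!mulmxA scalar_mxC.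
Qed.

Lemma mult_exists : exists f : {rmorphism A -> A}, forall a, u (f a) = phi (u a).
Proof.
case: (model) => _ uI uP.
have ex a : exists b, u b = phi (u a).
  by apply/uP => g; rewrite phi_lact (lact_model model).
have [f0 f0E] := choice ex.
have [f fE] : exists f : {rmorphism A -> A}, f =1 f0.
  apply: rmorphism_of_fun => [a b|a b|]; apply: uI.
  - by rewrite rmorphB !f0E !rmorphB.
  - by rewrite rmorphM !f0E !rmorphM.
  - by rewrite f0E !rmorph1.
by exists f => a; rewrite fE f0E.
Qed.

Definition mult : {rmorphism A -> A} := projT1 (cid mult_exists).

Lemma multE a : u (mult a) = phi (u a).
Proof. exact: (projT2 (cid mult_exists)). Qed.

Lemma mult_base c : mult (strA c) = strA c.
Proof. by case: (model) => uC uI _; apply: uI; rewrite multE uC phiC. Qed.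

Lemma mult_inj : injective mult.
Proof.
by case: (model) => _ uI _ a b /(congr1 u); rewrite !multE => /phi_inj/uI.
Qed.

Definition phiE : {rmorphism E -> E} := projT1 (cid (rat_map phi_inj)).

Lemma phiE_val z : phiE (val z) = val (phi z).
Proof. exact: (projT2 (cid (rat_map phi_inj))). Qed.

Lemma phiE_ract g z : ract g (phiE z) = phiE (ract g z).
Proof.
have [a [b [_ ->]]] := lau_ratio z.
by rewrite !(phiE_val, ract_val, fmorph_div) !phi_lact.
Qed.

End Multiplication.
End Model.
End RationalFunctions.

(** * The degree of multiplication by d *)

Section BasisDescent.
Variables (E : fieldType) (G : finGroupType) (al : G -> {rmorphism E -> E}).
Hypothesis al1 : forall x, al 1%g x = x.
Hypothesis alM : forall g h x, al (g * h)%g x = al h (al g x).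
Hypothesis al_faithful : forall g, g != 1%g -> exists x, al g x != x.
Variables (ph : {rmorphism E -> E}) (ph_al : forall g z, al g (ph z) = ph (al g z)).
Variable r : nat.

(** E is a vector space over its subfield ph(E); scalars are written before [ph] is applied. *)
Definition twisted_comb (w : 'cV[E]_r) (c : 'rV[E]_r) : E := (map_mx ph c *m w) 0 0.

Lemma twisted_combZ w h c : twisted_comb w (h *: c) = ph h * twisted_comb w c.
Proof. by rewrite /twisted_comb map_mxZ -scalemxAl mxE. Qed.

Lemma twisted_combE w c : twisted_comb w c = \sum_l ph (c 0 l) * w l 0.
Proof. by rewrite /twisted_comb mxE; under eq_bigr do rewrite mxE. Qed.

(** The matrices [R g] of the semilinear action on the basis [w] over ph(E) form a cocycle. By
    Speiser's theorem a change of basis makes the basis invariant, and an invariant element then has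
    invariant coordinates. *)
Lemma basis_descent (w : 'cV[E]_r) :
  (forall z, exists c, z = twisted_comb w c) -> injective (twisted_comb w) ->
  exists e : 'cV[E]_r, [/\ forall g l, al g (e l 0) = e l 0, injective (twisted_comb e)
    & forall z, (forall g, al g z = z) -> exists c : 'rV[E]_r,
        (forall g l, al g (c 0 l) = c 0 l) /\ z = twisted_comb e c].
Proof.
move=> span free.
have spanm m (Z : 'cV[E]_m) : exists C : 'M[E]_(m, r), Z = map_mx ph C *m w.
  have [c cE] := choice (fun l => span (Z l 0)); exists (\matrix_l c l).
  apply/colP=> l; rewrite cE /twisted_comb !mxE.
  by apply: eq_bigr => j _; rewrite !mxE.
have freem m (C D : 'M[E]_(m, r)) : map_mx ph C *m w = map_mx ph D *m w -> C = D.
  move=> E0; apply/row_matrixP=> l; apply: free; rewrite /twisted_comb !map_row.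
  by rewrite -!row_mul E0.
have map_ph_al g m q (X : 'M[E]_(m, q)) :
    map_mx (al g) (map_mx ph X) = map_mx ph (map_mx (al g) X).
  by apply/matrixP=> a b; rewrite !mxE ph_al.
have [R RE] := choice (fun g => spanm r (map_mx (al g) w)).
have R1 : R 1%g = 1%:M.
  by apply: freem; rewrite -RE map_mx1 mul1mx; apply/matrixP=> a b; rewrite mxE al1.
have RM g h : R (g * h)%g = map_mx (al h) (R g) *m R h.
  apply: freem; rewrite -RE map_mxM -mulmxA -RE -map_ph_al -map_mxM -RE.
  by apply/matrixP=> a b; rewrite !mxE alM.
have [B Bu BE] := speiser al1 alM al_faithful R1 RM.
have Rinv g : map_mx (al g) (invmx B) *m R g = invmx B.
  have Ru : map_mx (al g) (invmx B) *m (R g *m B) = 1%:M.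
    by rewrite -BE -map_mxM mulVmx // map_mx1.
  by rewrite -[LHS](mulmxK Bu) -(mulmxA _ (R g) B) Ru mul1mx.
pose e := map_mx ph (invmx B) *m w.
have combe c : twisted_comb e c = twisted_comb w (c *m invmx B).
  by rewrite /twisted_comb /e mulmxA -map_mxM.
have efix g : map_mx (al g) e = e.
  by rewrite /e map_mxM map_ph_al RE mulmxA -map_mxM Rinv.
have einj : injective (twisted_comb e).
  move=> c c'; rewrite !combe => /free /(congr1 (mulmx^~ B)).
  by rewrite !mulmxKV.
exists e; split=> // [g l|z zfix]; first by have /colP/(_ l) := efix g; rewrite mxE.
have [c Ez] := span z; exists (c *m B); rewrite combe mulmxK //; split=> // g l.
suff /rowP/(_ l) : map_mx (al g) (c *m B) = c *m B by rewrite mxE.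
apply: einj; rewrite [RHS]combe mulmxK // -Ez -[RHS](zfix g).
have -> : z = twisted_comb e (c *m B) by rewrite combe mulmxK.
rewrite /twisted_comb -map_ph_al -{1}(efix g) -map_mxM.
by rewrite mxE.
Qed.

End BasisDescent.

Section PowerBasis.
Variables (L : fieldType) (n : nat) (d : int).
Hypothesis nz_d : d != 0.
Local Notation E := (ratfun L n).
Local Notation Lam := (lau L n).
Variables (ph : {rmorphism Lam -> Lam}) (phE : {rmorphism E -> E}).
Hypothesis phC : forall c, ph (lauC n c) = lauC n c.
Hypothesis phX : forall v, ph (lx L v) = lx L (v *m d%:M).
Hypothesis phE_val : forall z, phE (val z) = val (ph z).

Local Notation I := {ffun 'I_n -> 'I_`|d|}.
Local Notation r := #|{: I}|.

Definition residue_row (m : I) : 'rV[int]_n := \row_l (m l)%:Z.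

Lemma residue_row_exists v : exists m (v' : 'rV[int]_n), v = v' *m d%:M + residue_row m.
Proof.
have lt l : (`|(v 0%R l %% d)%Z| < `|d|)%N.
  by have := modz_ge0 (v 0 l) nz_d; have := ltz_mod (v 0 l) nz_d; lia.
exists [ffun l => Ordinal (lt l)], (\row_l (v 0%R l %/ d)%Z); apply/rowP=> l.
rewrite mul_mx_scalar !mxE ffunE /= {1}(divz_eq (v 0 l) d) mulrC; congr (_ + _).
by rewrite gez0_abs // modz_ge0.
Qed.

Lemma residue_row_inj v v' m m' : v *m d%:M + residue_row m = v' *m d%:M + residue_row m' ->
  v = v' /\ m = m'.
Proof.
move=> E0.
have Em : m = m'.
  apply/ffunP=> l; apply/ord_inj; have /rowP/(_ l) := E0.
  rewrite !mul_mx_scalar !mxE => /(congr1 (modz^~ d)).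
  have small (x : 'I_`|d|) : (x%:Z %% d)%Z = x.
    by rewrite -modz_abs modz_small //=; have := ltn_ord x; lia.
  by rewrite ![d * _]mulrC !modzMDl !small => -[].
split=> //; move: E0; rewrite Em => /addIr; rewrite !mul_mx_scalar => /rowP E0.
by apply/rowP=> l; have := E0 l; rewrite !mxE => /(mulfI nz_d).
Qed.

(** Euclidean division of exponents by d: L[N] is free over the image of [ph], with basis the x^m
    for 0 <= m_l < |d|. *)
Lemma power_span z : exists a : I -> Lam, z = \sum_m ph (a m) * lx L (residue_row m).
Proof.
have [s ->] := lau_expand z; elim: s => [|[c v] s [a aE]].
  by exists (fun=> 0); rewrite big_nil big1 // => m _; rewrite rmorph0 mul0r.
have [m [v' ->]] := residue_row_exists v.
exists (fun m' => a m' + (if m' == m then lauC n c * lx L v' else 0)).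
rewrite big_cons /= aE addrC; under [RHS]eq_bigr do rewrite rmorphD mulrDl.
rewrite big_split /=; congr (_ + _).
rewrite (bigD1 m) //= eqxx big1 => [|m' /negPf->]; last by rewrite rmorph0 mul0r.
by rewrite addr0 rmorphM phC phX lxD mulrA.
Qed.

Lemma power_coef v m a m' :
  lcoef (v *m d%:M + residue_row m) (ph a * lx L (residue_row m')) =
  if m' == m then lcoef v a else 0.
Proof.
have [s ->] := lau_expand a; rewrite rmorph_sum mulr_suml !lcoef_sum.
have [<-|ne] := eqVneq m' m.
  apply: eq_bigr => x _; rewrite rmorphM phC phX -mulrA -lxD !lcoefE.
  congr (_ * (nat_of_bool _)%:R); apply/eqP/eqP => [/residue_row_inj[]//|->//].
rewrite big1 // => x _; rewrite rmorphM phC phX -mulrA -lxD lcoefE.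
case: eqP => [/residue_row_inj[_ Em]|_]; last by rewrite mulr0.
by rewrite Em eqxx in ne.
Qed.

Lemma power_free (a : I -> Lam) :
  \sum_m ph (a m) * lx L (residue_row m) = 0 -> forall m, a m = 0.
Proof.
move=> a0 m; apply: lcoef_inj => v.
have := congr1 (lcoef (v *m d%:M + residue_row m)) a0.
rewrite lcoef_sum lcoef0 (bigD1 m) //= power_coef eqxx big1 ?addr0 // => m' ne.
by rewrite power_coef (negPf ne).
Qed.

Definition power_basis : 'cV[E]_r := \col_l xm L (residue_row (enum_val l)).

Lemma power_basis_val (a : I -> Lam) :
  twisted_comb phE power_basis (\row_l val (a (enum_val l))) =
  val (\sum_m ph (a m) * lx L (residue_row m)).
Proof.
rewrite twisted_combE (rmorph_sum (@subring_val _ _ (loc_closed (lauD L n)))) /=.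
rewrite (reindex (@enum_val I predT)) /=; last exact/onW_bij/enum_val_bij.
by apply: eq_bigr => l _; rewrite !mxE phE_val.
Qed.

Lemma common_denominator m (c : 'rV[E]_m) : exists (h : Lam) (a : 'I_m -> Lam),
  h != 0 /\ val h *: c = \row_l val (a l).
Proof.
have [a aP] := choice (fun l => lau_ratio (c 0 l)); have [b bP] := choice aP.
exists (\prod_l b l), (fun l => a l * \prod_(j | j != l) b j); split.
  rewrite -val_eq0 (rmorph_prod (@subring_val _ _ (loc_closed (lauD L n)))).
  by apply/prodf_neq0 => l _; rewrite val_eq0; case: (bP l).
apply/rowP=> l; rewrite !mxE (bigD1 l) //=; case: (bP l) => nz ->.
by rewrite mulrC mulrA divfK ?val_eq0.
Qed.

Lemma power_basis_free : injective (twisted_comb phE power_basis).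
Proof.
have free0 c : twisted_comb phE power_basis c = 0 -> c = 0.
  move=> c0; have [h [a [nz_h ha]]] := common_denominator c.
  have /eqP : twisted_comb phE power_basis (val h *: c) = 0.
    by rewrite twisted_combZ c0 mulr0.
  rewrite ha; pose a' m := a (enum_rank m).
  have -> : \row_l val (a l) = \row_l val (a' (enum_val l)) :> 'rV[E]_r.
    by apply/rowP=> l; rewrite !mxE /a' enum_valK.
  rewrite power_basis_val val_eq0 => /eqP/power_free a0.
  apply/rowP=> l; have /rowP/(_ l)/eqP := ha; rewrite !mxE.
  have -> : a l = 0 by rewrite -(a0 (enum_val l)) /a' enum_valK.
  by rewrite mulf_eq0 val_eq0 (negPf nz_h) => /eqP.
move=> c c' E0; apply/eqP; rewrite -subr_eq0; apply/eqP/free0.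
move: E0; rewrite /twisted_comb map_mxB mulmxBl => E0.
by rewrite mxE [X in _ + X]mxE E0 subrr.
Qed.

(** Fractions need an argument. Multiplication by the denominator b preserves the span of the basis;
    it is injective in finite dimension, hence invertible there, so a / b lies in the span. *)
Lemma power_basis_span z : exists c, z = twisted_comb phE power_basis c.
Proof.
have spanv (a : Lam) : exists c : 'rV[E]_r, val a = twisted_comb phE power_basis c.
  by have [f ->] := power_span a; exists (\row_l val (f (enum_val l))); rewrite power_basis_val.
have [a [b [nz_b ->]]] := lau_ratio z.
have nz_vb : val b != 0 by rewrite val_eq0.
have [R RE] := choice (fun l : 'I_r => spanv (b * lx L (residue_row (enum_val l)))).
have mulb c : twisted_comb phE power_basis c * val b =
    twisted_comb phE power_basis (c *m \matrix_l R l).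
  rewrite [RHS]/twisted_comb map_mxM -mulmxA mxE twisted_combE mulr_suml.
  apply: eq_bigr => l _; rewrite !mxE -mulrA; congr (_ * _).
  have := RE l; rewrite /twisted_comb mxE => E0.
  transitivity (val (b * lx L (residue_row (enum_val l)))); first by rewrite mulrC.
  by rewrite E0; apply: eq_bigr => j _; rewrite !mxE.
have Ru : \matrix_l R l \in unitmx.
  rewrite -row_free_unit; apply/inj_row_free => v v0; apply: power_basis_free.
  apply: (mulIf nz_vb); rewrite mulb v0 mulb mul0mx.
  by [].
have [y yE] := spanv a; exists (y *m invmx (\matrix_l R l)).
apply: (mulIf nz_vb); rewrite divfK; last exact: nz_vb.
by rewrite mulb (mulmxKV Ru) -yE.
Qed.

End PowerBasis.

Section MultiplicationDegree.
Variables (k : fieldType) (L : splittingFieldType k) (n : nat).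
Local Notation G := (gal_of {:L}%AS).
Variable N : lattice G n.
Variables (X : affvar k) (u : {rmorphism coord X -> lau L n}).
Hypothesis model : torus_model N (coord_str X) u.
Variable d : int.
Hypothesis nz_d : d != 0.
Local Notation E := (ratfun L n).
Local Notation I := {ffun 'I_n -> 'I_`|d|}.
Local Notation r := #|{: I}|.
Local Notation phi := (@phi k L n d).
Local Notation phiE := (phiE (k:=k) L n nz_d).

Lemma ltrace_sum (J : finType) (F : J -> lau L n) :
  ltrace N (\sum_j F j) = \sum_j ltrace N (F j).
Proof.
rewrite /ltrace exchange_big; apply: eq_bigr => g _.
exact: (rmorph_sum (lact N g)).
Qed.

Definition mult_hom : khom (coord_alg X) (coord_alg X) :=
  @KHom k (coord_alg X) (coord_alg X) (mult model d) (mult_base model d).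

Lemma mult_dominant : dominant mult_hom.
Proof. exact: (@mult_inj _ _ _ _ _ _ _ model _ nz_d). Qed.

Lemma mult_finite : finite_morphism mult_hom.
Proof.
have [c1 trc1] := al_trace1 (@galr1 k L) (@galrM k L) (@galr_faithful k L).
have [s [sE _]] := galois_coords N.
have [uC uI uP] := model.
have ex (w : lau L n) : exists a, u a = ltrace N w.
  by apply/uP => g; apply: ltrace_fix.
have [f fE] := choice ex.
pose J : finType := (I * 'I_(size s))%type.
pose x0 : L * L := (0, 0).
(* With [c1] of trace 1, u b is the trace of c1 (u b). Expanding u b in the x^m, and the
   coefficients by [galois_coords], shows that these traces generate. *)
pose gen (j : J) := f (lauC n (c1 * (nth x0 s j.2).1) * lx L (residue_row j.1)).
suff span b : exists c : J -> coord X, b = \sum_j mult model d (c j) * gen j.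
  exists #|{: J}|, (fun l => gen (enum_val l)) => b; have [c ->] := span b.
  exists (fun l => c (enum_val l)); rewrite (reindex (@enum_val J predT)) //=.
  exact/onW_bij/enum_val_bij.
have [a aE] := power_span nz_d (@phiC k L n d) (@phiX k L n d) (u b).
exists (fun j : J => f (lauC n (nth x0 s j.2).2 * a j.1)); apply: uI.
rewrite rmorph_sum /=.
transitivity (ltrace N (lauC n c1 * u b)).
  rewrite (ltrace_mul c1 (fun g => lact_model model g b)) trc1 rmorph1.
  by rewrite mul1r.
have -> : lauC n c1 * u b = \sum_(j : J) phi (ltrace N (lauC n (nth x0 s j.2).2 * a j.1)) *
    (lauC n (c1 * (nth x0 s j.2).1) * lx L (residue_row j.1)).
  rewrite aE mulr_sumr -(pair_big predT predT (fun m (j : 'I_(size s)) =>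
    phi (ltrace N (lauC n (nth x0 s j).2 * a m)) *
    (lauC n (c1 * (nth x0 s j).1) * lx L (residue_row m)))) /=.
  apply: eq_bigr => m _; rewrite {1}[a m]sE (big_nth x0) big_mkord rmorph_sum.
  rewrite mulr_suml mulr_sumr; apply: eq_bigr => j _.
  by rewrite !rmorphM phiC; ring.
rewrite ltrace_sum; apply: eq_bigr => j _ /=.
rewrite rmorphM multE !fE; set t := ltrace N (_ * a _).
rewrite [RHS]mulr_sumr; apply: eq_bigr => g _.
by rewrite rmorphM phi_lact ltrace_fix.
Qed.

(** The |d|^n monomials x^m form a basis of L(T) over its image under multiplication by d;
    [basis_descent] brings this basis down to k(T). *)
Lemma mult_degree : morphism_degree mult_hom (`|d| ^ n)%N.
Proof.
have -> : (`|d| ^ n)%N = r by rewrite card_ffun !card_ord.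
have [e [efix einj espan]] := basis_descent (@ract1 k L n N) (@ractM k L n N)
  (@ract_faithful k L n N) (phiE_ract N nz_d)
  (power_basis_span nz_d (@phiC k L n d) (@phiX k L n d) (@phiE_val k L n d nz_d))
  (power_basis_free nz_d (@phiC k L n d) (@phiX k L n d) (@phiE_val k L n d nz_d)).
have [e' e'E] := choice (fun l => uF_invariant model (fun g => efix g l)).
have inbase (z : {fraction coord X}) : in_base_funfield mult_hom z <->
    exists w, uF model z = phiE (uF model w).
  split=> [[a [b [_ ->]]]|[w]].
    exists (FracField.tofrac a / FracField.tofrac b).
    by rewrite !fmorph_div !uF_frac /= !phiE_val !multE.
  have [a [b [nz_b ->]]] := fraction_ratio w.
  move=> Ez; exists a, b; split=> //; apply: (fmorph_inj (uF model)); rewrite Ez.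
  by rewrite !fmorph_div !uF_frac /= !phiE_val !multE.
exists e' => z.
have [c [cfix cE]] := espan (uF model z) (fun g => ract_uF model g z).
have [w wE] := choice (fun l => uF_invariant model (fun g => cfix g l)).
have mulw (x : {fraction coord X}) : exists y, uF model y = phiE (uF model x).
  apply: uF_invariant => g.
  by rewrite phiE_ract ract_uF.
have [y yE] := choice mulw.
exists [ffun l => y (w l)]; split.
  split=> [l|]; first by apply/inbase; exists (w l); rewrite ffunE yE.
  apply: (fmorph_inj (uF model)); rewrite cE twisted_combE rmorph_sum.
  by apply: eq_bigr => l _; rewrite rmorphM ffunE yE wE e'E.
move=> c' [c'base zE].
have [w' w'E] := choice (fun l => (inbase _).1 (c'base l)).
apply/ffunP => l; apply: (fmorph_inj (uF model)); rewrite ffunE yE w'E wE.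
suff /rowP/(_ l) : c = \row_l uF model (w' l) by rewrite mxE => ->.
apply: einj; rewrite -cE zE twisted_combE rmorph_sum.
by apply: eq_bigr => j _; rewrite rmorphM !mxE w'E e'E.
Qed.

End MultiplicationDegree.

(** * A p-retraction from a factorization *)


Section Monomials.
Variables (F : fieldType) (r : nat) (eta : 'I_r -> F).
Hypothesis nz_eta : forall i, eta i != 0.

Definition monom (c : 'rV[int]_r) : F := \prod_i eta i ^ (c 0 i).

Lemma monom0 : monom 0 = 1.
Proof. by rewrite /monom big1 // => i _; rewrite mxE expr0z. Qed.

Lemma monomD : {morph monom : v w / v + w >-> v * w}.
Proof.
by move=> v w; rewrite -big_split; apply: eq_bigr => i _ /=; rewrite mxE expfzDr.
Qed.

Lemma monom_neq0 c : monom c != 0.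
Proof. by apply/prodf_neq0 => i _; rewrite expfz_neq0. Qed.

Lemma monom_delta i : monom (delta_mx 0 i) = eta i.
Proof.
rewrite /monom (bigD1 i) //= mxE !eqxx expr1z big1 ?mulr1 // => j /negPf ne.
by rewrite mxE ne andbF expr0z.
Qed.

Lemma monomZ z c : monom (z *: c) = monom c ^ z.
Proof.
rewrite /monom (big_morph (fun x => x ^ z) (fun x y => expfzMl x y z) (exp1rz F z)).
by apply: eq_bigr => i _; rewrite mxE mulrC exprz_exp.
Qed.

Lemma monom_mul m (c : 'rV[int]_m) (A : 'M[int]_(m, r)) :
  monom (c *m A) = \prod_i monom (row i A) ^ (c 0 i).
Proof.
rewrite mulmx_sum_row (big_morph monom monomD monom0).
by apply: eq_bigr => i _; rewrite monomZ.
Qed.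

End Monomials.

Lemma rmorph_monom (F F' : fieldType) (h : {rmorphism F -> F'}) r (eta : 'I_r -> F) c :
  h (monom eta c) = monom (h \o eta) c.
Proof. by rewrite rmorph_prod; apply: eq_bigr => i _; rewrite fmorphXz. Qed.

Lemma hom_scale (F : fieldType) m (Th : 'rV[int]_m -> F) :
  Th 0 = 1 -> {morph Th : v w / v + w >-> v * w} -> (forall w, Th w != 0) ->
  forall z w, Th (z *: w) = Th w ^ z.
Proof.
move=> Th0 ThD nzTh z w.
have ThN e : Th (e%:Z *: w) = Th w ^ e%:Z.
  elim: e => [|e IHe]; first by rewrite scale0r Th0 expr0z.
  by rewrite -(addn1 e) PoszD scalerDl scale1r ThD IHe expfzDr // expr1z.
case: z => e //; rewrite NegzE scaleNr; apply: (mulfI (nzTh (e.+1%:Z *: w))).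
by rewrite -ThD subrr Th0 ThN -expfzDr // subrr expr0z.
Qed.

(** * Lifting an extension to functions by Hilbert 90 *)

Section PermutedUnits.
Variables (E : fieldType) (G : finGroupType) (al : G -> {rmorphism E -> E}).
Hypothesis al1 : forall x, al 1%g x = x.
Hypothesis alM : forall g h x, al (g * h)%g x = al h (al g x).
Hypothesis al_faithful : forall g, g != 1%g -> exists x, al g x != x.
Variables (n : nat) (N : lattice G n) (xi : 'rV[int]_n -> E).
Hypotheses (xi0 : xi 0 = 1) (xiD : {morph xi : v w / v + w >-> v * w}).
Hypotheses (nz_xi : forall v, xi v != 0) (al_xi : forall g v, al g (xi v) = xi (v *m N g)).

(* Hilbert 90: the class in H^1(G, N (x) Q^* ) of the extension M dies in the
   monomial matrices over E, by Speiser's theorem, so M maps to E^*. *)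
Lemma character_lift m t (M : lattice G m) (Q : lattice G t) j q :
  short_exact N M Q j q -> permutation_lattice Q ->
  exists Th : 'rV[int]_m -> E,
  [/\ Th 0 = 1, {morph Th : v w / v + w >-> v * w}, forall w, Th w != 0,
      forall v, Th (v *m j) = xi v
    & forall g w, al g (Th w) = Th (w *m M g)].
Proof.
move=> ex permQ; have [[eqj eqq] _ _ _] := ex.
have [sg [rho [sgq jrho split_M jq0 sgrho]]] := short_exact_split ex.
have [B [B' [s [BB' B'B PB s1 sM]]]] := perm_latticeP permQ.
(* [mm i] lifts a basis vector of Q to M. The cocycle [tau] measures the failure of the lifts to be
   permuted by G. *)
pose mm i := row i B *m sg.
pose tau g i := mm i *m M g *m rho.
have mmM g i : mm i *m M g = tau g i *m j + mm (s g i).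
  rewrite -[LHS]mulmx1 -split_M mulmxDr mulmxA; congr (_ + _).
  rewrite mulmxA -[mm i *m M g *m q]mulmxA eqq mulmxA /mm -(mulmxA _ sg) sgq mulmx1.
  by rewrite PB.
have jM g v : v *m j *m M g *m rho = v *m N g.
  by rewrite -(mulmxA v) -eqj !mulmxA -(mulmxA _ j) jrho mulmx1.
have tau1 i : tau 1%g i = 0 by rewrite /tau act1 mulmx1 /mm -mulmxA sgrho mulmx0.
have tauM g h i : tau (g * h)%g i = tau g i *m N h + tau h (s g i).
  by rewrite {1}/tau actM mulmxA mmM !mulmxDl jM.
pose A g : 'M[E]_t := \matrix_(a, b) (xi (tau g a) * (b == s g a)%:R).
have A1 : A 1%g = 1%:M.
  by apply/matrixP=> a b; rewrite !mxE tau1 xi0 mul1r s1 eq_sym.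
have AM g h : A (g * h)%g = map_mx (al h) (A g) *m A h.
  apply/matrixP=> a b; rewrite !mxE (bigD1 (s g a)) //= big1 => [|c ne].
    by rewrite !mxE eqxx mulr1 al_xi tauM xiD sM addr0 mulrA.
  by rewrite !mxE (negPf ne) mulr0 rmorph0 mul0r.
have [C Cu CE] := speiser al1 alM al_faithful A1 AM.
have CgE g a b : al g (C a b) = xi (tau g a) * C (s g a) b.
  have /matrixP/(_ a b) := CE g; rewrite !mxE => ->.
  rewrite (bigD1 (s g a)) //= big1 => [|c ne]; first by rewrite !mxE eqxx mulr1 addr0.
  by rewrite !mxE (negPf ne) mulr0 mul0r.
have rowC a : exists b, C a b != 0.
  apply: contrapT => /forallNP C0; have /eqP := oner_neq0 E; apply.
  have /matrixP/(_ a a) := mulmxV Cu; rewrite !mxE eqxx mulr1n => <-.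
  by rewrite big1 // => b _; have /negP/negPn/eqP-> := C0 b; rewrite mul0r.
(* Since g multiplies row a by a unit while moving it to row [s g a], the first non-zero column is
   the same along an orbit. The entries [th] chosen there transform by [tau], as a lift of the basis
   of Q must. *)
pose jj a := [pick b | C a b != 0].
have jjs g a : jj (s g a) = jj a.
  apply: eq_pick => b /=; rewrite -(fmorph_eq0 (al g) (C a b)) CgE.
  by rewrite mulf_eq0 (negPf (nz_xi _)).
pose th a := odflt 0 (omap (C a) (jj a)).
have nz_th a : th a != 0.
  rewrite /th /jj; case: pickP => [b Cb|C0]; first exact: Cb.
  exfalso; have [b /negP] := rowC a; apply; apply/negPn/negP.
  by have -> : (C a b != 0) = false := C0 b.
have thg g a : al g (th a) = xi (tau g a) * th (s g a).
  by rewrite /th jjs; case: (jj a) => [b|] /=; rewrite ?CgE // rmorph0 mulr0.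
pose Th (w : 'rV[int]_m) := xi (w *m rho) * monom th (w *m q *m B').
have ThD : {morph Th : v w / v + w >-> v * w}.
  by move=> v w; rewrite /Th !mulmxDl xiD monomD // mulrACA.
exists Th; split=> //.
- by rewrite /Th !mul0mx xi0 monom0 mulr1.
- by move=> w; rewrite mulf_neq0 ?nz_xi ?monom_neq0.
- by move=> v; rewrite /Th -!mulmxA jrho mulmx1 (mulmxA j) jq0 mul0mx mulmx0 monom0 mulr1.
move=> g w; rewrite /Th rmorphM al_xi rmorph_monom.
have -> : monom (al g \o th) (w *m q *m B') =
    xi (w *m q *m sg *m M g *m rho) * monom th (w *m q *m Q g *m B').
  rewrite /monom; under eq_bigr do rewrite /= thg expfzMl.
  rewrite big_split /=; congr (_ * _).
    have -> : w *m q *m sg *m M g *m rho =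
        (w *m q *m B') *m (\matrix_a tau g a).
      rewrite -[in LHS](mulmx1 q) -B'B -!mulmxA; congr (_ *m (_ *m (_ *m _))).
      by apply/row_matrixP=> a; rewrite rowK !row_mul /tau /mm !mulmxA.
    rewrite [(w *m q *m B') *m _]mulmx_sum_row (big_morph xi xiD xi0).
    by apply: eq_bigr => a _; rewrite rowK (hom_scale xi0 xiD nz_xi).
  have -> : w *m q *m Q g *m B' = (w *m q *m B') *m (\matrix_a delta_mx 0 (s g a)).
    rewrite -[in LHS](mulmx1 q) -B'B -!mulmxA; congr (_ *m (_ *m (_ *m _))).
    apply/row_matrixP=> a; rewrite rowK mulmxA !row_mul PB -row_mul BB' row1 //.
  by rewrite -/(monom th _) monom_mul //; apply: eq_bigr => a _; rewrite rowK monom_delta.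
rewrite mulrA -xiD; congr (xi _ * monom th _).
  have Ew : w = w *m rho *m j + w *m q *m sg by rewrite -!mulmxA -mulmxDr split_M mulmx1.
  by rewrite [in RHS]Ew !mulmxDl jM.
by rewrite -(mulmxA w) -eqq mulmxA.
Qed.

(** Applying [b] and then [Th] sends the basis of P to functions [eta] permuted by G; the
    factorization of d becomes the last equation. *)
Lemma permuted_units p : p_factorizable p N ->
  exists (r : nat) (s : G -> 'I_r -> 'I_r) (a : 'M[int]_(n, r)) (eta : 'I_r -> E) (d : int),
  [/\ ~~ (p %| d)%Z, forall i, s 1%g i = i /\ forall g h, s (g * h)%g i = s h (s g i),
      forall i, eta i != 0 /\ forall g, al g (eta i) = eta (s g i),
      forall g (v : 'rV_n) i, (v *m N g *m a) 0 (s g i) = (v *m a) 0 i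
    & forall v : 'rV_n, monom eta (v *m a) = xi (v *m d%:M)].
Proof.
case=> m [r [t [M [P [Q [j [q [a [b [d [[pP pQ] ex [eqa eqb] ndp ab]]]]]]]]]]].
have [Th [Th0 ThD nzTh Thj Thg]] := character_lift ex pQ.
have [B [B' [s [BB' B'B PB s1 sM]]]] := perm_latticeP pP.
exists r, s, (a *m B'), (fun i => Th (row i B *m b)), d; split=> //.
- move=> i; split=> // g.
  by rewrite Thg -mulmxA -eqb mulmxA PB.
- move=> g v i.
  have -> : v *m N g *m (a *m B') = (v *m (a *m B')) *m (\matrix_a delta_mx 0 (s g a)).
    rewrite mulmxA -(mulmxA v) eqa -[in LHS](mulmx1 a) -B'B -!mulmxA.
    congr (_ *m (_ *m (_ *m _))).
    by apply/row_matrixP=> c; rewrite rowK mulmxA !row_mul PB -row_mul BB' row1.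
  rewrite mulmx_sum_row summxE (bigD1 i) //= big1 => [|c ne].
    by rewrite addr0 rowK [LHS]mxE [X in _ * X]mxE !eqxx mulr1.
  rewrite rowK [LHS]mxE [X in _ * X]mxE eqxx /=; case: eqP => [Esg|_]; last by rewrite mulr0.
  case/eqP: ne; have := sM g g^-1%g c.
  by rewrite -Esg -sM mulgV !s1.
move=> v.
transitivity (Th (v *m a *m b)); last first.
  by rewrite -mulmxA ab mulmxA -Thj.
have -> : v *m a *m b = (v *m (a *m B')) *m (B *m b).
  by rewrite -!mulmxA (mulmxA B') B'B mul1mx.
rewrite [_ *m (B *m b)]mulmx_sum_row.
rewrite (big_morph Th ThD Th0) /monom; apply: eq_bigr => i _.
by rewrite (hom_scale Th0 ThD nzTh) row_mul.
Qed.

End PermutedUnits.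

(** The generic point, at which the composite with the retraction will be defined. *)
Definition zero_ideal (A : idomainType) : {pred A} := [pred x | x == 0].

Fact zero_ideal_closed (A : idomainType) : idealr_closed (@zero_ideal A).
Proof.
split; rewrite ?inE ?eqxx ?oner_eq0 // => a x y; rewrite !inE => /eqP-> /eqP->.
by rewrite mulr0 addr0.
Qed.
Fact zero_ideal_prime (A : idomainType) : prime_idealr_closed (@zero_ideal A).
Proof. by move=> x y; rewrite !inE mulf_eq0. Qed.
HB.instance Definition _ (A : idomainType) :=
  isIdealr.Build A (@zero_ideal A) (zero_ideal_closed A).
HB.instance Definition _ (A : idomainType) :=
  isPrimeIdealrClosed.Build A (@zero_ideal A) (zero_ideal_prime (A:=A)).

Section PermutedCoordinates.
Variables (k : fieldType) (L : splittingFieldType k).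
Local Notation G := (gal_of {:L}%AS).
Variables (E : fieldType) (al : G -> {rmorphism E -> E}) (cst : {rmorphism L -> E}).
Hypothesis al_cst : forall g c, al g (cst c) = cst (galr g c).
Variables (A : idomainType) (uE : {rmorphism A -> E}).
Hypothesis uE_inj : injective uE.
Hypothesis al_inv : forall z, (forall g, al g z = z) ->
  exists a b : A, b != 0 /\ z = uE a / uE b.
Variables (r : nat) (s : G -> 'I_r -> 'I_r) (eta : 'I_r -> E).
Hypotheses (s1 : forall i, s 1%g i = i) (sM : forall g h i, s (g * h)%g i = s h (s g i)).
Hypothesis al_eta : forall g i, al g (eta i) = eta (s g i).

(** Speiser's theorem for a permutation matrix cocycle: a linear change of coordinates over L turns
    permuted functions into invariant ones, which are fractions of A. This is the open embedding of
    a quasi-trivial torus in an affine space; [c0] is a common denominator. *)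
Lemma permuted_coordinates : exists (C : 'M[L]_r) (c0 : A) (c : 'I_r -> A),
  [/\ c0 != 0, forall g i j, galr g (C i j) = C (s g i) j
    & forall i, uE c0 * eta i = \sum_j cst (C i j) * uE (c j)].
Proof.
pose R g : 'M[L]_r := \matrix_(i, j) (j == s g i)%:R.
have RE (F : fieldType) (h : {rmorphism L -> F}) g m (D : 'M[F]_(r, m)) i j :
    (map_mx h (R g) *m D) i j = D (s g i) j.
  rewrite mxE (bigD1 (s g i)) //= !mxE eqxx rmorph1 mul1r big1 ?addr0 // => l ne.
  by rewrite !mxE (negPf ne) rmorph0 mul0r.
have R1 : R 1%g = 1%:M by apply/matrixP=> i j; rewrite !mxE s1 eq_sym.
have RM g h : R (g * h)%g = map_mx (galr h) (R g) *m R h.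
  by apply/matrixP=> i j; rewrite RE !mxE sM.
have [C Cu CE] := speiser (@galr1 k L) (@galrM k L) (@galr_faithful k L) R1 RM.
have Cg g i j : galr g (C i j) = C (s g i) j.
  have /matrixP/(_ i j) := CE g; rewrite mxE => ->.
  by rewrite -(RE _ idfun) map_mx_id.
pose D := map_mx cst C; have Du : D \in unitmx by rewrite map_unitmx.
pose h : 'cV[E]_r := \col_i eta i; pose w := invmx D *m h.
have hg g : map_mx (al g) h = map_mx cst (R g) *m h.
  by apply/matrixP=> i j; rewrite RE !mxE al_eta.
have Dg g : map_mx (al g) D = map_mx cst (R g) *m D.
  by apply/matrixP=> i j; rewrite RE !mxE al_cst Cg.
have wg g : map_mx (al g) w = w.
  have Dgu : map_mx (al g) D \in unitmx by rewrite map_unitmx.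
  apply: (can_inj (mulKmx Dgu)).
  by rewrite -map_mxM mulKVmx // hg Dg -mulmxA mulKVmx.
have ex j : exists x : A * A, x.2 != 0 /\ w j 0 = uE x.1 / uE x.2.
  have [|a [b ab]] := al_inv (z := w j 0); last by exists (a, b).
  by move=> g; have /matrixP/(_ j 0) := wg g; rewrite mxE.
have [x xP] := choice ex.
exists C, (\prod_j (x j).2), (fun j => (x j).1 * \prod_(l | l != j) (x l).2).
split=> // [|i]; first by apply/prodf_neq0 => j _; case: (xP j).
have -> : eta i = \sum_j cst (C i j) * w j 0.
  have /matrixP/(_ i 0) : h = D *m w by rewrite mulKVmx.
  by rewrite mxE => ->; rewrite mxE; apply: eq_bigr => j _; rewrite mxE.
rewrite mulr_sumr; apply: eq_bigr => j _; rewrite mulrCA; congr (_ * _).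
have [nz ->] := xP j; have nzu : uE (x j).2 != 0.
  by rewrite -(rmorph0 uE) (inj_eq uE_inj).
by rewrite (bigD1 j) //= 2!rmorphM; field.
Qed.

End PermutedCoordinates.

Section CoefficientDescent.
Variables (k : fieldType) (L : splittingFieldType k) (m : nat).
Hypothesis galL : galois 1%AS {:L}%AS.

Lemma map_mpoly_galois (F : {mpoly L[m]}) :
  (forall g, map_mpoly (@galr k L g) F = F) ->
  exists f : {mpoly k[m]}, F = map_mpoly (in_alg L) f.
Proof.
move=> Ffix; have coefP mon : exists c : k, F@_mon = c%:A.
  by apply: galr_fixed => // g; rewrite -mcoeff_map_mpoly Ffix.
have [c cE] := choice coefP.
exists (\sum_(mon <- msupp F) c mon *: 'X_[mon]).
rewrite raddf_sum {1}[F]mpolyE; apply: eq_bigr => mon _.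
by rewrite /= map_mpolyZ map_mpolyX cE.
Qed.

Lemma map_mpoly_inj (K K' : fieldType) (h : {rmorphism K -> K'}) :
  injective (map_mpoly h : {mpoly K[m]} -> {mpoly K'[m]}).
Proof.
move=> f g fg; apply/mpolyP=> mon; apply: (fmorph_inj h).
by rewrite -!mcoeff_map_mpoly fg.
Qed.

End CoefficientDescent.

(** * The retraction through a quasi-trivial torus *)

Section Retraction.
Variables (k : fieldType) (L : splittingFieldType k) (n : nat).
Hypothesis galL : galois 1%AS {:L}%AS.
Local Notation G := (gal_of {:L}%AS).
Variables (N : lattice G n) (X : affvar k) (u : {rmorphism coord X -> lau L n}).
Hypothesis model : torus_model N (coord_str X) u.
Variables (E : fieldType) (cst : {rmorphism L -> E}) (uE : {rmorphism coord X -> E}).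
Hypothesis uE_inj : injective uE.
Hypothesis uE_str : forall c : k, uE (coord_str X c) = cst c%:A.
Variables (f : khom (coord_alg X) (coord_alg X)) (psi : {rmorphism lau L n -> E}).
Hypothesis psi_u : forall b, psi (u b) = uE (f b).
Hypothesis psiC : forall c, psi (lauC n c) = cst c.
Variables (r : nat) (s : G -> 'I_r -> 'I_r) (a : 'M[int]_(n, r)) (eta : 'I_r -> E).
Hypotheses (s1 : forall i, s 1%g i = i) (sM : forall g h i, s (g * h)%g i = s h (s g i)).
Hypothesis a_perm : forall g (v : 'rV_n) i, (v *m N g *m a) 0 (s g i) = (v *m a) 0 i.
Hypothesis nz_eta : forall i, eta i != 0.
Hypothesis psiX : forall v, psi (lx L v) = monom eta (v *m a).
Variables (C : 'M[L]_r) (c0 : coord X) (c : 'I_r -> coord X).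
Hypothesis nz_c0 : c0 != 0.
Hypothesis Cg : forall g i j, galr g (C i j) = C (s g i) j.
Hypothesis etaE : forall i, uE c0 * eta i = \sum_j cst (C i j) * uE (c j).

Local Notation YL := {mpoly L[r.+1]}.
Local Notation W := (ratfun L r.+1).
Local Notation tofrac := (@FracField.tofrac YL).
Local Notation X0 := ('X_ord0 : YL).

Let s_bij g : injective (s g).
Proof. by move=> i j /(congr1 (s g^-1%g)); rewrite -!sM mulgV !s1. Qed.

(* The map on characters is x^v |-> \prod_i y_i^(v a)_i, where the y_i are the
   coordinates of the quasi-trivial torus with character lattice P: they are the
   linear forms C z divided by the extra coordinate z_0, which clears the
   denominators of the functions c_j. *)
Definition ylin i : YL := \sum_j C i j *: 'X_(lift ord0 j).
Definition yden : YL := X0 * \prod_i ylin i.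
Definition gam g : {rmorphism YL -> YL} := map_mpoly (@galr k L g).

Lemma gam_ylin g i : gam g (ylin i) = ylin (s g i).
Proof.
rewrite rmorph_sum; apply: eq_bigr => j _.
by rewrite /= map_mpolyZ map_mpolyX Cg.
Qed.

Lemma gam_X0 g : gam g X0 = X0. Proof. exact: map_mpolyX. Qed.

Lemma gam_yden g : gam g yden = yden.
Proof.
rewrite rmorphM gam_X0 rmorph_prod [in RHS]/yden [in RHS](reindex_inj (@s_bij g)).
by congr (_ * _); apply: eq_bigr => i _; apply: gam_ylin.
Qed.

Definition cvec (l : 'I_r.+1) : coord X := oapp c c0 (unlift ord0 l).

Lemma sigma_exists : exists Sig : {rmorphism YL -> E},
  [/\ forall x, Sig x%:MP = cst x, Sig X0 = uE c0, forall l, Sig 'X_l = uE (cvec l)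
    & forall i, Sig (ylin i) = uE c0 * eta i].
Proof.
have [Sig [SigC SigX]] := mpoly_eval_exists cst (fun l => uE (cvec l)).
exists Sig; split=> // [|i]; first by rewrite SigX /cvec unlift_none.
rewrite rmorph_sum etaE; apply: eq_bigr => j _.
by rewrite -mul_mpolyC rmorphM SigC SigX /cvec liftK.
Qed.

Definition Sig : {rmorphism YL -> E} := projT1 (cid sigma_exists).

Lemma SigC x : Sig x%:MP = cst x.
Proof. by case: (projT2 (cid sigma_exists)). Qed.
Lemma SigX l : Sig 'X_l = uE (cvec l).
Proof. by case: (projT2 (cid sigma_exists)). Qed.
Lemma SigX0 : Sig X0 = uE c0.
Proof. by case: (projT2 (cid sigma_exists)). Qed.
Lemma Sig_ylin i : Sig (ylin i) = uE c0 * eta i.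
Proof. by case: (projT2 (cid sigma_exists)). Qed.

Let nz_uc0 : uE c0 != 0.
Proof. by rewrite -(rmorph0 uE) (inj_eq uE_inj). Qed.

Lemma Sig_yden_neq0 : Sig yden != 0.
Proof.
rewrite rmorphM mulf_neq0 ?SigX0 // rmorph_prod; apply/prodf_neq0 => i _.
by rewrite Sig_ylin mulf_neq0.
Qed.

Let nz_of (p : YL) : Sig p != 0 -> p != 0.
Proof. by apply: contra => /eqP->; rewrite rmorph0. Qed.

Lemma yden_neq0 : yden != 0. Proof. exact/nz_of/Sig_yden_neq0. Qed.
Lemma ylin_neq0 i : ylin i != 0.
Proof. by apply: nz_of; rewrite Sig_ylin mulf_neq0. Qed.
Lemma X0_neq0 : X0 != 0. Proof. by apply: nz_of; rewrite SigX0. Qed.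

Definition yfrac i : W := tofrac (ylin i) / tofrac X0.

Lemma yfrac_neq0 i : yfrac i != 0.
Proof. by rewrite mulf_neq0 ?invr_eq0 ?tofrac_eq0 ?ylin_neq0 ?X0_neq0. Qed.

Lemma monom_yfrac_in v : monom yfrac v \in loc_pred yden.
Proof.
suff: monom yfrac v \in loc_pred yden /\ monom yfrac (- v) \in loc_pred yden by case.
have [l1 _ lM] := loc_closed yden.
have mN w : monom yfrac (- w) = (monom yfrac w)^-1.
  apply: (mulfI (monom_neq0 yfrac_neq0 w)).
  by rewrite -(monomD yfrac_neq0) subrr monom0 mulfV ?monom_neq0 //; apply: yfrac_neq0.
elim/row_int_ind: v => [|i|v w [vin vin'] [win win']].
- by rewrite oppr0 monom0.
- rewrite mN monom_delta /yfrac invfM invrK; split; apply/loc_predP; exists 1%N.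
    exists (ylin i * \prod_j ylin j); rewrite expr1 /yden !rmorphM /=.
    by rewrite mulrA divfK // tofrac_eq0 X0_neq0.
  exists (X0 * X0 * \prod_(j | j != i) ylin j); rewrite expr1 /yden (bigD1 i) //= !rmorphM /=.
  have cancel (F : fieldType) (x y q : F) : y != 0 -> y^-1 * x * (x * (y * q)) = x * x * q.
    by move=> nz; field.
  by apply: cancel; rewrite tofrac_eq0 ylin_neq0.
- by rewrite opprB !(monomD yfrac_neq0); split; apply: lM.
Qed.

Definition yloc v : loc yden := Subring (monom_yfrac_in v).

Lemma yloc0 : yloc 0 = 1. Proof. by apply: val_inj; rewrite /= monom0. Qed.
Lemma ylocD : {morph yloc : v w / v + w >-> v * w}.
Proof. by move=> v w; apply: val_inj; rewrite /= (monomD yfrac_neq0). Qed.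

Lemma pull_exists : exists Pi : {rmorphism lau L n -> loc yden},
  (forall x, Pi (lauC n x) = loc_of yden x%:MP) /\ (forall v, Pi (lx L v) = yloc (v *m a)).
Proof.
apply: (lau_eval ((@loc_of _ yden) \o @mpolyC r.+1 L) (v := fun v => yloc (v *m a))).
  by rewrite mul0mx yloc0.
by move=> v w /=; rewrite mulmxDl ylocD.
Qed.

Definition pull : {rmorphism lau L n -> loc yden} := projT1 (cid pull_exists).
Lemma pullC x : pull (lauC n x) = loc_of yden x%:MP.
Proof. exact: (projT2 (cid pull_exists)).1. Qed.
Lemma pullX v : pull (lx L v) = yloc (v *m a).
Proof. exact: (projT2 (cid pull_exists)).2. Qed.

(** [Sig] is restriction along the morphism s, with scalars extended to L. It sends y_i to eta_i, so
    it carries the pull-back of z to [psi z]; this will be the equation pi o s = f. *)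
Lemma sigma_pull z M p :
  pull z * loc_of yden yden ^+ M = loc_of yden p -> psi z * Sig yden ^+ M = Sig p.
Proof.
have [|SL SLE] := @loc_extend _ yden _ Sig (Sig yden)^-1.
  by rewrite mulfV ?Sig_yden_neq0.
suff SLpull w : SL (pull w) = psi w.
  by move=> /(congr1 SL); rewrite rmorphM rmorphXn !SLE SLpull.
have SLy v : SL (yloc v) = monom eta v.
  apply: (@row_int_hom_eq _ E (SL \o yloc) (monom eta)) => [||v' w'|v' w'|i] /=.
  - by rewrite yloc0 rmorph1.
  - exact: monom0.
  - by rewrite ylocD rmorphM.
  - exact: monomD.
  apply: (mulIf nz_uc0); rewrite -SigX0 -SLE -rmorphM monom_delta SLE SigX0 mulrC.
  rewrite [RHS]mulrC -Sig_ylin -SLE mulrC; congr (SL _); apply: val_inj.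
  by rewrite /= monom_delta divfK // tofrac_eq0 X0_neq0.
apply: (lau_hom_eq (f := SL \o pull) (g := psi)) => [x|l] /=.
  by rewrite pullC SLE SigC psiC.
by rewrite pullX SLy psiX.
Qed.

(** The pull-back commutes with G because [a] is equivariant and G permutes the y_i. Its restriction
    to k[T] is thus defined over k. *)
Lemma gam_pull g z M p : pull z * loc_of yden yden ^+ M = loc_of yden p ->
  pull (lact N g z) * loc_of yden yden ^+ M = loc_of yden (gam g p).
Proof.
have gamI : injective (tofrac \o gam g : {rmorphism YL -> W}).
  move=> p1 p2 /= /eqP; rewrite tofrac_eq => /eqP.
  exact: map_mpoly_inj.
have [gW gWE] := fraction_extend gamI.
suff gpull w : gW (val (pull w)) = val (pull (lact N g w)).
  have gD : gW (tofrac yden) = tofrac yden.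
    by rewrite gWE; congr tofrac; apply: gam_yden.
  move=> /(congr1 val); rewrite /= rmorphXn /= => Ep; apply: val_inj.
  rewrite /= rmorphXn /= -gpull.
  have -> : tofrac (map_mpoly (@galr k L g) p) = gW (tofrac p) by rewrite gWE.
  by rewrite -Ep (rmorphM gW) (rmorphXn gW) gD.
pose vl : {rmorphism loc yden -> W} := @subring_val _ _ (loc_closed yden).
apply: (lau_hom_eq (f := gW \o (vl \o pull)) (g := vl \o (pull \o lact N g))) => [x|l] /=.
  by rewrite lactC !pullC /= gWE /= map_mpolyC.
rewrite lactX !pullX /= rmorph_monom /monom.
rewrite [RHS](reindex_inj (@s_bij g)) /=; apply: eq_bigr => i _.
by rewrite a_perm /= /yfrac fmorph_div !gWE /= -/(gam g) gam_ylin gam_X0.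
Qed.

Lemma retraction_exists :
  exists (sm : khom (coord_alg (affspace k r.+1)) (coord_alg X))
         (pi : ratmap (affspace k r.+1) X), comp_defined pi sm /\ comp_eq pi sm f.
Proof.
pose io : {rmorphism {mpoly k[r.+1]} -> YL} := map_mpoly (in_alg L).
have ioI : injective io := @map_mpoly_inj _ _ _ (in_alg L).
have [sm0 [sm0C sm0X]] := mpoly_eval_exists (coord_str X) cvec.
pose sm : khom (coord_alg (affspace k r.+1)) (coord_alg X) := 
  @KHom k (coord_alg (affspace k r.+1)) (coord_alg X) sm0 sm0C.
have uEsm p : uE (sm0 p) = Sig (io p).
  apply: (mpoly_hom_eq (f := uE \o sm0) (g := Sig \o io)) => [x|l] /=.
    by rewrite sm0C uE_str map_mpolyC SigC.
  by rewrite sm0X map_mpolyX SigX.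
have [D0 D0E] : exists D0, yden = io D0 by apply: map_mpoly_galois => // g; apply: gam_yden.
have nz_sD0 : sm0 D0 != 0.
  by rewrite -(inj_eq uE_inj) rmorph0 uEsm -D0E Sig_yden_neq0.
have nz_D0 : D0 != 0 by apply: contra nz_sD0 => /eqP->; rewrite rmorph0.
(* For b in k[T] the numerator over a power of the invariant [yden] is G-invariant, hence has
   coefficients in k. *)
have pullP b : exists x : nat * {mpoly k[r.+1]},
    pull (u b) * loc_of yden yden ^+ x.1 = loc_of yden (io x.2).
  have [M [F EF]] := locP (pull (u b)).
  have [|F0 F0E] := @map_mpoly_galois _ _ _ galL F; last by exists (M, F0); rewrite EF F0E.
  move=> g; have := gam_pull g EF; rewrite (lact_model model) EF => /(congr1 val)/eqP.
  by rewrite /= tofrac_eq => /eqP.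
have [x xP] := choice pullP.
have ioFI : injective (tofrac \o io : {rmorphism {mpoly k[r.+1]} -> W}).
  by move=> p1 p2 /= /eqP; rewrite tofrac_eq => /eqP/ioI.
have [ioF ioFE] := fraction_extend ioFI.
pose pi0 b : {fraction {mpoly k[r.+1]}} :=
  FracField.tofrac (x b).2 / FracField.tofrac D0 ^+ (x b).1.
have pi0E b : ioF (pi0 b) = val (pull (u b)).
  have nzM : tofrac yden ^+ (x b).1 != 0 by rewrite expf_neq0 // tofrac_eq0 yden_neq0.
  apply: (mulIf nzM); have /(congr1 val) := xP b; rewrite /= rmorphXn /= => ->.
  by rewrite /pi0 fmorph_div rmorphXn !ioFE /= -D0E divfK.
have [pi1 pi1E] : exists pi1 : {rmorphism coord X -> {fraction {mpoly k[r.+1]}}}, pi1 =1 pi0.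
  apply: rmorphism_of_fun => [b1 b2|b1 b2|]; apply: (fmorph_inj ioF).
  - by rewrite (rmorphB ioF) !pi0E (rmorphB u) (rmorphB pull).
  - by rewrite [RHS](rmorphM ioF) !pi0E (rmorphM u) (rmorphM pull).
  - by rewrite pi0E (rmorph1 u) (rmorph1 pull) (rmorph1 ioF).
have pi1C x0 : pi1 (coord_str X x0) = FracField.tofrac (x0%:MP_[r.+1]).
  apply: (fmorph_inj ioF); rewrite pi1E pi0E ioFE /= map_mpolyC.
  by case: (model) => -> _ _; rewrite pullC.
exists sm, (@KHom k (coord_alg X) (funfield (affspace k r.+1)) pi1 pi1C); split.
  exists (@zero_ideal (coord X)) => b; exists (x b).2, (D0 ^+ (x b).1); split.
    by rewrite !inE rmorphXn expf_neq0.
  by rewrite /= pi1E /pi0 rmorphXn.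
move=> b U V nz_sV /=; rewrite pi1E /pi0 => EUV.
have nz_V : V != 0 by apply: contra nz_sV => /eqP->; rewrite rmorph0.
have cross : (x b).2 * V = U * D0 ^+ (x b).1.
  apply/eqP; rewrite -tofrac_eq !rmorphM rmorphXn /=; apply/eqP.
  apply: (mulIf (x := (FracField.tofrac V)^-1)); first by rewrite invr_eq0 tofrac_eq0.
  rewrite mulfK ?tofrac_eq0 // mulrAC -EUV divfK //.
  by rewrite expf_neq0 // tofrac_eq0.
have fD : f b * sm0 D0 ^+ (x b).1 = sm0 (x b).2.
  apply: uE_inj; rewrite rmorphM rmorphXn !uEsm -D0E -psi_u.
  exact: sigma_pull.
apply: (mulIf (x := FracField.tofrac (sm0 V))); first by rewrite tofrac_eq0.
rewrite divfK ?tofrac_eq0 // -rmorphM; congr (FracField.tofrac _).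
apply: (mulIf (expf_neq0 (x b).1 nz_sD0)); rewrite mulrAC fD.
by rewrite -rmorphM cross rmorphM rmorphXn.
Qed.

End Retraction.

Lemma factorizable_retract_rational (k : fieldType) (L : splittingFieldType k) n
    (N : lattice (gal_of {:L}%AS) n) (X : affvar k)
    (u : {rmorphism coord X -> lau L n}) p :
  galois 1%AS {:L}%AS -> torus_model N (coord_str X) u -> prime p ->
  p_factorizable p N -> p_retract_rational p X.
Proof.
move=> galL model p_pr pN.
have [r [s [a [eta [d [ndp s1M etaP a_perm monE]]]]]] :=
  permuted_units (@ract1 k L n N) (@ractM k L n N) (@ract_faithful k L n N)
    (xm0 L n) (@xmD L n) (@xm_neq0 L n) (ract_xm N) pN.
have s1 i := (s1M i).1; have sM g h i := (s1M i).2 g h.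
have nz_eta i := (etaP i).1; have al_eta g i := (etaP i).2 g.
have nz_d : d != 0 by apply: contra ndp => /eqP->; rewrite dvdz0.
pose vl : {rmorphism lau L n -> ratfun L n} := @subring_val _ _ (loc_closed (lauD L n)).
pose cst : {rmorphism L -> ratfun L n} := vl \o @lauC L n.
have al_cst g c : ract N g (cst c) = cst (galr g c) by apply: ract_C.
have [C [c0 [c [nz_c0 Cg etaE]]]] := permuted_coordinates al_cst (uE_inj model)
  (ract_invariant model) s1 sM al_eta.
have uE_str c' : uE u (coord_str X c') = cst c'%:A.
  by case: (model) => uC _ _; rewrite /uE /cst /= uC.
have psi_u b : (vl \o phi L n d) (u b) = uE u (mult_hom model d b).
  by rewrite /uE /= multE.
have psiC x : (vl \o phi L n d) (lauC n x) = cst x by rewrite /= phiC.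
have psiX v : (vl \o phi L n d) (lx L v) = monom eta (v *m a).
  by rewrite monE /= phiX.
have [sm [pi def_eq]] := retraction_exists galL model (uE_inj model) uE_str
  psi_u psiC s1 sM a_perm nz_eta psiX nz_c0 Cg etaE.
exists r.+1, X, (mult_hom model d); split.
- exact: mult_finite.
- exact: mult_dominant.
- exists (`|d| ^ n)%N; split; first exact: mult_degree.
  by rewrite Euclid_dvdX // negb_and; apply/orP; left; apply: ndp.
- by exists sm, pi.
Qed.

(** * Factorial domains *)


Section Divisibility.
Variable R : idomainType.
Implicit Types (x y q : R) (s t : seq R).

Definition divides x y : Prop := exists z, y = x * z.

Definition prime_elt q : Prop :=
  [/\ q != 0, ~ divides q 1 & forall x y, divides q (x * y) -> divides q x \/ divides q y].

(** Dividing a product of primes, rather than being a unit times one, leaves units out of the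
    definition; [prime_factors] gives the usual form. *)
Definition factorial_domain : Prop := forall x, x != 0 ->
  exists s, {in s, forall q, prime_elt q} /\ divides x (\prod_(q <- s) q).

Lemma divides_mulr x y z : divides x y -> divides x (y * z).
Proof. by case=> w ->; exists (w * z); rewrite mulrA. Qed.

Lemma divides_trans x y z : divides x y -> divides y z -> divides x z.
Proof. by move=> xy [w ->]; apply: divides_mulr. Qed.

Lemma prime_divides_prod q s : prime_elt q -> divides q (\prod_(p <- s) p) ->
  exists2 p, p \in s & divides q p.
Proof.
case=> _ q1 qM; elim: s => [|p s IHs]; rewrite ?big_nil ?big_cons // => /qM[qp|/IHs[p' sp' qp']].
  by exists p; rewrite ?mem_head.
by exists p'; rewrite // inE sp' orbT.
Qed.

Lemma prime_divides_prime q p : prime_elt q -> prime_elt p -> divides q p -> divides p q.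
Proof.
move=> [_ q1 _] [nz_p _ pM] [z pE]; have [||[w wE]] := pM q z; first by exists 1; rewrite mulr1.
  by [].
case: q1; exists w; apply: (mulfI nz_p); rewrite mulr1 {1}pE wE; ring.
Qed.

Lemma prime_factors s x : {in s, forall q, prime_elt q} -> divides x (\prod_(q <- s) q) ->
  exists e t, [/\ divides e 1, {subset t <= s} & x = e * \prod_(q <- t) q].
Proof.
elim: s x => [|q s IHs] x sP.
  by rewrite big_nil => x1; exists x, [::]; rewrite big_nil mulr1.
have [nz_q _ qM] := sP q (mem_head q s).
have sP' : {in s, forall q, prime_elt q} by move=> q' sq'; apply: sP; rewrite inE sq' orbT.
rewrite big_cons => -[y Exy].
have [[x' Ex]|[y' Ey]] : divides q x \/ divides q y.
  by apply: qM; rewrite -Exy; apply: divides_mulr; exists 1; rewrite mulr1.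
  have [|e [t [e1 ts Ex']]] := IHs x' sP'.
    by exists y; apply: (mulfI nz_q); rewrite Exy Ex mulrA.
  exists e, (q :: t); split=> //; last by rewrite big_cons Ex Ex'; ring.
  by move=> z; rewrite !inE => /orP[->//|/ts->]; rewrite orbT.
have [|e [t [e1 ts Ex]]] := IHs x sP'.
  by exists y'; apply: (mulfI nz_q); rewrite Exy Ey; ring.
by exists e, t; split=> // z /ts zs; rewrite inE zs orbT.
Qed.

End Divisibility.

Section Isomorphism.
Variables (R S : idomainType) (h : {rmorphism R -> S}) (h' : {rmorphism S -> R}).
Hypotheses (hK : cancel h h') (h'K : cancel h' h).

Lemma iso_divides x y : divides x y -> divides (h x) (h y).
Proof. by case=> z ->; exists (h z); rewrite rmorphM. Qed.

End Isomorphism.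

Section IsomorphismPrimes.
Variables (R S : idomainType) (h : {rmorphism R -> S}) (h' : {rmorphism S -> R}).
Hypotheses (hK : cancel h h') (h'K : cancel h' h).

Lemma iso_prime q : prime_elt q -> prime_elt (h q).
Proof.
case=> nz_q q1 qM; split.
- by rewrite -(rmorph0 h) (inj_eq (can_inj hK)).
- by move=> /(iso_divides h'); rewrite hK rmorph1.
move=> x y /(iso_divides h'); rewrite hK rmorphM.
by case/qM=> /(iso_divides h); rewrite h'K => ?; [left | right].
Qed.

Lemma iso_factorial : factorial_domain R -> factorial_domain S.
Proof.
move=> ufd x nz_x; have [|s [sP xs]] := ufd (h' x).
  by rewrite -(rmorph0 h') (inj_eq (can_inj h'K)).
exists (map h s); split=> [q /mapP[p sp ->]|]; first exact/iso_prime/sP.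
by have := iso_divides h xs; rewrite h'K rmorph_prod big_map.
Qed.

End IsomorphismPrimes.

(** * Gauss's lemma for polynomials over a factorial domain *)

Section Gauss.
Variable R : idomainType.
Hypothesis ufd : factorial_domain R.
Implicit Types (f g h : {poly R}) (q c : R).

Lemma polyC_divides q f : divides q%:P f <-> forall i, divides q f`_i.
Proof.
split=> [[g ->] i|qf]; first by exists g`_i; rewrite coefCM.
have [c cE] := choice qf; exists (\poly_(i < size f) c i).
apply/polyP=> i; rewrite coefCM coef_poly; case: ltnP => [_|lef]; first exact: cE.
by rewrite mulr0 nth_default.
Qed.

Lemma divides_add q (x y : R) : divides q x -> divides q (x + y) -> divides q y.
Proof. by case=> z -> [w E]; exists (w - z); rewrite mulrBr -E addrC addKr. Qed.

Lemma divides_sum (I : finType) (P : pred I) q (F : I -> R) :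
  (forall i, P i -> divides q (F i)) -> divides q (\sum_(i | P i) F i).
Proof.
move=> qF; apply: big_ind => // [|x y [z ->] [w ->]]; first by exists 0; rewrite mulr0.
by exists (z + w); rewrite mulrDr.
Qed.

(** If q divides neither f nor g, take in each the first coefficient not divisible by q; the product
    of these two is the only term of a coefficient of f g not known to be divisible by q. *)
Lemma prime_polyC q : prime_elt q -> prime_elt q%:P.
Proof.
case=> nz_q q1 qM; split; first by rewrite polyC_eq0.
  by move/polyC_divides/(_ 0); rewrite coef1 eqxx.
have first f : ~ divides q%:P f ->
    exists i, ~ divides q f`_i /\ forall j, (j < i)%N -> divides q f`_j.
  move=> nqf; have ex : exists i, `[< ~ divides q f`_i >].
    apply: contrapT => /forallNP nex; apply/nqf/polyC_divides => i.
    by apply: contrapT => ni; case: (nex i); apply/asboolP.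
  exists (ex_minn ex); case: ex_minnP => i /asboolP ni imin; split=> // j ltji.
  apply: contrapT => nj; have := imin j; rewrite leqNgt ltji => /(_ _)/negP; apply=> //.
  exact/asboolP.
move=> f g /polyC_divides qfg; apply: contrapT => /not_orP[/first[i [nfi fi]] /first[j [ngj gj]]].
have := qfg (i + j)%N; rewrite coefM.
have lti : (i < (i + j).+1)%N by rewrite ltnS leq_addr.
rewrite (bigD1 (Ordinal lti)) //= addrC addKn => qS.
have : divides q (f`_i * g`_j).
  apply: divides_add qS; apply: divides_sum => l nel.
  have [ltl|] := ltnP l i; first exact/divides_mulr/fi.
  rewrite leq_eqVlt => /orP[/eqP eil|ltil].
    by case/eqP: nel; apply: val_inj; apply/esym.
  rewrite mulrC; apply/divides_mulr/gj; have := ltn_ord l; lia.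
by case/qM.
Qed.

Definition primitive_poly f : Prop := forall q, prime_elt q -> ~ divides q%:P f.

(** A prime dividing f divides its leading coefficient, hence is associate to some member of [s].
    Each extraction shortens [s]. *)
Lemma primitive_part f : f != 0 -> exists c g, f = c%:P * g /\ primitive_poly g.
Proof.
move=> nz_f; have [|s [sP lead_s]] := ufd (x := lead_coef f); first by rewrite lead_coef_eq0.
have [N leN] := ubnP (size s); elim: N => // N IHN in f s sP lead_s nz_f leN *.
have [fP|] := EM (primitive_poly f); first by exists 1, f; rewrite mul1r.
move=> /existsNP[q /not_implyP[qP /contrapT[g Ef]]].
have [nz_q _ _] := qP.
have nz_g : g != 0 by apply: contra nz_f => /eqP E; rewrite Ef E mulr0.
have lead_f : lead_coef f = q * lead_coef g by rewrite Ef lead_coefM lead_coefC.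
have [|p sp qp] := prime_divides_prod (s := s) qP.
  by apply: divides_trans lead_s; exists (lead_coef g).
have [z Eq] := prime_divides_prime qP (sP p sp) qp.
have [nz_p _ _] := sP p sp; have sE := perm_to_rem sp.
have ltN : (size (rem p s) < N)%N.
  by move: leN; rewrite (perm_size sE).
have [|||c [g' [Eg g'P]]] := IHN g (rem p s) _ _ _ ltN.
- by move=> x /mem_rem; apply: sP.
- case: lead_s => y; rewrite (perm_big _ sE) big_cons lead_f Eq => Ey.
  by exists (z * y); apply: (mulfI nz_p); rewrite Ey; ring.
- exact: nz_g.
by exists (q * c), g'; split=> //; rewrite Ef Eg polyCM mulrA.
Qed.

(** The primes of c are cancelled one at a time: each divides h g but not the primitive h, hence
    divides g. *)
Lemma primitive_cancel h f g c : primitive_poly h -> c != 0 ->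
  c%:P * f = h * g -> divides h f.
Proof.
move=> hP nz_c Ecf; have [s [sP [y Es]]] := ufd nz_c.
have : (\prod_(q <- s) q)%:P * f = h * (y%:P * g).
  by rewrite Es polyCM mulrAC Ecf; ring.
move: (y%:P * g) => {Ecf}g; elim: s sP {Es} g => [|q s IHs] sP g.
  by rewrite big_nil mul1r; exists g.
have qP := sP q (mem_head q s); have [nz_q _ _] := qP.
have sP' : {in s, forall q, prime_elt q} by move=> q' sq'; apply: sP; rewrite inE sq' orbT.
rewrite big_cons polyCM -mulrA => Eq; have [_ _ qM] := prime_polyC qP.
have [/(hP _ qP)//|[g' Eg]] := qM h g (ex_intro _ _ (esym Eq)).
apply: (IHs sP' g'); have nz_qP : q%:P != 0 by rewrite polyC_eq0.
by apply: (mulfI nz_qP); rewrite Eq Eg; ring.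
Qed.

Lemma dvdp_divides h f : divides h f -> h %| f.
Proof. by case=> g ->; apply: dvdp_mulIl. Qed.

(** Over a domain [%|] is divisibility up to a non-zero constant, that is, over the fraction field;
    primitivity removes the constant. *)
Lemma primitive_divides h f : primitive_poly h -> h %| f -> divides h f.
Proof.
move=> hP /Pdiv.WeakIdomain.dvdpP[[c g] /= nz_c Ef].
by apply: (primitive_cancel hP nz_c (g := g)); rewrite mul_polyC Ef mulrC.
Qed.

Lemma prime_poly h : irreducible_poly h -> primitive_poly h -> prime_elt h.
Proof.
move=> [h1 hI] hP; have nz_h : h != 0 by rewrite -size_poly_gt0 ltnW.
split=> // [/dvdp_divides|f g /dvdp_divides hfg].
  by rewrite dvdp1 => /eqP E; rewrite E in h1.
have [cop|ncop] := boolP (coprimep h f).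
  by right; apply: primitive_divides => //; rewrite -(Gauss_dvdpr _ cop).
left; apply: primitive_divides => //; rewrite coprimep_def in ncop.
by have /eqp_dvdl <- := hI _ ncop (dvdp_gcdl h f); apply: dvdp_gcdr.
Qed.

Lemma irreducible_factor f : (1 < size f)%N -> exists h, irreducible_poly h /\ h %| f.
Proof.
have [N leN] := ubnP (size f); elim: N => // N IHN in f leN * => f1.
have [fI|] := EM (irreducible_poly f); first by exists f; rewrite dvdpp.
move=> /not_andP[]// /existsNP[g /not_implyP[g1 /not_implyP[gf ngf]]].
have nz_f : f != 0 by rewrite -size_poly_gt0 ltnW.
have nz_g : g != 0 by apply: contraNneq nz_f => g0; rewrite -dvd0p -g0.
have ltgf : (size g < size f)%N.
  rewrite ltn_neqAle dvdp_leq // andbT; apply/negP=> Es.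
  by apply: ngf; rewrite -dvdp_size_eqp.
have [||h [hI hg]] := IHN g; first exact: leq_trans ltgf _.
  by rewrite ltn_neqAle eq_sym g1 size_poly_gt0.
by exists h; split=> //; apply: dvdp_trans gf.
Qed.

Lemma poly_factorial : factorial_domain {poly R}.
Proof.
move=> f; have [N leN] := ubnP (size f); elim: N => // N IHN in f leN * => nz_f.
have [f1|f1] := leqP (size f) 1.
  have [|s [sP [y Es]]] := ufd (x := f`_0).
    by rewrite -polyC_eq0 -size1_polyC.
  exists (map polyC s); split=> [q /mapP[p sp ->]|]; first exact/prime_polyC/sP.
  by exists y%:P; rewrite big_map -(rmorph_prod polyC) /= Es polyCM -size1_polyC.
have [h [hI hf]] := irreducible_factor f1.
have nz_h := irredp_neq0 hI.
have [c [g [Eh gP]]] := primitive_part nz_h.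
have nz_c : c != 0 by apply: contra nz_h => /eqP c0; rewrite Eh c0 mul0r.
have gh : g %= h by rewrite Eh mul_polyC eqp_sym eqp_scale.
have gI : irreducible_poly g.
  case: hI => h1 hI; split=> [|p p1 pg]; first by rewrite (eqp_size gh).
  by apply: eqp_trans (hI p p1 _) _; rewrite 1?eqp_sym // -(eqp_dvdr p gh).
have [f' Ef] : divides g f by apply: primitive_divides => //; rewrite (eqp_dvdl _ gh).
have nz_g := irredp_neq0 gI.
have nz_f' : f' != 0 by apply: contra nz_f => /eqP E; rewrite Ef E mulr0.
have [|s [sP [y Es]]] := IHN f' _ nz_f'.
  move: leN; rewrite Ef size_mul //; case: gI => g1 _; have := nz_f'.
  by rewrite -size_poly_gt0; lia.
exists (g :: s); split=> [q|]; last by exists y; rewrite big_cons Es Ef mulrA.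
by rewrite inE => /orP[/eqP->|/sP//]; apply: prime_poly.
Qed.

End Gauss.

Section MpolyFactorial.
Variable K : fieldType.

Lemma mpoly_unitC m (p q : {mpoly K[m]}) : p * q = 1 -> exists2 c, c != 0 & p = c%:MP.
Proof.
move=> pq; have := mpoly_intro_unit (n := m) (R := K) (p := p) (q := q).
rewrite mulrC => /(_ pq) /andP[/eqP pE]; rewrite unitfE => nz.
by exists p@_0.
Qed.

Lemma mpoly0_factorial : factorial_domain {mpoly K[0]}.
Proof.
move=> f nz_f; exists [::]; split=> //.
have fE : f = (f@_0)%:MP.
  apply/mpolyP=> m; rewrite mcoeffC (_ : m = 0%MM) ?eqxx ?mulr1 //.
  by apply/mnmP=> -[].
have nz : f@_0 != 0 by apply: contra nz_f => /eqP E; rewrite fE E mpolyC0.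
by exists ((f@_0)^-1)%:MP; rewrite big_nil {1}fE -mpolyCM mulfV.
Qed.

Lemma mpolyS_iso m : exists (h : {rmorphism {mpoly K[m.+1]} -> {poly {mpoly K[m]}}})
  (h' : {rmorphism {poly {mpoly K[m]}} -> {mpoly K[m.+1]}}), cancel h h' /\ cancel h' h.
Proof.
pose v (l : 'I_m.+1) : {poly {mpoly K[m]}} :=
  if unlift ord_max l is Some l' then ('X_l')%:P else 'X.
have [h [hC hX]] := mpoly_eval_exists (polyC \o @mpolyC m K) v.
have [w [wC wX]] := mpoly_eval_exists (@mpolyC m.+1 K) (fun l => 'X_(lift ord_max l)).
have comm : commr_rmorph w 'X_ord_max by move=> x; apply: mulrC.
pose h' : {rmorphism {poly {mpoly K[m]}} -> {mpoly K[m.+1]}} := horner_morph comm.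
have h'C c : h' c%:P = w c by apply: horner_morphC.
have h'X : h' 'X = 'X_ord_max by apply: horner_morphX.
exists h, h'; split.
  apply: (mpoly_hom_eq (f := h' \o h) (g := idfun)) => [c|l] /=.
    by rewrite hC /= h'C wC.
  rewrite hX /v; case: unliftP => [l' ->|->]; last exact: h'X.
  by rewrite h'C wX.
have hw c : h (w c) = c%:P.
  apply: (mpoly_hom_eq (f := h \o w) (g := polyC)) => [c'|l] /=.
    by rewrite wC hC.
  by rewrite wX hX /v liftK.
elim/poly_ind => [|p c IHp]; first by rewrite !rmorph0.
by rewrite rmorphD rmorphM h'X h'C rmorphD rmorphM IHp hw hX /v unlift_none.
Qed.

Lemma mpoly_factorial m : factorial_domain {mpoly K[m]}.
Proof.
elim: m => [|m IHm]; first exact: mpoly0_factorial.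
have [h [h' [hK h'K]]] := mpolyS_iso m.
exact: (iso_factorial h'K hK (poly_factorial IHm)).
Qed.

End MpolyFactorial.

Section SubringDomain.
Variables (F : fieldType) (S : {pred F}) (S_sub : subring_closed S).
Local Notation T := (subring S_sub).

(** Factoriality is stated for integral domains, so the localization needs units: elements whose
    inverse in the field stays in the subring. *)
Definition subring_unit : {pred T} :=
  [pred x : T | (val x != 0) && ((val x)^-1 \in subring_pred S_sub)].
Definition subring_inv (x : T) : T := insubd x (val x)^-1.

Fact subring_mulVx : {in subring_unit, left_inverse 1 subring_inv *%R}.
Proof.
by move=> x /andP[nz inS]; apply: val_inj; rewrite /= val_insubd inS mulVf.
Qed.
Fact subring_unitPl (x y : T) : y * x = 1 -> subring_unit x.
Proof.
move=> /(congr1 val) /= yx; have nz : val x != 0.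
  by apply: contra_eq_neq yx => ->; rewrite mulr0 eq_sym oner_neq0.
apply/andP; split=> //; suff -> : (val x)^-1 = val y by apply: valP.
by apply: (mulIf nz); rewrite mulVf.
Qed.
Fact subring_inv_out : {in [predC subring_unit], subring_inv =1 id}.
Proof.
move=> x; rewrite !inE negb_and negbK => /orP[/eqP x0|/negPf out]; apply: val_inj.
  by rewrite val_insubd x0 invr0; case: ifP.
by rewrite val_insubd out.
Qed.
HB.instance Definition _ := GRing.ComNzRing_hasMulInverse.Build T
  subring_mulVx subring_unitPl subring_inv_out.

Fact subring_integral : GRing.integral_domain_axiom T.
Proof.
move=> x y /(congr1 val) /= /eqP; rewrite mulf_eq0.
by rewrite -!(inj_eq val_inj) /=.
Qed.
HB.instance Definition _ := GRing.ComUnitRing_isIntegral.Build T subring_integral.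

End SubringDomain.

(** * Factoriality and units of the Laurent ring *)

Section LocalizationFactorial.
Variables (A : idomainType) (D : A).
Hypothesis nz_D : D != 0.
Hypothesis ufd : factorial_domain A.
Local Notation lof := (loc_of D).

Lemma loc_of_inj : injective lof.
Proof. by move=> a b /(congr1 val)/eqP; rewrite /= tofrac_eq => /eqP. Qed.

Lemma prime_divides_exp q (x : A) N : prime_elt q -> divides q (x ^+ N) -> divides q x.
Proof.
case=> _ q1 qM; elim: N => [|N IHN]; first by rewrite expr0 => /q1.
by rewrite exprS => /qM[].
Qed.

Lemma loc_of_divides q z N a : prime_elt q -> z * lof D ^+ N = lof a ->
  divides q a -> divides (lof q) z.
Proof.
move=> qP Ea [c Ec]; have [w Dw] := loc_inv nz_D; exists (lof c * w ^+ N).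
rewrite mulrA -rmorphM -Ec /= -Ea -mulrA -exprMn Dw.
by rewrite expr1n mulr1.
Qed.

Lemma prime_loc q : prime_elt q -> ~ divides q D -> prime_elt (lof q).
Proof.
move=> qP qD; have [nz_q q1 qM] := qP; split.
- by rewrite -(rmorph0 lof) (inj_eq loc_of_inj).
- move=> [z Ez]; have [N [c Ec]] := locP z.
  apply: qD; apply: (prime_divides_exp (N := N) qP); exists c; apply: loc_of_inj.
  by rewrite rmorphXn rmorphM /= -Ec mulrA -Ez mul1r.
move=> x y [z Ez].
have [N1 [a Ea]] := locP x; have [N2 [b Eb]] := locP y; have [N3 [c Ec]] := locP z.
have : divides q (a * (b * D ^+ N3)).
  exists (c * D ^+ (N1 + N2)); apply: loc_of_inj.
  rewrite !rmorphM !rmorphXn /= -Ea -Eb -Ec exprD.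
  transitivity (x * y * (lof D ^+ N1 * lof D ^+ N2 * lof D ^+ N3)); first by ring.
  by rewrite Ez; ring.
case/qM=> [/(loc_of_divides qP Ea)|/qM[/(loc_of_divides qP Eb)|/(prime_divides_exp qP)]] //.
  by left.
by right.
Qed.

(** Primes dividing D become units and are dropped; the others remain prime. *)
Lemma loc_factorial : factorial_domain (loc D).
Proof.
move=> z nz_z; have [N [f Ef]] := locP z.
have nz_f : f != 0.
  apply: contra nz_z => /eqP f0; have [w Dw] := loc_inv nz_D.
  have : z * lof D ^+ N * w ^+ N = 0 by rewrite Ef f0 rmorph0 mul0r.
  by rewrite -mulrA -exprMn Dw expr1n mulr1 => ->.
have [s [sP fs]] := ufd nz_f.
suff [t [tP st]] : exists t, {in t, forall q, prime_elt q} /\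
    divides (\prod_(q <- s) lof q) (\prod_(q <- t) q).
  exists t; split=> //; apply: divides_trans st; case: fs => y Es.
  exists (lof D ^+ N * lof y); have := congr1 lof Es; rewrite rmorph_prod rmorphM /= => ->.
  by rewrite mulrA Ef.
elim: s {fs} sP => [|q s IHs] sP.
  by exists [::]; split=> //; exists 1; rewrite !big_nil mulr1.
have sP' : {in s, forall q, prime_elt q} by move=> q' sq'; apply: sP; rewrite inE sq' orbT.
have [t [tP [y Et]]] := IHs sP'.
have [[c qD]|nqD] := EM (divides q D).
  exists t; split=> //; have [w Dw] := loc_inv nz_D; exists (lof c * w * y).
  rewrite big_cons Et; transitivity (lof D * w * (\prod_(q <- s) lof q * y)).
    by rewrite Dw mul1r.
  have -> : lof D = lof q * lof c by rewrite -rmorphM /= -qD.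
  by ring.
exists (lof q :: t); split=> [q'|]; last by exists y; rewrite !big_cons Et mulrA.
rewrite inE => /orP[/eqP->|/tP//]; apply: prime_loc nqD.
exact: sP (mem_head q s).
Qed.

End LocalizationFactorial.

Lemma lau_factorial (K : fieldType) n : factorial_domain (lau K n).
Proof. by have := @loc_factorial _ _ (lauD_neq0 K n) (@mpoly_factorial K n); apply. Qed.

(** The multiples of X_l are the kernel of the substitution X_l = 0, an endomorphism of a domain. *)
Lemma mpolyX_prime (K : fieldType) n (l : 'I_n) : prime_elt ('X_l : {mpoly K[n]}).
Proof.
have [h [hC hX]] := mpoly_eval_exists (@mpolyC n K)
  (fun j => if j == l then 0 else 'X_j : {mpoly K[n]}).
have hXm m : h 'X_[m] = if m l == 0 then 'X_[m] else 0.
  rewrite [in LHS]mpolyXE_id rmorph_prod; case: ifPn => ml.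
    rewrite [RHS]mpolyXE_id; apply: eq_bigr => j _; rewrite rmorphXn /= hX.
    by have [->|//] := eqVneq j l; rewrite (eqP ml) !expr0.
  by rewrite (bigD1 l) //= rmorphXn /= hX eqxx expr0n (negPf ml) mul0r.
have hP f : divides 'X_l f <-> h f = 0.
  split=> [[g ->]|hf0]; first by rewrite rmorphM /= hX eqxx mul0r.
  have : divides 'X_l (f - h f).
    rewrite [f]mpolyE rmorph_sum -sumrB; apply: big_ind => [|x y [z ->] [w ->]|m _].
    - by exists 0; rewrite mulr0.
    - by exists (z + w); rewrite mulrDr.
    rewrite -mul_mpolyC rmorphM /= hC hXm -mulrBr; case: ifPn => ml.
      by exists 0; rewrite subrr !mulr0.
    exists ((f@_m)%:MP * 'X_[m - U_(l)]); rewrite subr0 mulrCA -mpolyXD.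
    congr (_ * 'X_[_]); apply/mnmP=> j; rewrite mnmDE mnmBE mnm1E.
    by case: eqVneq => [<-|_] /=; lia.
  by rewrite hf0 subr0.
split=> [||f g].
- by rewrite -msupp_eq0 msuppX.
- by move/hP/eqP; rewrite rmorph1 oner_eq0.
move/hP/eqP; rewrite rmorphM mulf_eq0.
by case/orP=> /eqP ?; [left | right]; apply/hP.
Qed.

(** The numerator f of a unit divides a power of X_1 ... X_n, hence is a constant times a product of
    variables. *)
Lemma lau_unit_monomial (K : fieldType) n (z : lau K n) : divides z 1 ->
  exists c v, c != 0 /\ z = lauC n c * lx K v.
Proof.
case=> w zw; have [N [f Ef]] := locP z; have [M [g Eg]] := locP w.
pose Xs := [seq 'X_l | l <- enum 'I_n] : seq {mpoly K[n]}.
pose s k := flatten (nseq k Xs).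
have sP k : {in s k, forall q, prime_elt q}.
  by move=> q /flattenP[t /nseqP[-> _] /mapP[l _ ->]]; apply: mpolyX_prime.
have sE k : \prod_(q <- s k) q = lauD K n ^+ k.
  elim: k => [|k IHk]; first by rewrite big_nil.
  by rewrite /s /= big_cat -/(s k) IHk exprS big_map big_enum.
have [|e [t [e1 ts fE]]] := prime_factors (x := f) (sP (N + M)%N).
  exists g; rewrite sE; apply: (@loc_of_inj _ (lauD K n)).
  rewrite rmorphXn rmorphM /= -Ef -Eg exprD mulrACA -zw mul1r.
  by [].
case: e1 => e' /esym/mpoly_unitC[c nz_c eC].
have [v vE] : exists v, loc_of (lauD K n) (\prod_(q <- t) q) = lx K v.
  elim: t ts {fE} => [|q t IHt] ts; first by exists 0; rewrite big_nil lx0 rmorph1.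
  have [|v vE] := IHt; first by move=> x tx; apply: ts; rewrite inE tx orbT.
  have /flattenP[t' /nseqP[-> _] /mapP[l _ ql]] := ts q (mem_head q t).
  by exists (delta_mx 0 l + v); rewrite big_cons rmorphM /= vE lxD lx_delta ql.
exists c, (v - const_mx N%:Z); split=> //.
have -> : z = z * loc_of (lauD K n) (lauD K n) ^+ N * lx K (- const_mx N%:Z).
  by rewrite lauD_exp -mulrA lx_unit mulr1.
by rewrite Ef fE eC rmorphM /= vE lxD mulrA.
Qed.

Section PrimeSystems.
Variables (R : idomainType).

Definition associate (x y : R) : Prop := divides x y /\ divides y x.

Lemma associate_sym x y : associate x y -> associate y x.
Proof. by case. Qed.

Lemma associate_trans x y z : associate x y -> associate y z -> associate x z.
Proof.
by case=> xy yx [yz zy]; split; [apply: divides_trans yz | apply: divides_trans yx].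
Qed.

(** [choose] depends only on the extension of its predicate, so that associates get the same
    representative. *)
Definition canonical_associate (x : R) : R := choose (fun y => `[< associate x y >]) x.

Lemma canonical_associateP x : associate x (canonical_associate x).
Proof.
apply/asboolP; apply: (chooseP (P := fun y => `[< associate x y >])).
by apply/asboolP; split; exists 1; rewrite mulr1.
Qed.

Lemma canonical_associate_eq x y : associate x y ->
  canonical_associate x = canonical_associate y.
Proof.
move=> xy; have xx : associate x x by split; exists 1; rewrite mulr1.
have PQ : (fun z => `[< associate x z >]) =1 (fun z => `[< associate y z >]).
  move=> z; apply/asbool_equiv_eq; split; last exact: associate_trans.
  exact/associate_trans/associate_sym.
rewrite /canonical_associate (eq_choose PQ); apply: choose_id; apply/asboolP.
  exact: associate_sym.
exact: associate_trans (associate_sym xy) xy.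
Qed.

Lemma associate_unit x y : x != 0 -> associate x y -> exists2 e, divides e 1 & x = e * y.
Proof.
move=> nz_x [[e Ey] [f Ex]]; exists f; last by rewrite mulrC.
by exists e; apply: (mulfI nz_x); rewrite mulr1 {1}Ex Ey; ring.
Qed.

Lemma prime_associate x y : prime_elt x -> associate x y -> prime_elt y.
Proof.
move=> [nz_x x1 xM] [xy yx]; split.
- by apply: contra nz_x => /eqP y0; case: yx => z ->; rewrite y0 mul0r.
- by move=> y1; apply: x1; apply: divides_trans y1.
by move=> a b /(divides_trans xy)/xM[]/(divides_trans yx) ?; [left | right].
Qed.

Variables (G : finGroupType) (be : G -> {rmorphism R -> R}).
Hypothesis be1 : forall x, be 1%g x = x.
Hypothesis beM : forall g h x, be (g * h)%g x = be h (be g x).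
Hypothesis ufd : factorial_domain R.

Lemma be_associate g x y : associate x y -> associate (be g x) (be g y).
Proof. by case=> xy yx; split; apply: iso_divides. Qed.

Lemma be_prime g q : prime_elt q -> prime_elt (be g q).
Proof.
have K h : cancel (be h) (be h^-1%g) by move=> x; rewrite -beM mulgV be1.
by move=> qP; apply: (iso_prime (K g) _ qP) => x; rewrite -beM mulVg be1.
Qed.

(** All conjugates of the prime factors of [xs], one from each class of associates, form a finite
    set permuted by G up to units. The last clause later makes the norms of these primes
    non-zero. *)
Lemma prime_system (xs : seq R) : {in xs, forall x, x != 0} ->
  exists r (w : 'I_r -> R) (s : G -> 'I_r -> 'I_r),
  [/\ (forall i, prime_elt (w i)) /\ (forall i j, divides (w i) (w j) -> i = j),
      (forall i, s 1%g i = i) /\ (forall g h i, s (g * h)%g i = s h (s g i)),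
      forall g i, exists2 e, divides e 1 & be g (w i) = e * w (s g i)
    & (forall x, x \in xs -> exists e m, divides e 1 /\ x = e * \prod_i w i ^+ m i) /\
      forall i, exists2 x, x \in xs & exists g, divides (w i) (be g x)].
Proof.
move=> nz_xs.
have ex x : exists t, x \in xs -> {in t, forall q, prime_elt q} /\
    exists2 e, divides e 1 & x = e * \prod_(q <- t) q.
  have [xxs|] := boolP (x \in xs); last by exists [::].
  have [t [tP /(prime_factors tP)[e [t' [e1 t't xE]]]]] := ufd (nz_xs x xxs).
  exists t' => _; split; last by exists e.
  by move=> q /t't; apply: tP.
have [f fP] := choice ex.
pose s0 := flatten (map f xs).
have s0P : {in s0, forall q, prime_elt q}.
  by move=> q /flattenP[t /mapP[x xxs ->] xq]; apply: (fP x xxs).1.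
pose cn := canonical_associate.
pose ps := undup [seq cn (be g q) | g <- enum G, q <- s0].
have psP q : q \in ps -> exists g q0, q0 \in s0 /\ q = cn (be g q0).
  by rewrite mem_undup => /allpairsP[[g q0] /= [_ sq0 ->]]; exists g, q0.
have ps_mem g q0 : q0 \in s0 -> cn (be g q0) \in ps.
  move=> sq0; rewrite mem_undup; apply/allpairsP; exists (g, q0); split=> //.
  by rewrite mem_enum.
have psg g q : q \in ps -> cn (be g q) \in ps.
  move=> /psP[h [q0 [sq0 ->]]].
  have -> : cn (be g (cn (be h q0))) = cn (be (h * g)%g q0).
    apply: canonical_associate_eq; rewrite beM; apply: be_associate.
    exact/associate_sym/canonical_associateP.
  exact: ps_mem.
have psprime q : q \in ps -> prime_elt q.
  move=> /psP[h [q0 [sq0 ->]]]; apply: prime_associate (canonical_associateP _).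
  exact/be_prime/s0P.
have ps_cn q : q \in ps -> cn q = q.
  by move=> /psP[h [q0 [sq0 ->]]]; apply/canonical_associate_eq/associate_sym/canonical_associateP.
pose w (i : 'I_(size ps)) := nth 0 ps i.
have wps i : w i \in ps by apply: mem_nth.
have w_inj i j : w i = w j -> i = j.
  by move=> /eqP; rewrite nth_uniq ?undup_uniq // => /eqP/val_inj.
have lt g i : (index (cn (be g (w i))) ps < size ps)%N by rewrite index_mem psg.
pose s g i := Ordinal (lt g i).
have ws g i : w (s g i) = cn (be g (w i)) by rewrite /w nth_index ?psg.
exists (size ps), w, s; split.
- split=> [i|i j wij]; first exact/psprime.
  apply: w_inj; rewrite -(ps_cn _ (wps i)) -(ps_cn _ (wps j)).
  by apply: canonical_associate_eq; split=> //; apply: prime_divides_prime => //; apply: psprime.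
- split=> [i|g h i]; apply: w_inj; first by rewrite ws be1 ps_cn.
  rewrite !ws beM; apply/canonical_associate_eq/be_associate.
  exact: canonical_associateP.
- move=> g i; rewrite ws; apply: associate_unit; last exact: canonical_associateP.
  by case: (be_prime g (psprime _ (wps i))).
split=> [x xxs|i]; last first.
  have [g [q [sq wE]]] := psP _ (wps i).
  have /flattenP[t /mapP[x xxs ->] xq] := sq; exists x => //; exists g.
  have [_ [e _ xE]] := fP x xxs; rewrite wE.
  have [_ /divides_trans] := canonical_associateP (be g q); apply.
  apply: iso_divides; rewrite xE mulrC; apply: divides_mulr.
  by exists (\prod_(y <- rem q (f x)) y); rewrite (perm_big _ (perm_to_rem xq)) big_cons.
have [_ [e e1]] := fP x xxs; have : {subset f x <= s0}.
  by move=> q fq; apply/flattenP; exists (f x) => //; apply: map_f.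
move: (f x) => t ts ->.
suff [e' [m [e'1 ->]]] : exists e' m, divides e' 1 /\ \prod_(q <- t) q = e' * \prod_i w i ^+ m i.
  exists (e * e'), m; rewrite mulrA; split=> //.
  by case: e1 e'1 => y Ey [y' Ey']; exists (y * y'); rewrite mulrACA -Ey -Ey' mulr1.
elim: t {e1} ts => [|q t IHt] ts.
  exists 1, (fun=> 0%N); split; first by exists 1; rewrite mulr1.
  by rewrite big_nil mul1r big1.
have [|e' [m [[y' e'1] Et]]] := IHt; first by move=> q' tq'; apply: ts; rewrite inE tq' orbT.
have sq := ts q (mem_head q t).
have [nz_q _ _] := s0P q sq.
have [e2 [y2 e21]] := associate_unit nz_q (canonical_associateP q); rewrite -/(cn q) => Eq.
have cps : cn q \in ps by have := ps_mem 1%g q sq; rewrite be1.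
have lti : (index (cn q) ps < size ps)%N by rewrite index_mem.
have wi : w (Ordinal lti) = cn q by rewrite /w nth_index.
exists (e2 * e'), (fun j => (j == Ordinal lti) + m j)%N; split.
  by exists (y2 * y'); rewrite mulrACA -e21 -e'1 mulr1.
under [in RHS]eq_bigr do rewrite exprD.
rewrite big_split /= (bigD1 (Ordinal lti)) //= eqxx expr1 [X in _ * (_ * X * _)]big1.
  by rewrite big_cons Et {1}Eq wi mulr1; ring.
by move=> j /negPf->; rewrite expr0.
Qed.

End PrimeSystems.

Section Exponents.
Variables (R : idomainType) (E : fieldType) (h : {rmorphism R -> E}).
Hypothesis h_inj : injective h.
Variables (r : nat) (w : 'I_r -> R).
Hypothesis wP : forall i, prime_elt (w i).
Hypothesis w_assoc : forall i j, divides (w i) (w j) -> i = j.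

Lemma prime_image_neq0 i : h (w i) != 0.
Proof. by case: (wP i) => nz _ _; rewrite -(rmorph0 h) (inj_eq h_inj). Qed.

Lemma divides_monomial i (m : 'I_r -> nat) : divides (w i) (\prod_j w j ^+ m j) ->
  (0 < m i)%N.
Proof.
have -> : \prod_j w j ^+ m j = \prod_(x <- [seq w j ^+ m j | j <- enum 'I_r]) x.
  by rewrite big_map big_enum.
move/(prime_divides_prod (wP i)) => [x /mapP[j _ ->]] ij.
have Eij : i = j := w_assoc (prime_divides_exp (wP i) ij).
rewrite -Eij in ij; clear j Eij.
rewrite lt0n; apply: contraPneq ij => ->; rewrite expr0.
by case: (wP i).
Qed.

Lemma monomial_divides i (m : 'I_r -> nat) : (0 < m i)%N ->
  divides (w i) (\prod_j w j ^+ m j).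
Proof.
case mi : (m i) => [//|k] _; rewrite (bigD1 i) //= mi exprS -mulrA.
by apply: divides_mulr; exists 1; rewrite mulr1.
Qed.

(** With negative exponents moved to the other side, a prime with non-zero exponent would divide a
    product in which its exponent is 0. *)
Lemma prime_exponents e c : divides e 1 -> h e * monom (h \o w) c = 1 -> c = 0.
Proof.
move=> [e' ee'] ec1.
pose pos i := if 0 <= c 0 i then absz (c 0 i) else 0%N.
pose neg i := if 0 <= c 0 i then 0%N else absz (c 0 i).
have E1 : e * \prod_i w i ^+ pos i = \prod_i w i ^+ neg i.
  apply: h_inj; rewrite rmorphM !rmorph_prod /=.
  have -> : \prod_i h (w i ^+ neg i) =
      h e * monom (h \o w) c * \prod_i h (w i ^+ neg i) by rewrite ec1 mul1r.
  rewrite -mulrA -big_split; congr (_ * _); apply: eq_bigr => i _ /=.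
  rewrite !rmorphXn /pos /neg; case: ifP => ci.
    by rewrite expr0 mulr1 -{2}(gez0_abs ci).
  have -> : c 0 i = - (absz (c 0 i))%:Z by lia.
  rewrite -exprnN abszN /= mulVf ?expr0 // expf_neq0 //; exact: prime_image_neq0.
apply/rowP=> i; rewrite mxE; apply/eqP; apply: contraT => ci.
have [ci0|/negPf ci0] := boolP (0 <= c 0 i).
  have : divides (w i) (\prod_i w i ^+ neg i).
    rewrite -E1 mulrC; apply/divides_mulr/monomial_divides.
    by rewrite /pos ci0 absz_gt0.
  by move/divides_monomial; rewrite /neg ci0.
have : divides (w i) (\prod_i w i ^+ pos i).
  have -> : \prod_i w i ^+ pos i = (\prod_i w i ^+ neg i) * e'.
    by rewrite -E1 mulrAC -ee' mul1r.
  apply/divides_mulr/monomial_divides.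
  by rewrite /neg ci0 absz_gt0.
by move/divides_monomial; rewrite /pos ci0.
Qed.

End Exponents.

(** * A factorization from a p-retraction *)


Lemma monomM (F : fieldType) r (x y : 'I_r -> F) c :
  monom (fun i => x i * y i) c = monom x c * monom y c.
Proof. by rewrite -big_split; apply: eq_bigr => i _; rewrite expfzMl. Qed.

Lemma hom_mul (F : fieldType) m r (Th : 'rV[int]_r -> F) (A : 'M[int]_(m, r)) v :
  Th 0 = 1 -> {morph Th : v w / v + w >-> v * w} -> (forall w, Th w != 0) ->
  Th (v *m A) = monom (fun i => Th (row i A)) v.
Proof.
move=> Th0 ThD nzTh; rewrite mulmx_sum_row (big_morph Th ThD Th0).
by apply: eq_bigr => i _; rewrite hom_scale.
Qed.

Section FactorizationFromUnits.
Variables (L E : fieldType) (G : finGroupType).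
Variables (al : G -> {rmorphism E -> E}) (si : G -> {rmorphism L -> L}).
Variable cst : {rmorphism L -> E}.
Hypothesis al_cst : forall g c, al g (cst c) = cst (si g c).

(* Equality modulo constants: E^* / L^* is the module in which all lattices live. *)
Definition eqc (x y : E) : Prop := exists2 c, c != 0 & x = cst c * y.

Lemma eqc_refl x : eqc x x.
Proof. by exists 1; rewrite ?oner_neq0 // rmorph1 mul1r. Qed.

Lemma eqc_sym x y : eqc x y -> eqc y x.
Proof.
case=> c nz ->; exists c^-1; rewrite ?invr_eq0 //.
by rewrite mulrA -rmorphM mulVf // rmorph1 mul1r.
Qed.

Lemma eqc_trans x y z : eqc x y -> eqc y z -> eqc x z.
Proof.
by case=> c nz -> [c' nz' ->]; exists (c * c'); rewrite ?mulf_neq0 // rmorphM mulrA.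
Qed.

Lemma eqcM x x' y y' : eqc x x' -> eqc y y' -> eqc (x * y) (x' * y').
Proof.
case=> c nz -> [c' nz' ->]; exists (c * c'); rewrite ?mulf_neq0 //.
by rewrite rmorphM mulrACA.
Qed.

Lemma eqc_al g x y : eqc x y -> eqc (al g x) (al g y).
Proof.
by case=> c nz ->; exists (si g c); rewrite ?fmorph_eq0 // rmorphM al_cst.
Qed.

Lemma eqc_monom r (x y : 'I_r -> E) c : (forall i, eqc (x i) (y i)) ->
  eqc (monom x c) (monom y c).
Proof.
move=> xy; have ex i : exists e, e != 0 /\ x i = cst e * y i.
  by have [e nz E0] := xy i; exists e.
have [e eP] := choice ex; exists (monom e c).
  by apply: monom_neq0 => i; case: (eP i).
rewrite rmorph_monom -monomM; apply: eq_bigr => i _.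
by case: (eP i) => _ ->.
Qed.

Variables (n : nat) (N : lattice G n) (xi : 'rV[int]_n -> E).
Hypotheses (xi0 : xi 0 = 1) (xiD : {morph xi : v w / v + w >-> v * w}).
Hypotheses (nz_xi : forall v, xi v != 0) (al_xi : forall g v, al g (xi v) = xi (v *m N g)).
Variables (t : nat) (w : 'I_t -> E) (s2 : G -> 'I_t -> 'I_t) (tau : G -> 'I_t -> 'rV[int]_n).
Hypothesis nz_w : forall i, w i != 0.
Hypotheses (s21 : forall i, s2 1%g i = i)
  (s2M : forall g h i, s2 (g * h)%g i = s2 h (s2 g i)).
Hypothesis al_w : forall g i, eqc (al g (w i)) (xi (tau g i) * w (s2 g i)).
Hypothesis indep : forall v c, eqc (xi v * monom w c) 1 -> v = 0 /\ c = 0.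
Variables (r : nat) (s : G -> 'I_r -> 'I_r) (nu : 'I_r -> E).
Hypotheses (s1 : forall i, s 1%g i = i) (sM : forall g h i, s (g * h)%g i = s h (s g i)).
Hypothesis nu_expand : forall i, exists v c, eqc (nu i) (xi v * monom w c).
Hypothesis al_nu : forall g i, eqc (al g (nu i)) (nu (s g i)).
Variables (a : 'M[int]_(n, r)) (d : int) (p : nat).
Hypothesis a_equiv : forall g, N g *m a = a *m perm_act s g.
Hypothesis nu_a : forall v : 'rV_n, eqc (monom nu (v *m a)) (xi (v *m d%:M)).
Hypothesis ndp : ~~ (p %| d)%Z.
Hypothesis al1 : forall x, al 1%g x = x.
Hypothesis alM : forall g h x, al (g * h)%g x = al h (al g x).

(** This embeds M = Z^n + Z^t in E^* / L^* as the subgroup generated by the characters and the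
    [w i]. *)
Definition mon (y : 'rV[int]_(n + t)) : E := xi (lsubmx y) * monom w (rsubmx y).

Lemma mon0 : mon 0 = 1.
Proof. by rewrite /mon !linear0 xi0 monom0 mulr1. Qed.

Lemma monD : {morph mon : x y / x + y >-> x * y}.
Proof. by move=> x y; rewrite /mon !linearD /= xiD monomD // mulrACA. Qed.

Lemma mon_neq0 y : mon y != 0.
Proof. by rewrite mulf_neq0 // monom_neq0. Qed.

Lemma mon_inj x y : eqc (mon x) (mon y) -> x = y.
Proof.
case=> c nz xy; have : eqc (mon (x - y)) 1.
  exists c => //; apply: (mulIf (mon_neq0 y)).
  by rewrite -monD subrK xy mulr1.
move/indep=> [l0 r0]; apply/eqP; rewrite -subr_eq0 -[x - y]hsubmxK l0 r0.
by rewrite row_mx0.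
Qed.

Definition unit_act g : 'M[int]_(n + t) :=
  block_mx (N g) 0 (\matrix_i tau g i) (perm_act s2 g).

Lemma al_mon g y : eqc (al g (mon y)) (mon (y *m unit_act g)).
Proof.
rewrite -{2}[y]hsubmxK mul_row_block mulmx0 add0r /mon row_mxKl row_mxKr.
rewrite rmorphM al_xi xiD -mulrA; apply: eqcM; first exact: eqc_refl.
rewrite rmorph_monom (hom_mul _ _ xi0 xiD nz_xi).
rewrite (hom_mul _ _ (monom0 w) (monomD nz_w) (monom_neq0 nz_w)) -monomM.
apply: eqc_monom => i /=; rewrite !rowK monom_delta.
exact: al_w.
Qed.

(** [mon] is injective modulo constants, so [unit_act] inherits the laws of an action from [al]. *)
Fact unit_act1 : unit_act 1%g = 1%:M.
Proof.
apply/row_matrixP=> i; rewrite row1 rowE; apply: mon_inj; apply: eqc_sym.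
by rewrite -[X in eqc X]al1; apply: al_mon.
Qed.

Fact unit_actM g h : unit_act (g * h)%g = unit_act g *m unit_act h.
Proof.
apply/row_matrixP=> i; rewrite !rowE mulmxA; apply: mon_inj.
apply: eqc_trans (eqc_sym (al_mon _ _)) _; rewrite alM.
exact: eqc_trans (eqc_al h (al_mon g _)) (al_mon h _).
Qed.

Definition unit_lattice : lattice G (n + t) := Lattice unit_act1 unit_actM.

Lemma factorizable_of_units : p_factorizable p N.
Proof.
have ex i : exists y, eqc (nu i) (mon y).
  by have [v [c nuE]] := nu_expand i; exists (row_mx v c); rewrite /mon row_mxKl row_mxKr.
have [y yE] := choice ex; pose b : 'M[int]_(r, n + t) := \matrix_i y i.
pose P := perm_lattice s1 sM; pose Q := perm_lattice s21 s2M.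
exists (n + t)%N, r, t, unit_lattice, P, Q, (row_mx 1%:M 0), (col_mx 0 1%:M), a, b, d.
split=> //; first by split; apply: perm_latticeE.
- split.
  + split=> g.
      by rewrite /= mul_row_block mul_mx_row !mul1mx mulmx1 mulmx0 !mul0mx !addr0.
    by rewrite /= mul_block_col mul_col_mx !mulmx1 !mulmx0 !mul0mx !add0r mul1mx.
  + by move=> v; rewrite mul_mx_row mulmx1 => /(congr1 lsubmx); rewrite row_mxKl linear0.
  + move=> v; rewrite -{1}[v]hsubmxK mul_row_col mulmx0 mulmx1 add0r.
    split=> [v0|[v' ->]]; last by rewrite mul_mx_row mulmx0 row_mxKr.
    by exists (lsubmx v); rewrite mul_mx_row mulmx1 mulmx0 -v0 hsubmxK.
  by move=> v; exists (row_mx 0 v); rewrite mul_row_col mulmx0 mulmx1 add0r.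
- split=> g; first exact: a_equiv.
  apply/row_matrixP=> i; rewrite !row_mul !rowK -rowE rowK; apply: mon_inj.
  apply: eqc_trans (eqc_sym (yE _)) _; apply: eqc_trans (eqc_sym (al_nu _ _)) _.
  exact: eqc_trans (eqc_al g (yE i)) (al_mon g _).
apply/row_matrixP=> i; rewrite !rowE; apply: mon_inj.
have -> : mon (delta_mx 0 i *m (d%:M *m row_mx 1%:M 0)) = xi (delta_mx 0 i *m d%:M).
  rewrite mulmxA mul_mx_row mulmx1 mulmx0 /mon row_mxKl row_mxKr.
  by rewrite monom0 mulr1.
rewrite mulmxA (hom_mul _ _ mon0 monD mon_neq0).
apply: eqc_trans (nu_a _); apply: eqc_monom => l.
by rewrite rowK; apply: eqc_sym.
Qed.

End FactorizationFromUnits.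

(** * Multiplication matrices and norms from k(X') *)

Section RegularRepresentation.
Variables (k : fieldType) (X X' : affvar k) (f : khom (coord_alg X) (coord_alg X')) (d : nat).
Hypothesis f_dom : dominant f.
Hypothesis f_deg : morphism_degree f d.
Local Notation K := {fraction coord X}.
Local Notation K' := {fraction coord X'}.

(** The matrices of multiplication on k(X') in a basis over k(X); row vectors and commutativity of
    the field make this a ring homomorphism. *)
Lemma regular_representation : exists R : {rmorphism K' -> 'M[K]_d},
  forall a : coord X, R (FracField.tofrac (f a)) = (FracField.tofrac a)%:M.
Proof.
have fI : injective (@FracField.tofrac (coord X') \o kfun f : {rmorphism coord X -> K'}).
  by move=> a b /= /eqP; rewrite tofrac_eq => /eqP/f_dom.
have [fF fFE] := fraction_extend fI.
have base z : in_base_funfield f z <-> exists x, z = fF x.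
  split=> [[a [b [_ ->]]]|[x ->]].
    by exists (FracField.tofrac a / FracField.tofrac b); rewrite fmorph_div !fFE.
  have [a [b [nz_b ->]]] := fraction_ratio x.
  by exists a, b; rewrite fmorph_div !fFE.
have [e eP] := f_deg.
pose comb (c : 'rV[K]_d) := \sum_l fF (c 0 l) * e l.
have span z : exists c, z = comb c.
  have [c [[cb ->] _]] := eP z.
  have [x xE] := choice (fun l => (base _).1 (cb l)).
  by exists (\row_l x l); apply: eq_bigr => l _; rewrite mxE xE.
have free : injective comb.
  move=> c c' cc'; have [c0 [_ uniq]] := eP (comb c).
  have E1 : c0 = [ffun l => fF (c 0 l)].
    apply: uniq; split=> [l|]; first by apply/base; rewrite ffunE; exists (c 0 l).
    by apply: eq_bigr => l _; rewrite ffunE.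
  have E2 : c0 = [ffun l => fF (c' 0 l)].
    apply: uniq; split=> [l|]; first by apply/base; rewrite ffunE; exists (c' 0 l).
    by rewrite cc'; apply: eq_bigr => l _; rewrite ffunE.
  apply/rowP=> l; apply: (fmorph_inj fF).
  by move: E2; rewrite E1 => /ffunP/(_ l); rewrite !ffunE.
have combD c c' : comb (c + c') = comb c + comb c'.
  by rewrite -big_split; apply: eq_bigr => l _; rewrite mxE rmorphD mulrDl.
have combZ x c : comb (x *: c) = fF x * comb c.
  by rewrite mulr_sumr; apply: eq_bigr => l _; rewrite mxE rmorphM mulrA.
have comb_mul c (M : 'M[K]_d) : comb (c *m M) = \sum_i fF (c 0 i) * comb (row i M).
  rewrite mulmx_sum_row (big_morph comb combD (_ : comb 0 = 0)).
    by apply: eq_bigr => i _; rewrite combZ.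
  by rewrite /comb big1 // => l _; rewrite mxE rmorph0 mul0r.
have [crd crdE] := choice span.
pose R0 z : 'M[K]_d := \matrix_i crd (z * e i).
have R0E z c : comb (c *m R0 z) = z * comb c.
  rewrite comb_mul mulr_sumr; apply: eq_bigr => i _.
  by rewrite rowK -crdE; ring.
have R0_uniq z M : (forall c, comb (c *m M) = z * comb c) -> R0 z = M.
  by move=> ME; apply/row_matrixP=> i; rewrite !rowE; apply: free; rewrite R0E ME.
have [|||R RE] := @rmorphism_of_fun _ _ R0.
- move=> x y; apply: R0_uniq => c.
  by rewrite mulmxBr -scaleN1r combD combZ rmorphN1 !R0E; ring.
- move=> x y; apply: R0_uniq => c.
  by rewrite mulmxA !R0E; ring.
- by apply: R0_uniq => c; rewrite mulmx1 mul1r.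
exists R => a; rewrite RE; apply: R0_uniq => c.
by rewrite mul_mx_scalar combZ fFE.
Qed.

End RegularRepresentation.

Section TwistedNorm.
Variables (k : fieldType) (L : splittingFieldType k) (n : nat).
Local Notation G := (gal_of {:L}%AS).
Variables (E : fieldType) (al : G -> {rmorphism E -> E}) (cst : {rmorphism L -> E}).
Hypothesis al_cst : forall g c, al g (cst c) = cst (galr g c).
Variables (X X' : affvar k) (f : khom (coord_alg X) (coord_alg X')).
Variables (uF : {rmorphism {fraction coord X} -> E}).
Hypothesis uF_str : forall c : k, uF (FracField.tofrac (coord_str X c)) = cst c%:A.
Hypothesis al_uF : forall g x, al g (uF x) = uF x.
Variables (d m : nat).
Variable R : {rmorphism {fraction coord X'} -> 'M[{fraction coord X}]_d.+1}.
Hypothesis R_base : forall a, R (FracField.tofrac (f a)) = (FracField.tofrac a)%:M.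
Variable s : khom (coord_alg (affspace k m)) (coord_alg X').

(* Multiplication by the function b on k(X') in a basis over k(X).  The map S
   below extends b = s^* q from polynomials over k to polynomials over L. *)
Definition reg (b : coord X') : 'M[E]_d.+1 := map_mx uF (R (FracField.tofrac b)).

Lemma regM a b : reg (a * b) = reg a *m reg b.
Proof. by rewrite /reg rmorphM /= rmorphM map_mxM. Qed.

Lemma reg_unit b : b != 0 -> reg b \in unitmx.
Proof.
move=> nz_b; rewrite map_unitmx.
have : R (FracField.tofrac b) *m R (FracField.tofrac b)^-1 = 1%:M.
  by rewrite -[_ *m _]rmorphM mulfV ?rmorph1 // tofrac_eq0.
by move/mulmx1_unit => [Ru _]; exact: Ru.
Qed.

(** X' may cease to be integral over L, so restriction along s is extended to polynomials over L at
    the level of matrices rather than fields. *)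
Lemma scalar_extension : exists S : {rmorphism {mpoly L[m]} -> 'M[E]_d.+1},
  [/\ forall c, S c%:MP = (cst c)%:M,
      forall q : {mpoly k[m]}, S (map_mpoly (in_alg L) q) = reg (s q)
    & forall g q, map_mx (al g) (S q) = S (map_mpoly (@galr k L g) q)].
Proof.
pose cs : {rmorphism L -> 'M[E]_d.+1} := (@scalar_mx E d.+1) \o cst.
pose h (l : 'I_m) : 'M[E]_d.+1 := reg (s 'X_l).
pose rg : {rmorphism coord X' -> 'M[E]_d.+1} :=
  map_mx uF \o (R \o @FracField.tofrac (coord X')).
have hX mo : mmap1 h mo = reg (s 'X_[mo]).
  rewrite /mmap1 mpolyXE_id (rmorph_prod s) -[RHS]/(rg _) rmorph_prod.
  by apply: eq_bigr => l _; rewrite (rmorphXn s) (rmorphXn rg).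
pose S0 : {mpoly L[m]} -> 'M[E]_d.+1 := mmap cs h.
have S0X c mo : S0 (c *: 'X_[mo]) = cst c *: reg (s 'X_[mo]).
  by rewrite /S0 mmapZ mmapX hX -[LHS]/(cs c *m _) /cs /= mul_scalar_mx.
have S0sum (I : Type) (r : seq I) (P : pred I) F :
    S0 (\sum_(i <- r | P i) F i) = \sum_(i <- r | P i) S0 (F i).
  exact: (raddf_sum (mmap cs h)).
have S0B p q : S0 (p - q) = S0 p - S0 q by apply: (raddfB (mmap cs h)).
have S0C c : S0 c%:MP = (cst c)%:M by apply: mmapC.
(* The target is not commutative, so multiplicativity is checked on monomials: scalar matrices are
   central and [reg] is multiplicative. *)
have S0M p q : S0 (p * q) = S0 p *m S0 q.
  rewrite [p]mpolyE [q]mpolyE mulr_suml !S0sum mulmx_suml; apply: eq_bigr => m1 _.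
  rewrite mulr_sumr S0sum mulmx_sumr; apply: eq_bigr => m2 _.
  rewrite -scalerAl -scalerAr scalerA -mpolyXD !S0X mpolyXD (rmorphM s) regM.
  by rewrite -scalemxAl -scalemxAr scalerA rmorphM.
have [|S SE] := rmorphism_of_fun S0B S0M; first by rewrite -mpolyC1 S0C rmorph1.
exists S; split=> [c|q|g q]; first by rewrite SE.
- have := mpoly_hom_eq (f := S \o map_mpoly (in_alg L)) (g := rg \o s) => /(_ _ _ q) /= E0.
  apply: E0 => [c|l] /=.
    rewrite map_mpolyC SE S0C; have -> : s c%:MP = f (coord_str X c).
      by rewrite (khomP f); apply: (khomP s).
    by rewrite R_base map_scalar_mx uF_str.
  by rewrite map_mpolyX SE -['X_l]scale1r S0X rmorph1 scale1r.
apply: (mpoly_hom_eq (f := map_mx (al g) \o S) (g := S \o map_mpoly (@galr k L g)))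
  => [c|l] /=.
  by rewrite map_mpolyC !SE !S0C map_scalar_mx al_cst.
rewrite map_mpolyX !SE -['X_l]scale1r !S0X rmorph1 scale1r.
by apply/matrixP=> i j; rewrite !mxE al_uF.
Qed.

End TwistedNorm.

Section Pullback.
Variables (k : fieldType) (L : splittingFieldType k) (n : nat).
Hypothesis galL : galois 1%AS {:L}%AS.
Local Notation G := (gal_of {:L}%AS).
Variables (N : lattice G n) (X X' : affvar k) (u : {rmorphism coord X -> lau L n}).
Hypothesis model : torus_model N (coord_str X) u.
Variables (f : khom (coord_alg X) (coord_alg X')) (m : nat).
Variables (s : khom (coord_alg (affspace k m)) (coord_alg X')) (pi : ratmap (affspace k m) X).
Hypotheses (pi_def : comp_defined pi s) (pi_eq : comp_eq pi s f).
Local Notation Y := {mpoly L[m]}.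
Local Notation W := (ratfun L m).
Local Notation tofrac := (@FracField.tofrac Y).
Local Notation io := (map_mpoly (in_alg L) : {mpoly k[m]} -> Y).

Definition cstW : {rmorphism L -> W} := tofrac \o @mpolyC m L.

Lemma base_frac_exists : exists ioF : {rmorphism {fraction {mpoly k[m]}} -> W},
  forall q, ioF (FracField.tofrac q) = tofrac (io q).
Proof.
have I : injective (tofrac \o (map_mpoly (in_alg L)) : {rmorphism {mpoly k[m]} -> W}).
  by move=> p q /= /eqP; rewrite tofrac_eq => /eqP/map_mpoly_inj.
exact: fraction_extend I.
Qed.

Lemma gal_frac_exists g : exists h : {rmorphism W -> W},
  forall q, h (tofrac q) = tofrac (map_mpoly (@galr k L g) q).
Proof.
have I : injective (tofrac \o (map_mpoly (@galr k L g)) : {rmorphism Y -> W}).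
  by move=> p q /= /eqP; rewrite tofrac_eq => /eqP/map_mpoly_inj.
exact: fraction_extend I.
Qed.

Lemma torus_pull : exists (ioF : {rmorphism {fraction {mpoly k[m]}} -> W})
    (Pi : {rmorphism lau L n -> W}) (gW : G -> {rmorphism W -> W}),
  [/\ forall q, ioF (FracField.tofrac q) = tofrac (io q),
      forall c, Pi (lauC n c) = cstW c, forall a, Pi (u a) = ioF (pi a),
      forall g q, gW g (tofrac q) = tofrac (map_mpoly (@galr k L g) q)
    & forall g z, gW g (Pi z) = Pi (lact N g z)].
Proof.
have [ioF ioFE] := base_frac_exists; have [gW gWE] := choice gal_frac_exists.
pose R : kalg L := @KAlg L W cstW.
have yC c : (ioF \o kfun pi : {rmorphism coord X -> R}) (coord_str X c) = kstr R c%:A.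
  have := khomP pi c => /= ->.
  by rewrite ioFE map_mpolyC.
have [Pi PiE] := model_universal galL model yC.
have PiC c : Pi (lauC n c) = cstW c by apply: (khomP Pi).
have gWio g x : gW g (ioF x) = ioF x.
  apply: (fraction_hom_eq (f := gW g \o ioF) (g := ioF)) => q /=.
  rewrite ioFE gWE; congr tofrac; apply/mpolyP=> mo.
  by rewrite !mcoeff_map_mpoly /= galr_alg.
exists ioF, (kfun Pi), gW; split=> // g z.
apply: (model_hom_eq model (f := gW g \o kfun Pi) (h := kfun Pi \o lact N g)) => [c|a] /=.
  by rewrite lactC !PiC /cstW /= gWE map_mpolyC.
by rewrite (lact_model model) PiE /= gWio.
Qed.

Variables (E : fieldType) (cst : {rmorphism L -> E}) (vl : {rmorphism lau L n -> E}).
Variable uF : {rmorphism {fraction coord X} -> E}.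
Hypothesis vlC : forall c, vl (lauC n c) = cst c.
Hypothesis vl_u : forall a, vl (u a) = uF (FracField.tofrac a).
Variables (d : nat) (R : {rmorphism {fraction coord X'} -> 'M[{fraction coord X}]_d.+1}).
Hypothesis R_base : forall a, R (FracField.tofrac (f a)) = (FracField.tofrac a)%:M.
Variable S : {rmorphism Y -> 'M[E]_d.+1}.
Hypothesis SC : forall c, S c%:MP = (cst c)%:M.
Hypothesis S_io : forall q, S (io q) = reg uF R (s q).

(** The restriction along s of the pull-back of z is f^* z, whose multiplication matrix is the
    scalar [vl z]. The determinant condition on V makes the restriction meaningful; it survives
    sums, where denominators are multiplied. *)
Lemma pull_ratio (ioF : {rmorphism {fraction {mpoly k[m]}} -> W})
    (Pi : {rmorphism lau L n -> W}) z :
  (forall q, ioF (FracField.tofrac q) = tofrac (io q)) ->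
  (forall c, Pi (lauC n c) = cstW c) -> (forall a, Pi (u a) = ioF (pi a)) ->
  exists U V : Y, [/\ V != 0, \det (S V) != 0, Pi z = tofrac U / tofrac V
    & S U = vl z *: S V].
Proof.
move=> ioFE PiC PiE; have [l ->] := model_span model z.
elim: l => [|[c a] l [U1 [V1 [nz_V1 dV1 Pi1 S1]]]].
  have S1 : S 1 = 1%:M := rmorph1 S.
  by exists 0, 1; rewrite !big_nil !rmorph0 mul0r scale0r S1 det1 !oner_neq0.
rewrite big_cons /=.
have [U2 [V2 [nz_V2 dV2 Pi2 S2]]] : exists U V : Y, [/\ V != 0, \det (S V) != 0,
    Pi (lauC n c * u a) = tofrac U / tofrac V & S U = vl (lauC n c * u a) *: S V].
  (* Definedness at the image of [z0] gives a denominator V whose restriction s V is outside [z0],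
     hence non-zero and invertible as a matrix. *)
  have [z0 z0P] := pi_def; have [U [V [Vz0 piE]]] := z0P a.
  have nz_sV : s V != 0.
    by apply: contraNneq Vz0 => sV0; rewrite inE sV0 rpred0.
  have nz_V : V != 0 by apply: contra nz_sV => /eqP->; rewrite rmorph0.
  have feq := pi_eq nz_sV piE.
  exists (c *: io U), (io V); split.
  - by rewrite -(rmorph0 (map_mpoly (in_alg L))) (inj_eq (@map_mpoly_inj _ _ _ (in_alg L))).
  - by rewrite S_io -unitfE -unitmxE reg_unit.
  - rewrite rmorphM PiC PiE piE fmorph_div !ioFE -mul_mpolyC rmorphM mulrA.
    by [].
  rewrite -mul_mpolyC rmorphM SC -[LHS]/(_ *m _) mul_scalar_mx rmorphM vlC -scalerA.
  congr (_ *: _); rewrite vl_u !S_io.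
  rewrite /reg -map_mxZ; congr map_mx.
  have -> : FracField.tofrac (s U) = FracField.tofrac (f a) * FracField.tofrac (s V).
    by rewrite feq divfK // tofrac_eq0.
  by rewrite rmorphM /= R_base -[LHS]/(_ *m _) mul_scalar_mx.
exists (U1 * V2 + U2 * V1), (V1 * V2); split.
- by rewrite mulf_neq0.
- by rewrite rmorphM det_mulmx mulf_neq0.
- rewrite rmorphD Pi1 Pi2 addrC rmorphD !rmorphM /= addf_div ?tofrac_eq0 //.
have SM x y : S (x * y) = S x *m S y by rewrite rmorphM.
rewrite rmorphD !SM S1 S2 -!scalemxAl -!SM [V2 * V1]mulrC -scalerDl addrC.
by rewrite [in RHS]rmorphD.
Qed.

End Pullback.

Section NormFactorization.
Variables (k : fieldType) (L : splittingFieldType k) (n : nat).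
Local Notation G := (gal_of {:L}%AS).
Variable N : lattice G n.
Variables (E : fieldType) (al : G -> {rmorphism E -> E}).
Hypothesis al1 : forall x, al 1%g x = x.
Hypothesis alM : forall g h x, al (g * h)%g x = al h (al g x).
Variables (cst : {rmorphism L -> E}) (vl : {rmorphism lau L n -> E}).
Hypothesis al_cst : forall g c, al g (cst c) = cst (galr g c).
Hypothesis vl_inj : injective vl.
Hypothesis vlC : forall c, vl (lauC n c) = cst c.
Hypothesis al_vl : forall g z, al g (vl z) = vl (lact N g z).
Hypothesis vl_ratio : forall x : E, exists a b, b != 0 /\ x = vl a / vl b.
Variables m d : nat.
Local Notation Y := {mpoly L[m]}.
Local Notation W := (ratfun L m).
Local Notation tofrac := (@FracField.tofrac Y).
Variable S : {rmorphism Y -> 'M[E]_d.+1}.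
Hypothesis SC : forall c, S c%:MP = (cst c)%:M.
Hypothesis S_al : forall g q, map_mx (al g) (S q) = S (map_mpoly (@galr k L g) q).
Variables (Pi : {rmorphism lau L n -> W}) (gW : G -> {rmorphism W -> W}).
Hypothesis gWE : forall g q, gW g (tofrac q) = tofrac (map_mpoly (@galr k L g) q).
Hypothesis gWPi : forall g z, gW g (Pi z) = Pi (lact N g z).
Hypothesis ratio : forall z, exists U V : Y,
  [/\ V != 0, \det (S V) != 0, Pi z = tofrac U / tofrac V & S U = vl z *: S V].

Local Notation gam g := (map_mpoly (@galr k L g) : {rmorphism Y -> Y}).

Definition nrm (q : Y) : E := \det (S q).

Lemma nrmM q q' : nrm (q * q') = nrm q * nrm q'.
Proof. by rewrite /nrm rmorphM det_mulmx. Qed.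

Lemma nrmC c : nrm c%:MP = cst c ^+ d.+1.
Proof. by rewrite /nrm SC det_scalar. Qed.

Lemma nrm_al g q : al g (nrm q) = nrm (gam g q).
Proof. by rewrite /nrm -det_map_mx S_al. Qed.

Lemma nrm_neq0 q : nrm q != 0 -> q != 0.
Proof.
by apply: contra => /eqP->; rewrite /nrm rmorph0 -[0]/(0 : 'M__) det0.
Qed.

Lemma nrm_prod (I : finType) (F : I -> Y) (e : I -> nat) :
  nrm (\prod_i F i ^+ e i) = \prod_i nrm (F i) ^+ e i.
Proof.
have nrm1 : nrm 1 = 1 by rewrite -mpolyC1 nrmC rmorph1 expr1n.
rewrite (big_morph nrm nrmM nrm1); apply: eq_bigr => i _.
elim: (e i) => [|j IHj]; first by rewrite !expr0.
by rewrite !exprS nrmM IHj.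
Qed.

Definition nat_row r (e : 'I_r -> nat) : 'rV[int]_r := \row_i (e i)%:Z.

Lemma monom_nat (F : fieldType) r (x : 'I_r -> F) e :
  monom x (nat_row e) = \prod_i x i ^+ e i.
Proof. by apply: eq_bigr => i _; rewrite mxE. Qed.

Lemma monomB (F : fieldType) r (x : 'I_r -> F) v v' : (forall i, x i != 0) ->
  monom x (v - v') = monom x v / monom x v'.
Proof.
move=> nz; apply: (mulIf (monom_neq0 nz v')).
by rewrite -monomD // subrK divfK // monom_neq0.
Qed.

Lemma eqcV (x y : E) : eqc cst x y -> eqc cst x^-1 y^-1.
Proof.
case=> c nz ->; exists c^-1; rewrite ?invr_eq0 //.
by rewrite invfM fmorphV.
Qed.

(* The polynomials occurring in the pull-backs of the characters of T factor
   uniquely; P is spanned by their prime factors w_i, and b sends w_i to its norm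
   in E^* / L^*.  The norm of the pull-back of x^v is x^(dv). *)
Lemma norm_factorization p : ~~ (p %| d.+1)%N -> p_factorizable p N.
Proof.
move=> ndp.
pose xi v := vl (lx L v).
have nz_vl z : z != 0 -> vl z != 0 by rewrite -(rmorph0 vl) (inj_eq vl_inj).
have xi0 : xi 0 = 1 by rewrite /xi lx0 rmorph1.
have xiD : {morph xi : v w / v + w >-> v * w} by move=> v w; rewrite /xi lxD rmorphM.
have nz_xi v : xi v != 0.
  have : xi v * xi (- v) != 0 by rewrite -xiD subrr xi0 oner_neq0.
  by rewrite mulf_eq0 negb_or => /andP[].
have al_xi g v : al g (xi v) = xi (v *m N g) by rewrite /xi al_vl lactX.
have exUV l : exists x : Y * Y, [/\ x.2 != 0, nrm x.2 != 0,
    Pi (lx L (delta_mx 0 l)) = tofrac x.1 / tofrac x.2 & S x.1 = xi (delta_mx 0 l) *: S x.2].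
  by have [U [V UV]] := ratio (lx L (delta_mx 0 l)); exists (U, V).
have [x xP] := choice exUV.
have nrmU l : nrm (x l).1 = xi (delta_mx 0 l) ^+ d.+1 * nrm (x l).2.
  by case: (xP l) => _ _ _ SU; rewrite /nrm SU detZ.
have nz_nrmU l : nrm (x l).1 != 0.
  by rewrite nrmU mulf_neq0 ?expf_neq0 //; case: (xP l).
pose xs := [seq (x l).1 | l <- enum 'I_n] ++ [seq (x l).2 | l <- enum 'I_n].
have xs_nrm q : q \in xs -> nrm q != 0.
  by rewrite mem_cat => /orP[] /mapP[l _ ->] //; case: (xP l).
have U_xs l : (x l).1 \in xs by rewrite mem_cat (map_f (fun l => (x l).1)) // mem_enum.
have V_xs l : (x l).2 \in xs by rewrite mem_cat (map_f (fun l => (x l).2)) ?orbT // mem_enum.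
have gam1 q : gam 1%g q = q.
  by apply/mpolyP=> mo; rewrite mcoeff_map_mpoly /= galr1.
have gamM g h q : gam (g * h)%g q = gam h (gam g q).
  by apply/mpolyP=> mo; rewrite !mcoeff_map_mpoly /= galrM.
have [r [w [s [[wP w_assoc] [s1 sM] w_gam [xs_fact w_xs]]]]] :=
  prime_system gam1 gamM (@mpoly_factorial L m) (fun q xq => nrm_neq0 (xs_nrm q xq)).
(* [w i] divides a conjugate of some U or V, and the norms of these are non-zero. *)
have nz_nu i : nrm (w i) != 0.
  have [q xq [g [z Ez]]] := w_xs i.
  have : nrm (gam g q) != 0 by rewrite -nrm_al fmorph_eq0 xs_nrm.
  by rewrite Ez nrmM mulf_eq0 negb_or => /andP[].
have fact q : q \in xs -> exists e, exists2 c, c != 0 & q = c%:MP * \prod_i w i ^+ e i.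
  move=> /xs_fact[u [e [[u' uu'] ->]]].
  by have [c nz ->] := mpoly_unitC (esym uu'); exists e, c.
have [eU eUP] := choice (fun l => fact _ (U_xs l)).
have [eV eVP] := choice (fun l => fact _ (V_xs l)).
pose a : 'M[int]_(n, r) := \matrix_l (nat_row (eU l) - nat_row (eV l)).
pose tw i := tofrac (w i).
have nz_tw i : tw i != 0 by rewrite tofrac_eq0; case: (wP i).
have tw_nat e : tofrac (\prod_i w i ^+ e i) = monom tw (nat_row e).
  by rewrite monom_nat rmorph_prod; apply: eq_bigr => i _; rewrite rmorphXn.
have tofrac_inj : injective tofrac by move=> q q' /eqP; rewrite tofrac_eq => /eqP.
have Pi_row l : eqc (cstW L m) (Pi (lx L (delta_mx 0 l))) (monom tw (row l a)).
  case: (xP l) => _ _ -> _; have [c nz ->] := eUP l; have [c' nz' ->] := eVP l.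
  exists (c / c'); first by rewrite mulf_neq0 ?invr_eq0.
  rewrite rowK monomB // -!tw_nat fmorph_div.
  have tM b q : tofrac (b%:MP * q) = cstW L m b * tofrac q by rewrite rmorphM.
  by rewrite !tM invfM mulrACA.
have Pi_monom v : eqc (cstW L m) (Pi (lx L v)) (monom tw (v *m a)).
  rewrite (hom_mul _ _ (monom0 tw) (monomD nz_tw) (monom_neq0 nz_tw)).
  rewrite -{1}[v]mulmx1 (hom_mul (Th := fun v => Pi (lx L v))).
  - by apply: eqc_monom => l; rewrite row1.
  - by rewrite lx0 rmorph1.
  - by move=> v1 v2; rewrite lxD rmorphM.
  move=> v1; have : Pi (lx L v1) * Pi (lx L (- v1)) != 0.
    by rewrite -rmorphM lx_unit rmorph1 oner_neq0.
  by rewrite mulf_eq0 negb_or => /andP[nz1 _]; exact: nz1.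
have monom_inj v v' : eqc (cstW L m) (monom tw v) (monom tw v') -> v = v'.
  case=> c nz E0; apply/eqP; rewrite -subr_eq0; apply/eqP.
  apply: (prime_exponents tofrac_inj wP w_assoc (e := (c^-1)%:MP)).
    by exists c%:MP; rewrite -mpolyCM mulVf.
  rewrite -[monom _ _]/(monom tw _) monomB // E0 mulfK ?monom_neq0 //.
  by rewrite /cstW /= -rmorphM -mpolyCM mulVf // rmorph1.
have cstWal g c : gW g (cstW L m c) = cstW L m (galr g c).
  by rewrite /cstW /= gWE map_mpolyC.
have a_equiv g : N g *m a = a *m perm_act s g.
  apply/row_matrixP=> l; rewrite !row_mul; apply: monom_inj.
  rewrite rowE; apply: eqc_trans (eqc_sym (Pi_monom _)) _.
  rewrite -lactX -gWPi; apply: eqc_trans (eqc_al cstWal g (Pi_row l)) _.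
  rewrite rmorph_monom (hom_mul _ _ (monom0 tw) (monomD nz_tw) (monom_neq0 nz_tw)).
  apply: eqc_monom => i /=; rewrite rowK monom_delta /tw gWE.
  have [u [u' uu'] ->] := w_gam g i; have [c nz ->] := mpoly_unitC (esym uu').
  by exists c; rewrite // rmorphM.
have al_nu g i : eqc cst (al g (nrm (w i))) (nrm (w (s g i))).
  rewrite nrm_al; have [u [u' uu'] ->] := w_gam g i.
  have [c nz ->] := mpoly_unitC (esym uu').
  by exists (c ^+ d.+1); rewrite ?expf_neq0 // nrmM nrmC rmorphXn.
have nrm_fact q e c : c != 0 -> q = c%:MP * \prod_i w i ^+ e i ->
    eqc cst (nrm q) (monom (nrm \o w) (nat_row e)).
  move=> nz ->; exists (c ^+ d.+1); first by rewrite expf_neq0.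
  by rewrite nrmM nrmC nrm_prod rmorphXn monom_nat.
(* The matrix of U is x^v times that of V, of size d + 1. On determinants this is a factor x^((d+1)
   v), and the norms of V cancel. *)
have nu_a (v : 'rV_n) : eqc cst (monom (nrm \o w) (v *m a)) (xi (v *m (d.+1%:Z)%:M)).
  rewrite (hom_mul _ _ (monom0 _) (monomD nz_nu) (monom_neq0 nz_nu)).
  rewrite (hom_mul _ _ xi0 xiD nz_xi); apply: eqc_monom => l.
  have -> : row l (d.+1%:Z)%:M = d.+1%:Z *: delta_mx 0 l :> 'rV[int]_n.
    by rewrite -scalemx1 linearZ /= row1.
  rewrite rowK monomB // (hom_scale xi0 xiD nz_xi).
  have [c nz EU] := eUP l; have [c' nz' EV] := eVP l.
  apply: eqc_trans (eqcM (eqc_sym (nrm_fact _ _ _ nz EU)) (eqcV (eqc_sym (nrm_fact _ _ _ nz' EV)))) _.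
  rewrite nrmU mulfK; first exact: eqc_refl.
  by case: (xP l).
have exnd i : exists y : lau L n * lau L n, [/\ y.1 != 0, y.2 != 0 & nrm (w i) = vl y.1 / vl y.2].
  case: (vl_ratio (nrm (w i))) => y1 [y2 y12]; exists (y1, y2).
  split; [|exact: y12.1|exact: y12.2].
  apply: contraNneq (nz_nu i) => /= y0; rewrite y12.2 y0 (rmorph0 vl).
  by rewrite mul0r.
have [y yP] := choice exnd.
(* The primes of these numerators and denominators, with their conjugates, form the basis of Q. *)
pose ys := [seq (y i).1 | i <- enum 'I_r] ++ [seq (y i).2 | i <- enum 'I_r].
have nz_ys z : z \in ys -> z != 0.
  by rewrite mem_cat => /orP[] /mapP[i _ ->]; case: (yP i).
have y1_ys i : (y i).1 \in ys by rewrite mem_cat (map_f (fun l => (y l).1)) // mem_enum.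
have y2_ys i : (y i).2 \in ys by rewrite mem_cat (map_f (fun i => (y i).2)) ?orbT // mem_enum.
have [t [w2 [s2 [[w2P w2_assoc] [s21 s2M] w2_lact [ys_fact _]]]]] :=
  prime_system (lact1 N) (lactM N) (@lau_factorial L n) nz_ys.
have nz_w2 i : (vl \o w2) i != 0 by apply: nz_vl; case: (w2P i).
have unitE e : divides e 1 -> exists v, eqc cst (vl e) (xi v).
  move=> /lau_unit_monomial[c [v [nz ->]]]; exists v; exists c => //.
  by rewrite rmorphM vlC.
have fact2 z : z \in ys -> exists v c, eqc cst (vl z) (xi v * monom (vl \o w2) c).
  move=> /ys_fact[e [ex [/unitE[v ev] ->]]]; exists v, (nat_row ex).
  rewrite rmorphM; apply: eqcM ev _; rewrite monom_nat rmorph_prod.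
  rewrite (eq_bigr (fun i => (vl \o w2) i ^+ ex i)); first exact: eqc_refl.
  by move=> i _; rewrite rmorphXn.
have ext (gi : G * 'I_t) : exists v, eqc cst (al gi.1 (vl (w2 gi.2)))
    (xi v * vl (w2 (s2 gi.1 gi.2))).
  case: gi => g i /=; rewrite al_vl; have [e /unitE[v ev] ->] := w2_lact g i.
  by exists v; rewrite rmorphM; apply: eqcM ev (eqc_refl _ _).
have [tau tauP] := choice ext.
apply: (@factorizable_of_units L E G al (@galr k L) cst al_cst n N xi xi0 xiD nz_xi al_xi
  t (vl \o w2) s2 (fun g i => tau (g, i)) nz_w2 s21 s2M _ _ r s (nrm \o w) s1 sM _ al_nu
  a d.+1%:Z p a_equiv nu_a) => //.
- by move=> g i; apply: tauP (g, i).
(* Unique factorization gives c = 0. Then x^v is a constant, and comparing coefficients gives v =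
   0. *)
- move=> v c [e nz_e E0]; rewrite mulr1 in E0.
  have c0 : c = 0.
    apply: (prime_exponents vl_inj w2P w2_assoc (e := lauC n e^-1 * lx L v)).
      exists (lauC n e * lx L (- v)).
      by rewrite mulrACA -rmorphM mulVf // rmorph1 mul1r lx_unit.
    rewrite rmorphM -mulrA -[monom _ _]/(monom (vl \o w2) _) E0 vlC.
    by rewrite -rmorphM mulVf // rmorph1.
  split=> //; move: E0; rewrite c0 monom0 mulr1 -vlC => /vl_inj E0.
  have := lcoefE v (1 : L) v; rewrite rmorph1 !mul1r E0 -[lauC n e]mulr1 -(lx0 L n) lcoefE.
  case: eqP => [->//|_]; rewrite mulr0 eqxx => /eqP.
  by rewrite eq_sym oner_eq0.
move=> i; case: (yP i) => _ _ /= ->.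
have [v1 [c1 E1]] := fact2 _ (y1_ys i); have [v2 [c2 E2]] := fact2 _ (y2_ys i).
exists (v1 - v2), (c1 - c2); rewrite monomB //.
have -> : xi (v1 - v2) = xi v1 / xi v2.
  by apply: (mulIf (nz_xi v2)); rewrite -xiD subrK divfK.
by rewrite mulrACA -invfM; apply: eqcM E1 (eqcV E2).
Qed.

End NormFactorization.

Lemma retract_rational_factorizable (k : fieldType) (L : splittingFieldType k) n
    (N : lattice (gal_of {:L}%AS) n) (X : affvar k)
    (u : {rmorphism coord X -> lau L n}) p :
  galois 1%AS {:L}%AS -> torus_model N (coord_str X) u ->
  p_retract_rational p X -> p_factorizable p N.
Proof.
move=> galL model [m [X' [f [_ f_dom [[|d] [f_deg ndp]] [s [pi [pi_def pi_eq]]]]]]].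
  (* Degree 0 is excluded because p divides 0; from here on the degree is [d.+1]. *)
  by rewrite dvdn0 in ndp.
pose vl : {rmorphism lau L n -> ratfun L n} := @subring_val _ _ (loc_closed (lauD L n)).
pose cst : {rmorphism L -> ratfun L n} := vl \o @lauC L n.
have al_cst g c : ract N g (cst c) = cst (galr g c) by apply: ract_C.
have vl_u a : vl (u a) = uF model (FracField.tofrac a) by rewrite uF_frac.
have uF_str c : uF model (FracField.tofrac (coord_str X c)) = cst c%:A.
  by rewrite -vl_u; case: (model) => -> _ _.
have [R R_base] := regular_representation f_dom f_deg.
have [S [SC S_io S_al]] := scalar_extension al_cst uF_str (ract_uF model) R_base s.
have [ioF [Pi [gW [ioFE PiC PiE gWE gWPi]]]] := torus_pull galL model pi.
have vlC c : vl (lauC n c) = cst c by [].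
have ratio z := pull_ratio model pi_def pi_eq vlC vl_u R_base SC S_io z ioFE PiC PiE.
exact: (norm_factorization (@ract1 k L n N) (@ractM k L n N) al_cst val_inj vlC
  (@ract_val k L n N) (@lau_ratio L n) SC S_al gWE gWPi ratio ndp).
Qed.

Theorem proposition3p1
  (k : fieldType)
  (ks : fieldType) (i : {rmorphism k -> ks}) (ks_closure : is_sep_closure i)
  (p : nat) (p_prime : prime p)
  (T : groupvar k) (T_torus : is_torus i T)
  (n : nat) (That : gal_lattice i n) (That_char : is_character_lattice T That) :
  (p_retract_rational p T <-> torus_flasque_class_p_invertible T p That) /\
  (torus_flasque_class_p_invertible T p That <-> p_factorization p That).
Proof.
have [ev [evU evD evA]] := That_char.
have [u [evu uU]] := lattice_universal_point T_torus evU evD.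
(* The finite set S leaves room to enlarge L so that the lattices of a given diagram become
   Gal(L/k)-lattices. *)
have cover (S : seq ks) : exists (L : splittingFieldType k) (e : {rmorphism L -> ks})
    (N : lattice (gal_of {:L}%AS) n) (uL : {rmorphism coord T -> lau L n}),
    [/\ galois 1%AS {:L}%AS /\ (forall c : k, e c%:A = i c), split_over T (in_alg L),
        forall x, x \in S -> exists y, e y = x, deflation e That N
      & torus_model N (coord_str T) uL].
  have [L [e [N [uL [eL [[galL eC Se TN] [model eLC eLX eLu]]]]]]] :=
    torus_model_exists ks_closure evA evu uU S.
  exists L, e, N, uL; split=> //.
  exact: (split_over_finite evu uU galL eC model eLC eLX eLu).
have factL : p_factorization p That -> exists (L : splittingFieldType k)
    (e : {rmorphism L -> ks}) (N : lattice (gal_of {:L}%AS) n)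
    (uL : {rmorphism coord T -> lau L n}),
    [/\ galois 1%AS {:L}%AS /\ (forall c : k, e c%:A = i c), split_over T (in_alg L),
        deflation e That N, torus_model N (coord_str T) uL & p_factorizable p N].
  move=> /(factorization_open ks_closure)[S SP].
  have [L [e [N [uL [[galL eC] sT Se TN model]]]]] := cover S.
  by exists L, e, N, uL; split=> //; apply: SP eC Se TN.
have three_of_two := flasque_class_factorization p_prime (T := T) (That := That).
split; split=> //.
- move=> retr; have [L [e [N [uL [[galL eC] sT _ TN model]]]]] := cover [::].
  exists L, e, N; split=> //; apply: factorizable_flasque_class => //.
  exact: retract_rational_factorizable galL model retr.
- move=> /three_of_two/factL[L [e [N [uL [[galL _] _ _ model pN]]]]].
  exact: factorizable_retract_rational galL model p_prime pN.
move=> /factL[L [e [N [uL [eC sT TN _ pN]]]]].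
by exists L, e, N; split=> //; apply: factorizable_flasque_class.
Qed.
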